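(* Let $a,b\ge2$ be integers and $p,p'\in(0,1]$. Let $E_{a,p}$ and $E_{b,p'}$ be two independent Mandelbrot percolations on the interval $[0,1]$ along the $a$-adic and $b$-adic grids respectively. If $\log a/\log b$ is irrational, then almost surely conditioned on $E_{a,p}\neq \emptyset$ and $E_{b,p'}\neq \emptyset$, for all $s\in\mathbb{R}$ with $s\neq 0$, $$\dim (E_{a,p}+sE_{b,p'})=\min\{1,\dim E_{a,p}+\dim E_{b,p'}\}=\min\left\{1,2+\frac{\log p}{\log a}+\frac{\log p'}{\log b}\right\}.$$
   Context: Let $\Sigma_a^+=\{1,\dots,a\}^{\mathbb{N}}$ and let $\{V_u\}$, indexed by the finite words $u$ in the letters $1,\dots,a$, be i.i.d. with $V_u=1/p$ with probability $p$ and $V_u=0$ with probability $1-p$. Set $\Sigma_{a,p}^+=\{i_1i_2\cdots\in\Sigma_a^+:V_{i_1}V_{i_1i_2}\cdots V_{i_1\cdots i_n}>0\text{ for all }n\ge1\}$. Let $\bm{I}_a=\{f_i(x)=a^{-1}x+(i-1)a^{-1}\}_{i=1}^a$ and $\Phi_{\bm{I}_a}(i_1i_2\cdots)=\lim_{n\to\infty}f_{i_1}\circ\cdots\circ f_{i_n}(0)$. Then $E_{a,p}=\Phi_{\bm{I}_a}(\Sigma_{a,p}^+)\subset[0,1]$. $E_{b,p'}$ is defined in the same way with $b,p'$ and an independent family of weights. $X+sY=\{x+sy:x\in X,y\in Y\}$. For a set $E$, $\dim E$ denotes the common value of its box-counting and Hausdorff dimensions; writing $\dim E$ asserts that they are equal.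 *)

(* Defs.v *)
From HB Require Import structures.
From mathcomp Require Import all_boot all_order all_algebra.
From mathcomp Require Import all_classical all_reals all_analysis.

Set Implicit Arguments.
Unset Strict Implicit.
Unset Printing Implicit Defensive.

Import Order.TTheory GRing.Theory Num.Theory.
Import numFieldNormedType.Exports.

Local Open Scope classical_set_scope.
Local Open Scope ring_scope.

Section Dimension.
Context {R : realType}.
Implicit Types (E U : set R) (s delta : R).
Local Open Scope ereal_scope.

(* Pitfall: [diam set0 = -oo]. *)
Definition diam U : \bar R :=
  ereal_sup [set `|x - y|%:E | x in U & y in U].

(* Empty members are skipped, so that they contribute 0 even when s = 0. *)
Definition hausdorff_premeasure delta s E : \bar R :=
  ereal_inf [set \sum_(0 <= i <oo | U i != set0) diam (U i) `^ s
            | U in [set U : nat -> set R |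
                    (forall i, diam (U i) <= delta%:E) /\
                    E `<=` \bigcup_i U i]].

Definition hausdorff_measure s E : \bar R :=
  ereal_sup [set hausdorff_premeasure delta s E
            | delta in [set delta | (0 < delta)%R]].

Definition hausdorff_dim E : \bar R :=
  ereal_inf [set s%:E | s in [set s | (0 <= s)%R /\ hausdorff_measure s E = 0]].

(* Least number of sets of diameter at most delta that cover E;
   +oo if there is no finite cover. *)
Definition covering_number E delta : \bar R :=
  ereal_inf [set (n%:R)%:E | n in [set n : nat |
    exists U : 'I_n -> set R,
      (forall i, diam (U i) <= delta%:E) /\ E `<=` \bigcup_i U i]].

Definition box_ratio E delta : \bar R :=
  lne (covering_number E delta) * ((- ln delta)^-1)%:E.

Definition lower_box_dim E : \bar R := limf_einf (box_ratio E) 0^'+.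

Definition upper_box_dim E : \bar R := limf_esup (box_ratio E) 0^'+.

Definition has_dim E : Prop :=
  lower_box_dim E = hausdorff_dim E /\ upper_box_dim E = hausdorff_dim E.

(* Only meaningful together with [has_dim E]. *)
Definition fractal_dim E : \bar R := hausdorff_dim E.

End Dimension.

Section Independence.
Context {d : measure_display} {T : measurableType d} {R : realType}.
Variable P : probability T R.

Definition mutually_independent (I : eqType) (X : I -> {RV P >-> R}) : Prop :=
  forall (r : seq I) (B : I -> set R), uniq r -> (forall i, measurable (B i)) ->
    P (\bigcap_(i in [set` r]) (X i @^-1` B i)) =
    (\prod_(i <- r) P (X i @^-1` B i))%E.

Definition family_sigma_algebra (I : Type) (X : I -> {RV P >-> R}) :
    set (set T) :=
  <<s \bigcup_i preimage_set_system setT (X i) measurable >>.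

Definition independent_families (I J : Type)
    (X : I -> {RV P >-> R}) (Y : J -> {RV P >-> R}) : Prop :=
  forall A B : set T,
    family_sigma_algebra X A -> family_sigma_algebra Y B ->
    P (A `&` B) = (P A * P B)%E.

End Independence.

(* The letters 1, ..., a are encoded by 'I_a, the letter i being the ordinal
   of value i - 1; finite words are sequences and the prefix i_1 ... i_n of an
   infinite word i is [mkseq i n]. *)
Section Mandelbrot.
Context {d : measure_display} {T : measurableType d} {R : realType}.
Variable P : probability T R.

Definition mandelbrot_weights (a : nat) (p : R)
    (V : seq 'I_a -> {RV P >-> R}) : Prop :=
  (forall u, P (V u @^-1` [set p^-1]) = p%:E /\
             P (V u @^-1` [set 0]) = (1 - p)%:E) /\
  mutually_independent V.

Definition adic_map (a : nat) (j : 'I_a) (x : R) : R :=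
  a%:R^-1 * x + j%:R * a%:R^-1.

Definition coding_map (a : nat) (i : nat -> 'I_a) : R :=
  limn (fun n => foldr (@adic_map a) 0 (mkseq i n)).

Definition surviving_words (a : nat) (V : seq 'I_a -> {RV P >-> R}) (w : T) :
    set (nat -> 'I_a) :=
  [set i | forall n, (1 <= n)%N ->
    0 < \prod_(1 <= k < n.+1) V (mkseq i k) w].

Definition percolation_set (a : nat) (V : seq 'I_a -> {RV P >-> R}) (w : T) :
    set R :=
  @coding_map a @` surviving_words V w.

End Mandelbrot.

Definition scaled_sum {R : realType} (X : set R) (s : R) (Y : set R) : set R :=
  [set x + s * y | x in X & y in Y].

(* Main.v *)
(** The upper bounds are a first moment computation. For the lower bounds, write
    [al = 1 + ln p / ln a] and [be = 1 + ln p' / ln b].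

    The surviving words form a Galton-Watson tree. By the second moment method and
    the convexity of the offspring generating function, on survival some vertex is
    almost surely the root of a subtree in which each vertex has at least
    [K ~ a^(al L)] descendants [L] levels further down. Equal splitting of the mass
    along this subtree gives every word of length [k] mass of order at most
    [a^(- k g)], for any [g < al].

    At scale [2^-n], the number of pairs of surviving words of both trees whose
    cells meet a strip [|x + s y - c| <= M 2^-n] has moments of any order bounded by
    powers of [n^2 2^(n h)], with [h = max 0 (al + be - 1)]: a new pair whose
    coordinates leave the tree of the previous ones [k] and [m] levels above the
    bottom costs [p^k p'^m], and there are at most a constant times
    [min (a^k, b^m) <= a^(k (1 - al)) b^(m al)] of them. Markov's inequality for a
    high moment beats the polynomial number of strips in a [2^-n]-net of parameters
    [(s, c)], so that almost surely, for all [s <> 0] simultaneously, every strip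
    carries at most [2^(n (h + e))] pairs. Hence the projection of the product of the
    two equally split masses gives intervals of length [2^-n] mass at most
    [2^(- n (al + be - h - 3 e))], where [al + be - h = min 1 (al + be)]. *)

Require Import Defs.
From HB Require Import structures.
From mathcomp Require Import all_boot all_order all_algebra.
From mathcomp Require Import all_classical all_reals all_analysis.
From mathcomp Require Import finmap measurable_realfun zify ring lra.
Set Implicit Arguments.
Unset Strict Implicit.
Unset Printing Implicit Defensive.
Import Order.TTheory GRing.Theory Num.Theory.
Import numFieldNormedType.Exports.
Local Open Scope classical_set_scope.
Local Open Scope ring_scope.

(** * Hausdorff dimension and mass distribution *)

Section dimension.
Context {R : realType}.
Implicit Types (A E U : set R) (s t delta : R).

(** The obstacle is the quantifier over all [s]: independence yields statements that hold almost
    surely for one [s], whereas one null set has to serve uncountably many. The masses on the two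
    trees are therefore chosen without reference to [s], and the only statement needed for every [s]
    is a count of cells, which is stable under small changes of [(s, c)] and so can be read off from
    a net. The mass of an interval is then bounded by the number of cell pairs lying over it times
    the mass of the heaviest pair; no finer information on the joint behaviour of the two masses
    enters.

    Limit measures are never constructed. A mass is the uniform measure on a finite family of
    infinite words, regular down to a prescribed level; compactness turns any countable cover into a
    finite one, for which a sufficiently deep level is enough. On the probabilistic side, the basic
    events depend on finitely many words, and infinite statements are reached by monotone limits,
    Borel-Cantelli and countable intersections. *)

Lemma diam_ge0 U : U !=set0 -> (0 <= diam U)%E.
Proof.
move=> [x Ux]; apply: le_ereal_sup_tmp; exists `|x - x|%:E => //.
by exists x => //; exists x.
Qed.

Lemma diam_ub U x y : U x -> U y -> (`|x - y|%:E <= diam U)%E.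
Proof. by move=> Ux Uy; apply: ereal_sup_ubound; exists x => //; exists y. Qed.

Lemma diam_le U (M : \bar R) :
  (forall x y, U x -> U y -> (`|x - y|%:E <= M)%E) -> (diam U <= M)%E.
Proof. by move=> H; apply: ge_ereal_sup => _ [x Ux [y Uy <-]]; exact: H. Qed.

Lemma diam_ler_powR s t (x : \bar R) : 0 <= s -> s <= t ->
  (0 <= x <= 1)%E -> (x `^ t <= x `^ s)%E.
Proof.
case: x => [x| |] s0 st; [rewrite !lee_fin|by rewrite leye_eq andbF|by []].
move=> /andP[x0 x1].
move: x0; rewrite le_eqVlt => /predU1P[<-|x0].
  have [->|s1] := eqVneq s 0.
    by rewrite powRr0 [X in X <= _]/powR eqxx; case: eqP.
  rewrite powR0 ?gt_eqF ?powR_ge0// (lt_le_trans _ st)//.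
  by rewrite lt_def s1.
by apply: ger_powR => //; rewrite x0.
Qed.

Lemma hausdorff_premeasure_ge0 delta s A : (0 <= hausdorff_premeasure delta s A)%E.
Proof.
apply: le_ereal_inf_tmp => _ [U _ <-]; apply: nneseries_ge0 => *.
exact: poweR_ge0.
Qed.

(** Positivity at the single scale 1 is enough: sets of diameter at most 1 satisfy
    [diam ^ t <= diam ^ s] for [s < t], so a vanishing [s]-dimensional measure would force the
    [t]-premeasure at scale 1 to vanish too. *)
Lemma hausdorff_dim_ge A t :
  (0 < hausdorff_premeasure 1 t A)%E -> (t%:E <= hausdorff_dim A)%E.
Proof.
move=> t0; apply: le_ereal_inf_tmp => _ [s [s0 Hs] <-]; rewrite lee_fin.
rewrite leNgt; apply/negP => st; move: t0; apply/negP; rewrite -leNgt.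
apply: (@le_trans _ _ (hausdorff_premeasure 1 s A)); last first.
  by rewrite -Hs; apply: ereal_sup_ubound; exists 1 => //=.
apply: le_ereal_inf_tmp => _ [U [U1 AU] <-].
apply: (@le_trans _ _ (\sum_(0 <= i <oo | U i != set0) diam (U i) `^ t)%E).
  by apply: ereal_inf_lbound; exists U.
apply: lee_nneseries => [i _ _|i /set0P Ui]; first exact: poweR_ge0.
by apply: diam_ler_powR => //; [exact: ltW|rewrite diam_ge0 //= U1].
Qed.

Lemma le_hausdorff_dim_approx A (h : R) :
  (forall t, 0 < t -> t < h -> (t%:E <= hausdorff_dim A)%E) ->
  (h%:E <= hausdorff_dim A)%E.
Proof.
move=> H.
have dim0 : (0 <= hausdorff_dim A)%E.
  by apply: le_ereal_inf_tmp => _ [s [s0 _] <-]; rewrite lee_fin.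
have [h0|h0] := leP h 0; first by rewrite (le_trans _ dim0)// lee_fin.
apply/lee_subgt0Pr => e e0; rewrite -EFinD.
have [eh|eh] := leP h e; first by rewrite (le_trans _ dim0)// lee_fin; lra.
by apply: H; lra.
Qed.

Lemma dyadic_scale (rho : R) : 0 < rho -> rho <= 1 ->
  exists n : nat, 2^-1 ^+ n.+1 < rho <= 2^-1 ^+ n.
Proof.
move=> r0 r1.
have ex : exists n, 2^-1 ^+ n.+1 < rho.
  have [n _ /(_ n (leqnn _)) /= H] := near_infty_natSinv_expn_lt (PosNum r0).
  exists n; rewrite (le_lt_trans _ H)//.
  rewrite div1r exprVn lef_pV2 ?posrE ?exprn_gt0//.
  by rewrite ler_eXn2l// ltr1n.
exists (ex_minn ex); case: ex_minnP => n -> /= nmin.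
case: n nmin => [|n] nmin; first by rewrite expr0.
by rewrite leNgt; apply/negP => /nmin; rewrite ltnn.
Qed.


(* Each ball of the cover is fattened so that its radius [rho i] satisfies
   [rho i `^ t = diam (U i) `^ t + k 2^-i]: the fattening is open, and its cost
   is controlled without any continuity of the power. *)
Lemma mass_distribution A t (C : R) : 0 < t -> 0 < C -> compact A ->
  (forall N : nat, exists (J : finType) (pt : J -> R),
    [/\ (0 < #|J|)%N, (forall j, A (pt j)) &
        forall n c, (n <= N)%N ->
          #|[pred j | `|pt j - c| <= 2^-1 ^+ n]|%:R <=
            C * (2^-1 ^+ n) `^ t * #|J|%:R]) ->
  (t%:E <= hausdorff_dim A)%E.
Proof.
move=> t0 C0 cA HJ; apply: hausdorff_dim_ge.
pose D := 2 `^ t * C.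
have D0 : 0 < D by rewrite mulr_gt0// powR_gt0.
(* If the [t]-sum of the cover is below [k], the values [rho i ^ t] add up to less than [k + 2 k]. A
   ball of radius [rho i] carries mass at most [D rho i ^ t], so [3 k D < 1] contradicts total mass
   1. The bound [k <= 1/4] keeps all radii at most 1. *)
pose k := (4 * D + 4)^-1.
have k0 : 0 < k by rewrite invr_gt0; lra.
have k4 : k <= 4^-1 by rewrite /k lef_pV2 ?posrE//; lra.
have kD : 3 * k * D < 1.
  rewrite /k mulrAC -[_ * _ / _]/(_ / _) ltr_pdivrMr; lra.
apply: (@lt_le_trans _ _ k%:E); first by rewrite lte_fin.
apply: le_ereal_inf_tmp => _ [U [U1 AU] <-].
rewrite leNgt; apply/negP => sumk.
pose dt i := if U i != set0 then fine (diam (U i)) `^ t else 0.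
have dt_ge0 i : 0 <= dt i by rewrite /dt; case: ifP => // _; exact: powR_ge0.
have diamE i : U i !=set0 -> diam (U i) = (fine (diam (U i)))%:E.
  move=> Ui; rewrite fineK// ge0_fin_numE ?diam_ge0//.
  by rewrite (le_lt_trans (U1 i))// ltry.
have sumdt n : \sum_(i < n) dt i < k.
  rewrite -lte_fin; apply: le_lt_trans sumk.
  apply: le_trans (nneseries_lim_ge n _); last by move=> *; exact: poweR_ge0.
  rewrite -sumEFin big_mkord [leRHS]big_mkcond/=; apply: lee_sum => i _.
  rewrite /dt; case: ifP => // /set0P Ui; rewrite [in leRHS]diamE//.
have dtk i : dt i < k.
  apply: le_lt_trans (sumdt i.+1); rewrite big_ord_recr/= lerDr.
  by apply: sumr_ge0.
pose rho i := (dt i + k * 2^-1 ^+ i) `^ t^-1.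
have rt0 i : 0 < dt i + k * 2^-1 ^+ i.
  by rewrite ltr_wpDl// mulr_gt0// exprn_gt0.
have rho0 i : 0 < rho i by rewrite powR_gt0.
have rhot i : rho i `^ t = dt i + k * 2^-1 ^+ i.
  by rewrite /rho -powRrM mulVf ?gt_eqF// powRr1// ltW.
have rho1 i : rho i <= 1.
  have -> : 1 = 1 `^ t^-1 :> R by rewrite powR1.
  rewrite ge0_ler_powR ?nnegrE ?invr_ge0// ltW//.
  have : (2^-1 : R) ^+ i <= 1 by rewrite exprn_ile1//; lra.
  have := dtk i; nra.
have /choice[n Hn] : forall i, exists n, 2^-1 ^+ n.+1 < rho i <= 2^-1 ^+ n.
  by move=> i; exact: dyadic_scale.
have /choice[c Hc] : forall i, exists x, U i !=set0 -> U i x.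
  move=> i; have [[x Ux]|Ui] := pselect (U i !=set0); first by exists x.
  by exists 0.
have Ub i x : U i x -> `|x - c i| < rho i.
  move=> Ux; have Ui : U i !=set0 by exists x.
  have /andP[d0 dr] : 0 <= fine (diam (U i)) < rho i.
    rewrite fine_ge0 ?diam_ge0//= ltNge; apply/negP => rd.
    have := @ge0_ler_powR _ t (ltW t0) (rho i) (fine (diam (U i))).
    rewrite !nnegrE => /(_ (ltW (rho0 i)) (le_trans (ltW (rho0 i)) rd) rd).
    rewrite rhot /dt ifT; last exact/set0P.
    by apply/negP; rewrite -ltNge ltrDl mulr_gt0// exprn_gt0.
  apply: le_lt_trans dr; rewrite -lee_fin -diamE//; apply: diam_ub => //.
  exact: Hc.
move: cA; rewrite compact_cover => /(_ nat setT (fun i => ball (c i) (rho i))).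
case=> [i _|x /AU[i _ /Ub xU]|F _ AF]; first exact: ball_open.
  by exists i => //; rewrite /ball/= distrC.
pose M := (\max_(i <- F) i).+1.
have AM x : A x -> exists2 i : 'I_M, true & `|x - c i| < rho i.
  move=> /AF[i /= iF]; rewrite /ball/= distrC => xc.
  have iM : (i < M)%N by rewrite ltnS; apply: leq_bigmax_seq.
  by exists (Ordinal iM).
(* The depth is fixed only now: finitely many radii are left, and a family regular down to the
   smallest of their dyadic scales suffices. *)
have [J [pt [J0 Apt cnt]]] := HJ (\max_(i < M) n i)%N.
have /choice[ix Hix] : forall j, exists i : 'I_M, `|pt j - c i| < rho i.
  by move=> j; have [i _ ?] := AM _ (Apt j); exists i.
have : #|J|%:R <= \sum_(i < M) C * (2^-1 ^+ (n i)) `^ t * (#|J|%:R : R).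
  rewrite -[in leLHS]sum1_card (partition_big ix xpredT)//= natr_sum; apply: ler_sum => i _.
  apply: le_trans (cnt (n i) (c i) _); last by apply: (leq_bigmax_cond (F := fun i : 'I_M => n i)).
  rewrite sum1_card ler_nat; apply: subset_leq_card; apply/fintype.subsetP => j.
  rewrite !inE => /eqP ji; rewrite -ji (le_trans (ltW (Hix j)))//.
  by have /andP[] := Hn (ix j).
apply/negP; rewrite -ltNge -mulr_suml -[ltRHS]mul1r ltr_pM2r ?ltr0n//.
apply: le_lt_trans kD.
have : \sum_(i < M) C * (2^-1 ^+ n i) `^ t <= D * \sum_(i < M) (dt i + k * 2^-1 ^+ i).
  rewrite mulr_sumr; apply: ler_sum => i _; rewrite -rhot /D -mulrA mulrCA.
  rewrite ler_pM2l// -powRM ?(ltW (rho0 i))//.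
  apply: ge0_ler_powR; rewrite ?nnegrE ?exprn_ge0 ?(ltW t0)//.
    by rewrite mulr_ge0 ?(ltW (rho0 i)).
  have /andP[+ _] := Hn i; rewrite exprS; lra.
move=> /le_trans; apply; rewrite [leRHS]mulrC ler_wpM2l ?(ltW D0)//.
rewrite big_split/= -mulr_sumr.
have -> : 3 * k = k + k * 2 by ring.
rewrite lerD ?(ltW (sumdt M))// ler_wpM2l ?(ltW k0)//.
have := @geometric_le_lim R M 1 2^-1 ler01; rewrite /series/= big_mkord.
rewrite ger0_norm ?invr_ge0// div1r => /(_ _ _) H.
rewrite (_ : \sum_(i < M) _ = \sum_(i < M) geometric 1 2^-1 i).
  have E : (1 - 2^-1)^-1 = 2 :> R by field.
  by apply: le_trans (H _ _) _; rewrite ?E//; lra.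
by apply: eq_bigr => i _; rewrite /= mul1r.
Qed.

End dimension.

(** * Box dimensions *)

Section box_dimension.
Context {R : realType}.
Implicit Types (A E U : set R) (s t delta : R).

Lemma covering_number_ge0 A delta : (0 <= covering_number A delta)%E.
Proof. by apply: le_ereal_inf_tmp => _ [n _ <-]; rewrite lee_fin. Qed.

Lemma hausdorff_premeasure_le_covering A delta t : 0 < t -> 0 < delta ->
  (hausdorff_premeasure delta t A <= covering_number A delta * (delta `^ t)%:E)%E.
Proof.
move=> t0 d0; rewrite -lee_pdivrMr ?powR_gt0//.
apply: le_ereal_inf_tmp => _ [n [U [Ud AU]] <-].
rewrite lee_pdivrMr ?powR_gt0//.
(* The finite cover is padded with empty sets, which the sum skips. *)
pose W i := if insub i is Some j then U j else set0.
have Wn i : (n <= i)%N -> W i = set0 by move=> ni; rewrite /W insubF// ltnNge ni.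
apply: (@le_trans _ _ (\sum_(0 <= i <oo | W i != set0) diam (W i) `^ t)%E).
  apply: ereal_inf_lbound; exists W => //; split=> [i|x /AU[i _ Ui]].
    rewrite /W; case: insubP => [j _ _|_]; first exact: Ud.
    by apply: diam_le => x y [].
  by exists (nat_of_ord i) => //; rewrite /W valK.
apply: lime_le; first by apply: is_cvg_nneseries => *; exact: poweR_ge0.
near=> k; have nk : (n <= k)%N by near: k; exact: nbhs_infty_ge.
rewrite (big_cat_nat _ nk)//= [X in (_ + X)%E]big1_seq ?adde0; last first.
  by move=> i /andP[+ +]; rewrite mem_index_iota => + /andP[/Wn Wi _] => /eqP/(_ Wi).
rewrite -EFinM mulr_natl -[n in _ *+ n]card_ord -sumr_const -sumEFin.
rewrite big_mkord big_mkcond/=; apply: lee_sum => i _.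
case: ifPn => [/set0P Wi|_]; last by rewrite lee_fin powR_ge0.
rewrite -poweR_EFin; apply: gt0_ler_poweR; rewrite ?(ltW t0)// ?in_itv/= ?leey ?andbT.
- exact: diam_ge0.
- by rewrite lee_fin ltW.
- by rewrite /W valK.
Unshelve. all: by end_near. Qed.

Lemma nbhs_right0_oo (d : R) : 0 < d -> nbhs (0 : R)^'+ [set x | 0 < x < d].
Proof.
move=> d0; near=> x => /=; apply/andP; split; near: x; first exact: nbhs_right_gt.
exact: nbhs_right_lt.
Unshelve. all: by end_near. Qed.

(** Lets a multiplicative constant in a covering bound cost only an additive [e] in the box
    ratio. *)
Lemma ln_negligible (c e : R) : 0 < e -> exists2 d : R, 0 < d &
  forall x, 0 < x < d -> 0 < - ln x /\ `|ln c| <= e * - ln x.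
Proof.
move=> e0; exists (Num.min 2^-1 (expR (- (`|ln c| / e)))).
  by rewrite lt_min invr_gt0 ltr0n expR_gt0.
move=> x /andP[x0]; rewrite lt_min => /andP[x1 x2]; split.
  by rewrite oppr_gt0 ln_lt0// x0/=; lra.
rewrite mulrC -ler_pdivrMr// lerNr -[leRHS]expRK ler_ln ?posrE ?expR_gt0//.
exact: ltW.
Qed.

Lemma lower_box_dim_ge A t (c d : R) : 0 < c -> 0 < d ->
  (forall x, 0 < x < d -> ((c * x `^ - t)%:E <= covering_number A x)%E) ->
  (t%:E <= lower_box_dim A)%E.
Proof.
move=> c0 d0 H; apply/lee_subgt0Pr => e e0; rewrite /lower_box_dim limf_einfE.
have [d' d'0 Hd'] := ln_negligible c e0.
apply: le_ereal_sup_tmp.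
exists (ereal_inf (box_ratio A @` [set x | 0 < x < Num.min d d'])).
  exists [set x | 0 < x < Num.min d d'] => //.
  by apply: nbhs_right0_oo; rewrite lt_min d0.
apply: le_ereal_inf_tmp => _ [x /= /andP[x0 xdd] <-].
move: xdd; rewrite lt_min => /andP[xd xd'].
have [|lx lc] := Hd' x; first by rewrite x0.
rewrite /box_ratio lee_pdivlMr//.
have Hx : ((c * x `^ - t)%:E <= covering_number A x)%E by apply: H; rewrite x0.
have cx0 : 0 < c * x `^ - t by rewrite mulr_gt0// powR_gt0.
apply: (@le_trans _ _ (lne (c * x `^ - t)%:E)); last first.
  by rewrite lee_lne// in_itv/= ?covering_number_ge0 ?leey// lee_fin ltW.
rewrite lne_EFin// lnM ?posrE ?powR_gt0// ln_powR -EFinB -EFinM lee_fin.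
have : - ln c <= `|ln c| by rewrite -normrN ler_norm.
lra.
Qed.

Lemma upper_box_dim_le A t (c d : R) : 0 < c -> 0 < d ->
  (forall x, 0 < x < d -> (covering_number A x <= (c * x `^ - t)%:E)%E) ->
  (upper_box_dim A <= t%:E)%E.
Proof.
move=> c0 d0 H; apply/lee_addgt0Pr => e e0; rewrite /upper_box_dim limf_esupE.
have [d' d'0 Hd'] := ln_negligible c e0.
apply: (@le_trans _ _ (ereal_sup (box_ratio A @` [set x | 0 < x < Num.min d d']))).
  apply: ereal_inf_lbound.
  exists [set x | 0 < x < Num.min d d'] => //.
  by apply: nbhs_right0_oo; rewrite lt_min d0.
apply: ge_ereal_sup => _ [x /= /andP[x0 xdd] <-].
move: xdd; rewrite lt_min => /andP[xd xd'].
have [|lx lc] := Hd' x; first by rewrite x0.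
rewrite /box_ratio lee_pdivrMr//.
have Hx : (covering_number A x <= (c * x `^ - t)%:E)%E by apply: H; rewrite x0.
have cx0 : 0 < c * x `^ - t by rewrite mulr_gt0// powR_gt0.
apply: (@le_trans _ _ (lne (c * x `^ - t)%:E)).
  by rewrite lee_lne// in_itv/= ?covering_number_ge0 ?leey// lee_fin ltW.
rewrite lne_EFin// lnM ?posrE ?powR_gt0// ln_powR -EFinD -EFinM lee_fin.
have : ln c <= `|ln c| by rewrite ler_norm.
lra.
Qed.

Lemma lower_le_upper_box_dim A : (lower_box_dim A <= upper_box_dim A)%E.
Proof.
rewrite /lower_box_dim /upper_box_dim limf_einfE limf_esupE.
apply: ge_ereal_sup => _ [V V0 <-]; apply: le_ereal_inf_tmp => _ [W W0 <-].
have /filter_ex[x [Vx Wx]] : nbhs (0 : R)^'+ (V `&` W) by exact: filterI.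
apply: (@le_trans _ _ (box_ratio A x)).
  by apply: ereal_inf_lbound; exists x.
by apply: ereal_sup_ubound; exists x.
Qed.

(** The premeasure grows as the scale shrinks: if it is at least [c > 0] at scale [d0], then for
    [x < d0] a cover by sets of diameter at most [x] has at least [c x^(-t)] members. Nonemptiness
    makes covering numbers at least 1, which settles [t <= 0]. *)
Lemma hausdorff_dim_le_lower A : A !=set0 -> (hausdorff_dim A <= lower_box_dim A)%E.
Proof.
move=> A0.
have N1 x : 0 < x -> (1 <= covering_number A x)%E.
  move=> x0; apply: le_ereal_inf_tmp => _ [[|n] [U [_ AU]] <-].
    by case: A0 => y /AU[[]].
  by rewrite lee_fin ler1n.
have L0 : (0 <= lower_box_dim A)%E.
  apply: (@lower_box_dim_ge A 0 1 1) => // x /andP[x0 _].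
  by rewrite oppr0 powRr0 mul1r N1.
have Hpos t : 0 < t -> (t%:E < hausdorff_dim A)%E -> (t%:E <= lower_box_dim A)%E.
  move=> t0 tH.
  have Ht : hausdorff_measure t A != 0%E.
    apply: contraTneq tH => Ht; rewrite -leNgt; apply: ereal_inf_lbound.
    by exists t => //; split => //; exact: ltW.
  have [d0 [d00 Hd0]] : exists d0 : R, 0 < d0 /\ (0 < hausdorff_premeasure d0 t A)%E.
    apply: contrapT => /forallNP nd; move/negP: Ht; apply; rewrite eq_le.
    apply/andP; split; last first.
      apply: (le_trans (hausdorff_premeasure_ge0 1 t A)).
      by apply: ereal_sup_ubound; exists 1 => /=.
    apply: ge_ereal_sup => _ [e /= e0 <-]; rewrite leNgt; apply/negP => ?.
    by apply: (nd e).
  have [c c0 Hc] : exists2 c : R, 0 < c & (c%:E <= hausdorff_premeasure d0 t A)%E.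
    case: hausdorff_premeasure Hd0 => [r| |] // r0; first by exists r.
    by exists 1 => //; rewrite leey.
  apply: (lower_box_dim_ge c0 d00) => x /andP[x0 xd].
  rewrite powRN EFinM lee_pdivrMr ?powR_gt0//.
  apply: le_trans (hausdorff_premeasure_le_covering _ t0 x0).
  apply: (le_trans Hc); apply: ereal_inf_le_tmp => _ [U [Ux AU] <-].
  exists U => //; split=> // i; apply: (le_trans (Ux i)).
  by rewrite lee_fin ltW.
have Hall t : (t%:E < hausdorff_dim A)%E -> (t%:E <= lower_box_dim A)%E.
  have [t0|t0 _] := ltP 0 t; first exact: Hpos.
  by apply: le_trans L0; rewrite lee_fin.
move: Hall L0; case: (hausdorff_dim A) => [h| |] Hall L0; last by rewrite leNye.
  apply/lee_subgt0Pr => e e0; rewrite -EFinB; apply: Hall.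
  by rewrite lte_fin ltrBlDr ltrDl.
move: Hall L0; case: (lower_box_dim A) => [l| |]// + _ => /(_ (l + 1)).
by rewrite ltry lee_fin gerDl => /(_ isT); rewrite ler10.
Qed.

End box_dimension.

(** * Words and the coding map *)

Section words.
Context {R : realType} {a : nat}.
Implicit Types (u v z : seq 'I_a) (i : nat -> 'I_a).

(** Left endpoint of the [a]-adic cell of [u]; [word_num] below is the index of that cell within its
    level, counted from the left. *)
Definition word_pt u : R := foldr (@adic_map R a) 0 u.

Fixpoint word_num u : nat :=
  if u is j :: v then (j * a ^ size v + word_num v)%N else 0%N.

Lemma word_ptE u : (0 < a)%N -> word_pt u = (word_num u)%:R / a%:R ^+ size u.
Proof.
move=> a0; have aN0 : a%:R != 0 :> R by rewrite pnatr_eq0 -lt0n.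
elim: u => [|j u IH]; first by rewrite /= mul0r.
rewrite /= /adic_map -/(word_pt u) IH natrD natrM natrX exprS.
by field; rewrite expf_neq0// aN0.
Qed.

Lemma word_num_lt u : (word_num u < a ^ size u)%N.
Proof.
elim: u => [|j u IH] //=; have := ltn_ord j; rewrite expnS; nia.
Qed.

Lemma word_num_inj u v : size u = size v -> word_num u = word_num v -> u = v.
Proof.
elim: u v => [|j u IH] [|k v] //= [suv]; rewrite suv => E.
have [jk uv] : j = k :> nat /\ word_num u = word_num v.
  have := word_num_lt u; have := word_num_lt v; rewrite suv => hv hu.
  have := congr1 (fun m => m %/ a ^ size v)%N E.
  have := congr1 (fun m => m %% a ^ size v)%N E.
  have a0 : (0 < a ^ size v)%N by exact: leq_ltn_trans hv.
  by rewrite !modnMDl !modn_small// !divnMDl// !divn_small// !addn0.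
by rewrite (IH v)//; congr cons; exact: val_inj.
Qed.

Lemma word_pt_cat u v : word_pt (u ++ v) = word_pt u + a%:R^-1 ^+ size u * word_pt v.
Proof.
elim: u => [|j u IH]; first by rewrite /= add0r mul1r.
by rewrite /= /adic_map -/(word_pt (u ++ v)) -/(word_pt u) IH exprS; ring.
Qed.

Lemma word_pt_ge0 u : 0 <= word_pt u.
Proof.
by elim: u => //= j u IH; rewrite addr_ge0// mulr_ge0// invr_ge0.
Qed.

Lemma word_pt_le1 u : (0 < a)%N -> word_pt u <= 1.
Proof.
move=> a0; rewrite word_ptE// ler_pdivrMr ?exprn_gt0 ?ltr0n// mul1r -natrX ler_nat.
exact/ltnW/word_num_lt.
Qed.

Lemma coding_map_itv i n : (0 < a)%N ->
  word_pt (mkseq i n) <= coding_map i <= word_pt (mkseq i n) + a%:R^-1 ^+ n.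
Proof.
move=> a0; pose x := fun n => word_pt (mkseq i n).
have xle m k : (m <= k)%N -> x m <= x k <= x m + a%:R^-1 ^+ m.
  move=> /subnKC <-; rewrite /x /mkseq iotaD map_cat word_pt_cat !size_map size_iota.
  have an : 0 <= a%:R^-1 ^+ m :> R by rewrite exprn_ge0// invr_ge0.
  rewrite lerDl mulr_ge0 ?word_pt_ge0//= lerD2l -[leRHS]mulr1.
  by rewrite ler_wpM2l// word_pt_le1.
have xnd : {homo x : m k / (m <= k)%N >-> m <= k}.
  by move=> m k /xle/andP[].
have xcvg : cvgn x.
  apply: nondecreasing_is_cvgn => //; exists 1 => _ [k _ <-].
  exact: word_pt_le1.
apply/andP; split; first exact: nondecreasing_cvgn_le.
apply: limr_le => //; near=> k.
have /xle/andP[_ //] : (n <= k)%N by near: k; exact: nbhs_infty_ge.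
Unshelve. all: by end_near. Qed.

Lemma coding_map_dist i n : (0 < a)%N ->
  `|coding_map i - word_pt (mkseq i n)| <= a%:R^-1 ^+ n.
Proof.
by move=> /(coding_map_itv i n)/andP[h1 h2]; rewrite ger0_norm; lra.
Qed.

Lemma coding_map01 i : (0 < a)%N -> 0 <= @coding_map R a i <= 1.
Proof. by move=> /(coding_map_itv i 0); rewrite /= expr0 add0r. Qed.

Definition word_tree (Q : seq 'I_a -> Prop) : set (nat -> 'I_a) :=
  [set i | forall n, Q (mkseq i n)].

Lemma path_choice (G : seq 'I_a -> Prop) : G [::] ->
  (forall u, G u -> exists j, G (rcons u j)) ->
  exists i, forall n, G (mkseq i n).
Proof.
move=> G0 GS; have [j0 _] := GS _ G0.
have /choice[g Hg] : forall u, exists j, G u -> G (rcons u j).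
  by move=> u; have [/GS[j ?]|nG] := pselect (G u); [exists j|exists j0].
pose P n := iter n (fun u => rcons u (g u)) [::].
have PE n : mkseq (fun n => g (P n)) n = P n.
  by elim: n => // n IH; rewrite mkseqS IH.
exists (fun n => g (P n)) => n; rewrite PE.
by elim: n => //= n IH; exact: Hg.
Qed.

Lemma inv_expr_small (e : R) : (1 < a)%N -> 0 < e ->
  exists n, a%:R^-1 ^+ n < e.
Proof.
move=> a1 e0; have [n _ /(_ n (leqnn _)) /= H] := near_infty_natSinv_expn_lt (PosNum e0).
exists n; rewrite (le_lt_trans _ H)// div1r exprVn lef_pV2 ?posrE ?exprn_gt0 ?ltr0n ?(ltnW a1)//.
by rewrite lerXn2r ?nnegrE// ler_nat.
Qed.

(** A König argument replaces a topology on words. A point [x] of the closure has, at each level, a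
    word through which codings arbitrarily close to [x] pass; since the alphabet is finite, one
    child of such a word inherits the property, and the branch obtained codes [x]. *)
Lemma coding_compact (Q : seq 'I_a -> Prop) : (1 < a)%N ->
  compact (@coding_map R a @` word_tree Q).
Proof.
move=> a1; have a0 := ltnW a1.
apply: (subclosed_compact _ (@segment_compact R 0 1)); last first.
  by move=> _ [i _ <-] /=; rewrite in_itv/= coding_map01.
move=> x Ax.
pose near u := forall e : R, 0 < e -> exists i,
  [/\ word_tree Q i, mkseq i (size u) = u & `|x - coding_map i| < e].
have near0 : near [::].
  move=> e e0; have [y [[i Qi <-] xi]] := Ax _ (nbhsx_ballx x _ e0).
  by exists i.
have nearS u : near u -> exists j, near (rcons u j).
  move=> nu; apply: contrapT => /forallNP H.
  have /choice[e He] : forall j, exists e : R, 0 < e /\ forall i,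
      word_tree Q i -> mkseq i (size u).+1 = rcons u j -> e <= `|x - coding_map i|.
    move=> j; have /existsNP[e /not_implyP[e0 ne]] := H j.
    exists e; split => // i Qi iu; rewrite leNgt; apply/negP => xi.
    by apply: ne; exists i; rewrite size_rcons.
  have [i [Qi iu]] := nu (\big[Num.min/1]_j e j) (lt_bigmin _ ltr01 (fun j _ => (He j).1)).
  apply/negP; rewrite -leNgt.
  apply: (@le_trans _ _ (e (i (size u)))); first exact: bigmin_le_cond.
  by apply: (He _).2 => //; rewrite mkseqS iu.
have [i Hi] := path_choice near0 nearS.
exists i.
  move=> n; have [i' [Q' + _]] := Hi n _ ltr01.
  by rewrite size_mkseq => <-.
apply/eqP; rewrite -subr_eq0 -normr_eq0 eq_le normr_ge0 andbT leNgt.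
apply/negP => d0; have [n Hn] : exists n, a%:R^-1 ^+ n < `|coding_map i - x| / 3.
  by apply: inv_expr_small => //; lra.
have [i' [_ + xi']] := Hi n (`|coding_map i - x| / 3) ltac:(lra).
rewrite size_mkseq => ii'.
have := coding_map_dist i n a0; have := coding_map_dist i' n a0; rewrite ii'.
move=> h1 h2; suff : `|coding_map i - x| <= `|x - coding_map i'| +
    (`|coding_map i' - word_pt (mkseq i n)| + `|coding_map i - word_pt (mkseq i n)|).
  by lra.
rewrite distrC; set w := word_pt _; set c' := coding_map i'; set c := coding_map i.
have -> : x - c = (x - c') + ((c' - w) - (c - w)) by ring.
by rewrite (le_trans (ler_normD _ _))// lerD2l (le_trans (ler_normB _ _)).
Qed.

End words.

Lemma scaled_sum_compact (R : realType) (X Y : set R) (s : R) :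
  compact X -> compact Y -> compact (scaled_sum X s Y).
Proof.
move=> cX cY.
have -> : scaled_sum X s Y = (fun z : R * R => z.1 + s * z.2) @` (X `*` Y).
  apply/seteqP; split => [_ [x Xx [y Yy <-]]|_ [[x y] [Xx Yy] <-]]; first by exists (x, y).
  by exists x => //; exists y.
apply: continuous_compact (compact_setX cX cY).
apply: continuous_subspaceT => z; apply: cvgD; first exact: cvg_fst.
apply: cvgM; [exact: cvg_cst|exact: cvg_snd].
Qed.

(** * Words near a point and masses of intervals *)

Section counting.
Context {R : realType}.

Lemma card_separated (J : finType) (A : {pred J}) (f : J -> nat) (x y : R) :
  {in A &, injective f} -> 0 <= y -> (forall j, j \in A -> `|(f j)%:R - x| <= y) ->
  #|A|%:R <= 2 * y + 1.
Proof.
move=> finj y0 fx; case: (pickP (mem A)) => [j0 j0A|A0]; last first.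
  by rewrite eq_card0//; lra.
pose m := f [arg min_(j < j0 in A) f j]%N.
have [jm jmA [jmmin mE]] : exists2 j, j \in A & (forall j', j' \in A -> (f j <= f j')%N) /\ m = f j.
  by rewrite /m; case: arg_minnP => // j jA jmin; exists j.
have fm j : j \in A -> (f j - m <= Num.trunc (2 * y))%N.
  move=> jA; rewrite mE truncn_ge_nat; last lra.
  rewrite natrB ?jmmin//; have := fx _ jA; have := fx _ jmA.
  by rewrite !ler_norml; lra.
have inj : {in A &, injective (fun j => inord (f j - m) : 'I_(Num.trunc (2 * y)).+1)}.
  move=> i j iA jA /(congr1 val); rewrite /= !inordK ?ltnS ?fm// => E.
  apply: finj => //; have := jmmin _ iA; have := jmmin _ jA; rewrite -mE; lia.
have := max_card (mem [seq (inord (f j - m) : 'I_(Num.trunc (2 * y)).+1) | j in A]).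
rewrite card_in_image// card_ord -(ler_nat R) => /le_trans; apply.
by rewrite -natr1 lerD2r truncn_le; lra.
Qed.

Lemma card_fibers_cond_le (J Z : finType) (f : J -> Z) (P : pred J) (Q : pred Z) (B : R) :
  (forall j, P j -> Q (f j)) ->
  (forall z, #|[pred j | P j && (f j == z)]|%:R <= B) -> #|P|%:R <= #|Q|%:R * B.
Proof.
move=> PQ fB; rewrite -[in leLHS]sum1_card (partition_big f Q)//= natr_sum.
rewrite -[in leRHS]sum1_card natr_sum mulr_suml; apply: ler_sum => z _.
by rewrite mul1r; apply: le_trans (fB z); rewrite sum1_card.
Qed.

Lemma card_fibers_le (J Z : finType) (f : J -> Z) (P : pred J) (Q : pred Z) (B : R) :
  (forall j, P j -> Q (f j)) ->
  (forall z, #|[pred j | f j == z]|%:R <= B) -> #|P|%:R <= #|Q|%:R * B.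
Proof.
move=> PQ fB; apply: (card_fibers_cond_le PQ) => z; apply: le_trans (fB z).
rewrite ler_nat; apply: subset_leq_card.
by apply/fintype.subsetP => j; rewrite !inE => /andP[].
Qed.

(* Least length of words whose cells have length at most [2^-n]. *)
Definition level (a n : nat) : nat := up_log a (2 ^ n).

Lemma levelP a n : (1 < a)%N -> (2 ^ n <= a ^ level a n <= a * 2 ^ n)%N.
Proof.
move=> a1; rewrite up_logP//=; case: n => [|n].
  by rewrite /level expn0 up_log1 expn0 muln1 ltnW.
have h : (1 < 2 ^ n.+1)%N by exact: leq_trans (ltn_expl n.+1 (isT : 1 < 2)%N).
have := up_log_gtn a1 h; rewrite -/(level a n.+1).
have : (0 < level a n.+1)%N by rewrite /level up_log_gt0 a1 h.
by case: (level a n.+1) => // l _ /=; move=> ?; rewrite (expnS a); rewrite leq_mul2l ltnW ?orbT.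
Qed.

Lemma level_inv a n : (1 < a)%N -> a%:R^-1 ^+ level a n <= 2^-1 ^+ n :> R.
Proof.
move=> a1; have /andP[h _] := levelP n a1.
rewrite !exprVn lef_pV2 ?posrE ?exprn_gt0 ?ltr0n ?(ltnW a1)//.
by rewrite -!natrX ler_nat.
Qed.

Lemma level_expr a n : (1 < a)%N -> a%:R ^+ level a n * 2^-1 ^+ n <= a%:R :> R.
Proof.
move=> a1; have /andP[_ h] := levelP n a1.
by rewrite exprVn ler_pdivrMr ?exprn_gt0// -!natrX -natrM ler_nat.
Qed.

Lemma leq_level a n m : (1 < a)%N -> (n <= m)%N -> (level a n <= level a m)%N.
Proof.
move=> a1 nm; apply: up_log_min => //; have /andP[h _] := levelP m a1.
by rewrite (leq_trans _ h)// leq_exp2l.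
Qed.

(* The mass distributions are uniform measures on finite families [D] of infinite
   words, which have the right decay down to a prescribed level [n] only. *)
Definition frostman_words (a : nat) (S : set (nat -> 'I_a)) (g : R) : Prop :=
  exists2 C : R, 0 < C & forall n : nat, exists (J : finType) (D : J -> nat -> 'I_a),
    [/\ (0 < #|J|)%N, (forall j, S (D j)) &
      forall k (z : seq 'I_a), (k <= n)%N ->
        #|[pred j | mkseq (D j) k == z]|%:R <= C * (a%:R^-1 ^+ k) `^ g * #|J|%:R].

(** Rescaling by [a^k / s] turns the points into distinct integers [word_num z] in an interval of
    half-width [e a^k / |s|]. *)
Lemma card_words_near a (k : nat) (Q : pred (k.-tuple 'I_a)) (s c e : R) : (1 < a)%N ->
  s != 0 -> 0 <= e ->
  (forall z : k.-tuple 'I_a, Q z -> `|c + s * word_pt z| <= e) ->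
  #|Q|%:R <= 2 * (e / `|s| * a%:R ^+ k) + 1.
Proof.
move=> a1 s0 e0 H; have ak0 : 0 < a%:R ^+ k :> R by rewrite exprn_gt0 ?ltr0n ?(ltnW a1).
apply: (@card_separated _ _ (fun z : k.-tuple 'I_a => word_num z) (- c / s * a%:R ^+ k)).
- by move=> u v _ _ /word_num_inj uv; apply: val_inj; apply: uv; rewrite !size_tuple.
- by rewrite mulr_ge0 ?(ltW ak0)// divr_ge0.
- move=> z /H; rewrite word_ptE ?(ltnW a1)// size_tuple => Hz.
  set A := a%:R ^+ k in ak0 Hz *; set m := (word_num z)%:R in Hz *.
  have -> : m - - c / s * A = (c + s * (m / A)) * (A / s) by field; rewrite s0 gt_eqF.
  rewrite normrM normf_div (gtr0_norm ak0).
  rewrite (_ : e / `|s| * A = e * (A / `|s|)); last by rewrite mulrAC mulrA.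
  by rewrite ler_wpM2r// divr_ge0// ltW.
Qed.


Lemma powR_expn (x g : R) n : 0 < x -> (x ^+ n) `^ g = (x `^ g) ^+ n.
Proof.
by move=> x0; rewrite -!powR_mulrn ?powR_ge0 ?(ltW x0)// -!powRrM mulrC.
Qed.

(* Only the prefixes of level [level a n], whose cells have length at most
   [2^-n], are needed to bound the mass of a ball of radius [2^-n]. *)
Lemma frostman_hausdorff_dim a (Q : seq 'I_a -> Prop) (g : R) : (1 < a)%N -> 0 < g ->
  frostman_words (word_tree Q) g ->
  (g%:E <= hausdorff_dim (@coding_map R a @` word_tree Q))%E.
Proof.
move=> a1 g0 [C C0 HC]; have a0 := ltnW a1.
(* Prefixes of points within [2^-n] of [c] lie within [2 * 2^-n] of it, one [2^-n] being the cell
   length; since [a^k 2^-n <= a], at most [4 a + 1] of them occur. *)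
pose C1 := (4 * a%:R + 1) * C.
have C10 : 0 < C1 by rewrite mulr_gt0// ltr_wpDl// mulr_ge0.
apply: (mass_distribution g0 C10); first exact: coding_compact.
move=> N; have [J [D [J0 DS DC]]] := HC (level a N).
exists J, (fun j => coding_map (D j)); split => // [j|n c nN]; first by exists (D j).
pose k := level a n.
have DB (z : k.-tuple 'I_a) : #|[pred j | [tuple of mkseq (D j) k] == z]|%:R <=
    C * (a%:R^-1 ^+ k) `^ g * #|J|%:R.
  exact: (DC k z (leq_level a1 nN)).
apply: (le_trans (card_fibers_le (Q := fun z : k.-tuple 'I_a =>
  `|- c + 1 * word_pt z| <= 2 * 2^-1 ^+ n) _ DB)).
  move=> j /= Hj; rewrite mul1r; have := coding_map_dist (D j) k a0 (R := R).
  have := level_inv n a1; rewrite -/k; move: Hj; rewrite !ler_norml; lra.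
rewrite mulrA ler_wpM2r// /C1 mulrA ler_pM ?mulr_ge0 ?powR_ge0 ?(ltW C0)//.
  rewrite ler_wpM2r ?(ltW C0)//.
  apply: (le_trans (card_words_near (s := 1) (c := - c) (e := 2 * 2^-1 ^+ n) a1 _ _ _)) => //.
  by rewrite normr1 divr1; have := level_expr n a1; rewrite -/k; lra.
apply: ge0_ler_powR; rewrite ?nnegrE ?exprn_ge0 ?invr_ge0 ?(ltW g0)//.
exact: level_inv.
Qed.

Definition strip_words (a b : nat) (Q : seq 'I_a -> Prop) (Q' : seq 'I_b -> Prop)
    (k m : nat) (s c e : R) : pred (k.-tuple 'I_a * m.-tuple 'I_b) :=
  [pred z : k.-tuple 'I_a * m.-tuple 'I_b | [&& `[< Q z.1 >], `[< Q' z.2 >] & `|word_pt z.1 + s * word_pt z.2 - c| <= e]].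

(** The mass over an interval is at most the number of cell pairs meeting the strip, of order
    [2^(n h)], times the largest mass of one pair, of order [2^(- n (g + g'))]. The half-width
    [(2 + |s|) 2^-n] is the radius [2^-n] plus the errors [2^-n] and [|s| 2^-n] of replacing points
    by cell endpoints. *)
Lemma frostman_sum_hausdorff_dim a b (Q : seq 'I_a -> Prop) (Q' : seq 'I_b -> Prop)
    (g g' h s C0 : R) : (1 < a)%N -> (1 < b)%N -> 0 < g -> 0 < g' -> h < g + g' -> 0 < C0 ->
  frostman_words (word_tree Q) g -> frostman_words (word_tree Q') g' ->
  (forall n c, #|strip_words Q Q' (k := level a n) (m := level b n) s c
                   ((2 + `|s|) * 2^-1 ^+ n)|%:R <= C0 * (2^-1 ^+ n) `^ (- h)) ->
  ((g + g' - h)%:E <= hausdorff_dim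
     (scaled_sum (@coding_map R a @` word_tree Q) s (@coding_map R b @` word_tree Q')))%E.
Proof.
move=> a1 b1 g0 g'0 hgg C00 [C Cp HC] [C' Cp' HC'] Hs; have [a0 b0] := (ltnW a1, ltnW b1).
have t0 : 0 < g + g' - h by lra.
have CC : 0 < C0 * C * C' by rewrite !mulr_gt0.
apply: (mass_distribution t0 CC).
  by apply: scaled_sum_compact; exact: coding_compact.
move=> N; have [J [D [J0 DS DC]]] := HC (level a N).
have [J' [D' [J0' DS' DC']]] := HC' (level b N).
exists (J * J')%type, (fun j => coding_map (D j.1) + s * coding_map (D' j.2)); split.
- by rewrite card_prod muln_gt0 J0.
- by move=> j; exists (coding_map (D j.1)); [exists (D j.1)|
    exists (coding_map (D' j.2)) => //; exists (D' j.2)].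
move=> n c nN; pose k := level a n; pose m := level b n.
pose f (j : J * J') := ([tuple of mkseq (D j.1) k], [tuple of mkseq (D' j.2) m]).
have DB z : #|[pred j | f j == z]|%:R <=
    (C * (a%:R^-1 ^+ k) `^ g * #|J|%:R) * (C' * (b%:R^-1 ^+ m) `^ g' * #|J'|%:R).
  apply: (@le_trans _ _ (#|[pred j | mkseq (D j) k == z.1]|%:R *
      #|[pred j | mkseq (D' j) m == z.2]|%:R)).
    rewrite -natrM -cardX ler_nat; apply: subset_leq_card; apply/fintype.subsetP.
    by move=> [j j']; rewrite !inE /= => /eqP <- /=; rewrite !eqxx.
  by rewrite ler_pM//; [apply: DC|apply: DC']; exact: leq_level.
apply: (le_trans (card_fibers_le (Q := strip_words Q Q' s c ((2 + `|s|) * 2^-1 ^+ n)) _ DB)).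
  move=> j /= Hj; apply/and3P; split.
  - by apply/asboolP; exact: DS.
  - by apply/asboolP; exact: DS'.
  have := coding_map_dist (D j.1) k a0 (R := R).
  have := coding_map_dist (D' j.2) m b0 (R := R).
  have := level_inv n a1; have := level_inv n b1; rewrite -/k -/m /=; move: Hj.
  set x := coding_map (D j.1); set y := coding_map (D' j.2).
  set y' := word_pt (mkseq (D' _) _); set x' := word_pt (mkseq (D _) _) => H hb ha hy hx.
  have -> : x' + s * y' - c = (x + s * y - c) - ((x - x') + s * (y - y')) by ring.
  rewrite (le_trans (ler_normB _ _))//.
  have := ler_normD (x - x') (s * (y - y')); rewrite normrM => h1.
  have : `|s| * `|y - y'| <= `|s| * 2^-1 ^+ n by rewrite ler_wpM2l// (le_trans hy).
  lra.
have -> : #|{: J * J'}|%:R = #|J|%:R * #|J'|%:R :> R by rewrite card_prod natrM.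
have pg (x : nat) (y : R) : (1 < x)%N -> 0 < y ->
    (x%:R^-1 ^+ level x n) `^ y <= (2^-1 ^+ n) `^ y.
  move=> x1 y0; apply: ge0_ler_powR; rewrite ?nnegrE ?exprn_ge0 ?invr_ge0 ?(ltW y0)//.
  exact: level_inv.
have := pg a g a1 g0; have := pg b g' b1 g'0; rewrite -/k -/m => pb pa.
have -> : (2^-1 ^+ n) `^ (g + g' - h) =
    (2^-1 ^+ n) `^ (- h) * ((2^-1 ^+ n) `^ g * (2^-1 ^+ n) `^ g') :> R.
  rewrite -!powRD; last 2 first.
  - by apply/implyP => _; rewrite expf_neq0// invr_neq0.
  - by apply/implyP => _; rewrite expf_neq0// invr_neq0.
  by congr (_ `^ _); ring.
apply: (@le_trans _ _ (C0 * (2^-1 ^+ n) `^ (- h) *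
  (C * (2^-1 ^+ n) `^ g * #|J|%:R * (C' * (2^-1 ^+ n) `^ g' * #|J'|%:R)))); last by lra.
have nn (K x y n' : R) : 0 < K -> 0 <= n' -> 0 <= K * x `^ y * n'.
  by move=> K0 n0; rewrite !mulr_ge0 ?powR_ge0 ?(ltW K0).
apply: ler_pM => //; [by rewrite mulr_ge0 ?nn|exact: Hs|].
by apply: ler_pM; rewrite ?nn// ler_wpM2r// ler_pM2l.
Qed.

End counting.

(** * Upper box dimension from counts of cells *)

Section upper.
Context {R : realType}.

Lemma upper_box_dim_cover (A : set R) (h M C : R) : 0 <= h -> 0 < M -> 0 < C ->
  (forall n, exists (J : finType) (B : J -> set R),
    [/\ #|J|%:R <= C * (2^-1 ^+ n) `^ (- h),
        (forall j, (diam (B j) <= (M * 2^-1 ^+ n)%:E)%E) & A `<=` \bigcup_j B j]) ->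
  (upper_box_dim A <= h%:E)%E.
Proof.
move=> h0 M0 C0 H; have M2 : 0 < 2 * M by rewrite mulr_gt0.
(* The level [n.+1] used at scale [x] satisfies [x / (2 M) <= 2^-(n+1) < x / M]; the left inequality
   produces the constant. *)
apply: (@upper_box_dim_le _ _ _ (C * (2 * M) `^ h) M) => //.
  by rewrite mulr_gt0// powR_gt0.
move=> x /andP[x0 xM].
have [||n /andP[n1 n2]] := @dyadic_scale R (x / M); [by rewrite divr_gt0|by rewrite ler_pdivrMr// mul1r ltW|].
have [J [B [cJ dB AB]]] := H n.+1.
apply: (@le_trans _ _ (#|J|%:R)%:E).
  apply: ereal_inf_lbound; exists #|J| => //; exists (fun i => B (enum_val i)).
  split=> [i|y /AB[j _ By]]; last by exists (enum_rank j); rewrite // enum_rankK.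
  apply: (le_trans (dB _)); rewrite lee_fin.
  by move: n1; rewrite ltr_pdivlMr// mulrC => /ltW.
rewrite lee_fin (le_trans cJ)// -mulrA ler_pM2l//.
have -> : (2 * M) `^ h * x `^ (- h) = (x / (2 * M)) `^ (- h).
  rewrite [RHS]powRM ?invr_ge0 ?(ltW x0) ?(ltW M2)// mulrC; congr (_ * _).
  by rewrite -powR_inv1 ?(ltW M2)// -powRrM mulN1r opprK.
rewrite !powRN lef_pV2 ?posrE ?powR_gt0 ?divr_gt0 ?exprn_gt0//.
apply: ge0_ler_powR; rewrite ?nnegrE ?exprn_ge0 ?invr_ge0// ?divr_ge0 ?(ltW x0) ?(ltW M2)//.
by rewrite exprS invfM mulrCA ler_pM2l.
Qed.

Definition surviving_count a (Q : seq 'I_a -> Prop) (k : nat) : nat :=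
  #|[pred z : k.-tuple 'I_a | `[< Q z >]]|.

(** The length is [2^-n] rather than a power of [1/a], so that cells of both bases have a common
    size. *)
Definition cell a n (u : seq 'I_a) : set R :=
  [set x | word_pt u <= x <= word_pt u + 2^-1 ^+ n].

Lemma coding_cell a (i : nat -> 'I_a) n : (1 < a)%N ->
  word_pt (mkseq i (level a n)) <= @coding_map R a i
    <= word_pt (mkseq i (level a n)) + 2^-1 ^+ n.
Proof.
move=> a1; have /andP[-> h] := coding_map_itv i (level a n) (ltnW a1) (R := R).
by rewrite (le_trans h)// lerD2l level_inv.
Qed.

Lemma coding_upper_box_dim a (Q : seq 'I_a -> Prop) (h C : R) : (1 < a)%N -> 0 <= h -> 0 < C ->
  (forall n, (surviving_count Q (level a n))%:R <= C * (2^-1 ^+ n) `^ (- h)) ->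
  (upper_box_dim (@coding_map R a @` word_tree Q) <= h%:E)%E.
Proof.
move=> a1 h0 C0 H; apply: (upper_box_dim_cover (M := 1) h0 _ C0) => // n.
exists {z : (level a n).-tuple 'I_a | `[< Q z >]},
  (fun z => cell n (val z : (level a n).-tuple 'I_a)); split.
- by rewrite card_sig; exact: H.
- move=> z; apply: diam_le => x y; rewrite /cell /= => xz yz.
  by rewrite lee_fin mul1r ler_norml; lra.
- move=> _ [i Qi <-].
  have Qz : `[< Q [tuple of mkseq i (level a n)] >] by apply/asboolP; exact: Qi.
  by exists (exist (fun z : (level a n).-tuple 'I_a => is_true `[< Q z >]) _ Qz) => //=; exact: coding_cell.
Qed.

Lemma sum_upper_box_dim a b (Q : seq 'I_a -> Prop) (Q' : seq 'I_b -> Prop) (h h' s C C' : R) :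
  (1 < a)%N -> (1 < b)%N -> 0 <= h -> 0 <= h' -> 0 < C -> 0 < C' ->
  (forall n, (surviving_count Q (level a n))%:R <= C * (2^-1 ^+ n) `^ (- h)) ->
  (forall n, (surviving_count Q' (level b n))%:R <= C' * (2^-1 ^+ n) `^ (- h')) ->
  (upper_box_dim (scaled_sum (@coding_map R a @` word_tree Q) s
     (@coding_map R b @` word_tree Q')) <= (h + h')%:E)%E.
Proof.
move=> a1 b1 h0 h0' C0 C0' H H'.
apply: (upper_box_dim_cover (M := 1 + `|s|) (C := C * C')) => [||| n].
- by rewrite addr_ge0.
- by rewrite ltr_wpDr.
- by rewrite mulr_gt0.
exists ({z : (level a n).-tuple 'I_a | `[< Q z >]} * {z : (level b n).-tuple 'I_b | `[< Q' z >]})%type,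
  (fun z => [set x + s * y | x in cell n (val z.1 : (level a n).-tuple 'I_a)
     & y in cell n (val z.2 : (level b n).-tuple 'I_b)]); split.
- rewrite card_prod !card_sig natrM opprD powRD; last first.
    by apply/implyP => _; rewrite expf_neq0// invr_neq0.
  by rewrite mulrACA ler_pM// ?H ?H'.
- move=> z; apply: diam_le => _ _ [x + [y + <-]] [x' + [y' + <-]]; rewrite /cell /= => xz yz xz' yz'.
  rewrite lee_fin (_ : _ - _ = (x - x') + s * (y - y')); last by ring.
  rewrite (le_trans (ler_normD _ _))// mulrDl mul1r normrM lerD//.
    by rewrite ler_norml; lra.
  by rewrite ler_wpM2l// ler_norml; lra.
- move=> _ [_ [i Qi <-] [_ [j Qj <-] <-]].
  have Qz : `[< Q [tuple of mkseq i (level a n)] >] by apply/asboolP; exact: Qi.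
  have Qz' : `[< Q' [tuple of mkseq j (level b n)] >] by apply/asboolP; exact: Qj.
  exists (exist (fun z : (level a n).-tuple 'I_a => is_true `[< Q z >]) _ Qz,
    exist (fun z : (level b n).-tuple 'I_b => is_true `[< Q' z >]) _ Qz') => //=.
  exists (coding_map i); first exact: coding_cell.
  by exists (coding_map j) => //; exact: coding_cell.
Qed.

Definition dyadic_point (H n i : nat) : R := i%:R * 2^-1 ^+ n - H%:R.

Lemma dyadic_approx (H n : nat) (x : R) : `|x| <= H%:R ->
  exists i : 'I_(2 * H * 2 ^ n + 1), 0 <= x - dyadic_point H n i <= 2^-1 ^+ n.
Proof.
have e0 : 0 < 2^-1 ^+ n :> R by rewrite exprn_gt0// invr_gt0.
have en : 2^-1 ^+ n * 2 ^+ n = 1 :> R by rewrite exprVn mulVf// expf_neq0.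
rewrite ler_norml => /andP[x1 x2].
have x0 : 0 <= (x + H%:R) * 2 ^+ n by rewrite mulr_ge0 ?exprn_ge0//; lra.
have jlt : (Num.trunc ((x + H%:R) * 2 ^+ n) < 2 * H * 2 ^ n + 1)%N.
  rewrite truncn_lt_nat// natrD !natrM natrX (@le_lt_trans _ _ (2 * H%:R * 2 ^+ n))//.
    by rewrite ler_wpM2r ?exprn_ge0//; lra.
  by rewrite ltrDl.
exists (Ordinal jlt) => //=.
have /andP[t1 t2] := truncn_itv x0; rewrite -[(Num.trunc _).+1%:R]natr1 in t2.
have xE : x + H%:R = (x + H%:R) * 2 ^+ n * 2^-1 ^+ n by rewrite -mulrA [_ ^+ n * _]mulrC en mulr1.
have h1 := ler_wpM2r (ltW e0) t1; have h2 := ler_wpM2r (ltW e0) (ltW t2).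
by move: h1 h2; rewrite -xE [(_ + 1) * _]mulrDl mul1r /dyadic_point; lra.
Qed.

Lemma bounded_upper_box_dim (A : set R) (M : nat) :
  (forall x, A x -> `|x| <= M%:R) -> (upper_box_dim A <= 1%:E)%E.
Proof.
move=> AM; apply: (upper_box_dim_cover (M := 1) (C := 2 * M%:R + 1)) => // n.
have e0 : 0 < 2^-1 ^+ n :> R by rewrite exprn_gt0// invr_gt0.
exists 'I_(2 * M * 2 ^ n + 1),
  (fun j : 'I_(2 * M * 2 ^ n + 1) => [set x : R | 0 <= x - dyadic_point M n j <= 2^-1 ^+ n]); split.
- rewrite card_ord powR_inv1 ?(ltW e0)// exprVn invrK natrD !natrM natrX.
  by have : 1 <= 2 ^+ n :> R; [rewrite -natrX ler1n expn_gt0|lra].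
- by move=> j; apply: diam_le => x y /= xj yj; rewrite lee_fin mul1r ler_norml; lra.
- by move=> x /AM/(dyadic_approx n)[j xj]; exists j.
Qed.

End upper.

(** * Regular subtrees *)

Section trees.
Context {a : nat}.
Implicit Types (u v z : seq 'I_a) (sg : seq 'I_a -> bool).

(** The empty prefix is not tested, as the products of weights start at length 1: the root is always
    present. *)
Definition survives sg u : bool := all (fun k => sg (take k u)) (iota 1 (size u)).

Definition shift sg u : seq 'I_a -> bool := fun v => sg (u ++ v).

Lemma shift_cat sg u v : shift (shift sg u) v = shift sg (u ++ v).
Proof. by apply/funext => z; rewrite /shift catA. Qed.

Lemma survives_cat sg u v :
  survives sg (u ++ v) = survives sg u && survives (shift sg u) v.
Proof.
rewrite /survives size_cat iotaD all_cat; congr andb.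
  apply: eq_in_all => k; rewrite mem_iota add1n ltnS => /andP[_ ku].
  by rewrite takel_cat.
rewrite [(1 + _)%N]addnC iotaDl all_map; apply: eq_in_all => k _ /=.
by rewrite /shift take_cat ltnNge leq_addr/= addKn.
Qed.

Lemma survives_take sg u k : survives sg u -> survives sg (take k u).
Proof. by rewrite -[u in survives sg u](cat_take_drop k) survives_cat => /andP[]. Qed.

Section good.
Variables K L : nat.

(** Depth-[j] truncation of the [K]-regular subtree, by blocks of [L] letters. It involves only
    words of length at most [L j], so finite independence applies to it. *)
Fixpoint good (j : nat) sg : bool :=
  if j is j'.+1 then
    (K <= #|[pred v : L.-tuple 'I_a | survives sg v && good j' (shift sg v)]|)%N
  else true.

Lemma good_dec j sg : good j.+1 sg -> good j sg.
Proof.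
elim: j sg => // j IH sg /leq_trans; apply; apply: subset_leq_card.
by apply/fintype.subsetP => v; rewrite !inE => /andP[-> /IH].
Qed.

Lemma good_le i j sg : (i <= j)%N -> good j sg -> good i sg.
Proof.
by move=> /subnK <-; elim: (j - i)%N => // k IH; rewrite addSn => /good_dec.
Qed.

Definition very_good sg : Prop := forall j, good j sg.

(** Each of the finitely many descendants that is not very good fails at some finite depth; beyond
    the largest of these depths, good and very good agree. *)
Lemma very_good_card sg : very_good sg ->
  (K <= #|[pred v : L.-tuple 'I_a | survives sg v && `[< very_good (shift sg v) >]]|)%N.
Proof.
move=> gsg.
have /choice[j Hj] : forall v : L.-tuple 'I_a, exists j,
    good j (shift sg v) -> very_good (shift sg v).
  move=> v; have [gv|/existsNP[j nj]] := pselect (very_good (shift sg v)).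
    by exists 0%N.
  by exists j => /nj.
apply: leq_trans (gsg (\max_v j v).+1) _; apply: subset_leq_card.
apply/fintype.subsetP => v; rewrite !inE => /andP[-> /= gv]; apply/asboolP/Hj.
exact: good_le (leq_bigmax v) gv.
Qed.

End good.

Lemma card_ffun_tail (K N j : nat) (P : pred {ffun 'I_N -> 'I_K}) : (j <= N)%N ->
  (forall f g, P f -> P g -> forall i : 'I_N, (i < j)%N -> f i = g i) ->
  (#|P| <= K ^ (N - j))%N.
Proof.
move=> jN H.
have lt (i : 'I_(N - j)) : (i + j < N)%N by have := ltn_ord i; lia.
pose F (f : {ffun 'I_N -> 'I_K}) : {ffun 'I_(N - j) -> 'I_K} :=
  [ffun i => f (Ordinal (lt i))].
have Finj : {in P &, injective F}.
  move=> f g Pf Pg /ffunP FE; apply/ffunP => i; have [ij|ji] := ltnP i j.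
    exact: H.
  have lti : (i - j < N - j)%N by have := ltn_ord i; lia.
  have := FE (Ordinal lti); rewrite !ffunE.
  by rewrite (_ : Ordinal _ = i)//; apply: val_inj => /=; lia.
rewrite -(card_in_image Finj) (leq_trans (max_card _))//.
by rewrite card_ffun !card_ord.
Qed.

(** Equal splitting is the uniform measure on digit strings, each string selecting a path of the
    [K]-regular subtree below [u0]. A prefix of length [k] determines the first
    [j = (k - size u0) %/ L] digits, so it is shared by a proportion at most [K^-j] of the paths.
    The constant pays for the letters of [u0] and for one incomplete block. *)
Lemma good_frostman (R : realType) (K L : nat) sg u0 (g : R) : (1 < a)%N ->
  (0 < K)%N -> (0 < L)%N -> 0 <= g -> K%:R^-1 <= (a%:R^-1 ^+ L) `^ g ->
  survives sg u0 -> very_good K L (shift sg u0) ->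
  frostman_words (word_tree (survives sg)) g.
Proof.
move=> a1 K0 L0 g0 Kg su0 gu0; have a0 := ltnW a1.
pose ok u := survives sg u /\ very_good K L (shift sg u).
have /choice[c Hc] : forall u, exists c : 'I_K -> L.-tuple 'I_a,
    ok u -> injective c /\ forall i, ok (u ++ c i).
  move=> u; have [[su gu]|nu] := pselect (ok u); last first.
    by exists (fun=> [tuple of nseq L (Ordinal a0)]).
  have KA := very_good_card gu; set A := mem _ in KA.
  exists (fun i => enum_val (widen_ord KA i)) => _; split.
    by move=> i j /enum_val_inj /(congr1 val) /= ij; exact: val_inj.
  move=> i; have := enum_valP (widen_ord KA i); rewrite inE => /andP[s1 /asboolP g1].
  by split; [rewrite survives_cat su|rewrite -shift_cat].
pose th (e : nat -> 'I_K) := fix th n := if n is n'.+1 then th n' ++ c (th n') (e n') else u0.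
have thok e n : ok (th e n) by elim: n => //= n IH; exact: (Hc _ IH).2.
have thsize e n : size (th e n) = (size u0 + L * n)%N.
  by elim: n => [|n IH] /=; [rewrite muln0 addn0|rewrite size_cat IH size_tuple mulnS; lia].
have thtake e n m : (n <= m)%N -> take (size (th e n)) (th e m) = th e n.
  move=> /subnKC <-; elim: (m - n)%N => [|k IH]; first by rewrite addn0 take_size.
  by rewrite addnS /= takel_cat// !thsize; nia.
pose d0 : 'I_a := Ordinal a0.
pose I e k := nth d0 (th e k.+1) k.
have Iseq e n k : (k <= size (th e n))%N -> mkseq (I e) k = take k (th e n).
  move=> kn; apply: (@eq_from_nth _ d0); first by rewrite size_mkseq size_takel.
  move=> i; rewrite size_mkseq => ik; rewrite nth_mkseq// nth_take// /I.
  have [h|h] := leqP i.+1 n.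
    by rewrite -(thtake e _ _ h) nth_take// thsize; nia.
  by rewrite -(thtake e _ _ (ltnW h)) nth_take// (leq_trans ik).
have Itree e : word_tree (survives sg) (I e).
  move=> n; rewrite (Iseq e n); last by rewrite thsize; nia.
  by apply: survives_take; exact: (thok e n).1.
have thinj e e' n : th e n = th e' n -> forall i, (i < n)%N -> e i = e' i.
  elim: n => // n IH /= E; have En : th e n = th e' n.
    have := congr1 (take (size (th e n))) E.
    by rewrite take_size_cat// take_size_cat// !thsize.
  move=> i; rewrite ltnS leq_eqVlt => /predU1P[->|]; last exact: IH.
  move/eqP: E; rewrite En eqseq_cat// eqxx/= => /eqP/val_inj.
  exact: (Hc _ (thok e' n)).1.
exists ((a%:R ^+ (size u0 + L)) `^ g); first by rewrite powR_gt0// exprn_gt0// ltr0n.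
move=> n.
(* Digits from the [n]-th on are set to 0; as [L >= 1], the first [n] blocks already cover all
   prefixes of length at most [n]. *)
pose dig (f : {ffun 'I_n -> 'I_K}) i := if insub i is Some j then f j else Ordinal K0.
have digE f (i : 'I_n) : dig f i = f i by rewrite /dig valK.
exists {ffun 'I_n -> 'I_K}, (fun f => I (dig f)); split => // [|k z kn].
  by rewrite card_ffun !card_ord expn_gt0 K0.
pose j := ((k - size u0) %/ L)%N.
have jn : (j <= n)%N by rewrite (leq_trans (leq_div _ _))// (leq_trans (leq_subr _ _)).
have kj : (k <= size u0 + L + L * j)%N.
  have := ltn_ceil (k - size u0) L0; rewrite -/j mulSn mulnC; lia.
have cardle : (#|[pred f | mkseq (I (dig f)) k == z]| <= K ^ (n - j))%N.
  apply: card_ffun_tail => // f f' /= /eqP ff /eqP ff' i ij.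
  have jk : (size u0 + L * j <= k)%N.
    have : (0 < j)%N by exact: leq_ltn_trans ij.
    rewrite /j divn_gt0// => h; have := leq_divM (k - size u0) L; rewrite mulnC; lia.
  have E e : th e j = take (size u0 + L * j) (mkseq (I e) k).
    rewrite (Iseq e k) ?thsize; last nia.
    rewrite take_takel// -(thsize e) thtake//.
    by rewrite (leq_trans (leq_div _ _))// leq_subr.
  by rewrite -!digE; apply: thinj (ij); rewrite !E ff ff'.
rewrite card_ffun !card_ord natrX.
apply: (@le_trans _ _ (K%:R ^+ (n - j))); first by rewrite -natrX ler_nat.
have KN0 : K%:R != 0 :> R by rewrite pnatr_eq0 -lt0n.
rewrite -[X in _ * _ ^+ X](subnK jn) (exprD K%:R) mulrCA -[leLHS]mulr1 ler_pM2l ?exprn_gt0 ?ltr0n//.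
rewrite mulrC -ler_pdivrMl ?exprn_gt0 ?ltr0n// mulr1 -exprVn.
apply: (@le_trans _ _ (((a%:R^-1 ^+ L) `^ g) ^+ j)).
  by rewrite lerXn2r ?nnegrE ?invr_ge0// powR_ge0.
rewrite -powR_expn ?exprn_gt0 ?invr_gt0 ?ltr0n// -powRM ?exprn_ge0 ?invr_ge0//.
apply: ge0_ler_powR; rewrite ?nnegrE ?mulr_ge0 ?exprn_ge0 ?invr_ge0//.
rewrite -exprM !exprVn ler_pdivlMr ?exprn_gt0 ?ltr0n// ler_pdivrMl ?exprn_gt0 ?ltr0n//.
by rewrite -exprD ler_weXn2l ?ler1n//; lia.
Qed.

End trees.

(** * Finite independence *)

Section real_probability.
Context {d : measure_display} {T : measurableType d} {R : realType}.
Variable P : probability T R.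
Implicit Types (A B : set T).

Definition pr A : R := fine (P A).

Lemma prE A : measurable A -> (pr A)%:E = P A.
Proof. by move=> mA; rewrite fineK// fin_num_measure. Qed.

Lemma pr_ge0 A : 0 <= pr A.
Proof. by rewrite fine_ge0. Qed.

Lemma pr_setT : pr setT = 1.
Proof. by rewrite /pr probability_setT. Qed.

Lemma pr_set0 : pr set0 = 0.
Proof. by rewrite /pr measure0. Qed.

Lemma le_pr A B : measurable A -> measurable B -> A `<=` B -> pr A <= pr B.
Proof.
by move=> mA mB AB; rewrite -lee_fin !prE//; apply: le_measure => //; exact/mem_set.
Qed.

Lemma prID A B : measurable A -> measurable B -> pr A = pr (A `&` B) + pr (A `\` B).
Proof.
move=> mA mB; apply: EFin_inj; rewrite EFinD !prE//.
- by rewrite addeC -measureDI.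
- exact: measurableD.
- exact: measurableI.
Qed.

Lemma pr_setC A : measurable A -> pr (~` A) = 1 - pr A.
Proof.
move=> mA; have := prID measurableT mA; rewrite pr_setT setTI setTD => ->.
by rewrite addrAC subrr add0r.
Qed.

Lemma prB A B : measurable A -> measurable B -> B `<=` A -> pr (A `\` B) = pr A - pr B.
Proof.
move=> mA mB BA; rewrite (prID mA mB) (_ : A `&` B = B); first by rewrite addrAC subrr add0r.
exact/setIidPr.
Qed.

(** The moment inequalities below are pointwise inequalities between combinations of indicators.
    Coefficients are nonnegative, so that nonnegative integrals suffice; negative terms are moved to
    the other side. *)
Lemma indicator_sum_le (I J : finType) (A : I -> set T) (B : J -> set T)
    (c : I -> R) (e : J -> R) :
  (forall i, measurable (A i)) -> (forall j, measurable (B j)) ->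
  (forall i, 0 <= c i) -> (forall j, 0 <= e j) ->
  (forall w, \sum_i c i * (w \in A i)%:R <= \sum_j e j * (w \in B j)%:R) ->
  \sum_i c i * pr (A i) <= \sum_j e j * pr (B j).
Proof.
move=> mA mB c0 e0 H.
have mI (U : set T) : measurable U -> measurable_fun setT (fun w => (w \in U)%:R : R).
  by move=> mU; exact: measurable_indic.
have key (K : finType) (D : K -> set T) (x : K -> R) : (forall k, measurable (D k)) ->
    (forall k, 0 <= x k) ->
    (\int[P]_w (\sum_(k <- enum K) (x k * (w \in D k)%:R)%:E) =
    (\sum_k x k * pr (D k))%:E)%E.
  move=> mD x0.
  have mf k : measurable_fun setT (fun w : T => ((x k * (w \in D k)%:R)%:E : \bar R)).
    apply/measurable_EFinP; apply: measurable_funM; first exact: measurable_cst.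
    exact: mI.
  rewrite ge0_integral_sum//; last by move=> k w _; rewrite lee_fin mulr_ge0.
  rewrite -sumEFin big_enum/=; apply: eq_bigr => k _.
  under eq_integral do rewrite EFinM.
  rewrite ge0_integralZl_EFin//; last by apply/measurable_EFinP; exact: mI.
  by rewrite (integral_indic P measurableT (mD k)) setIT EFinM prE.
rewrite -lee_fin -!key//; apply: ge0_le_integral => //.
- by move=> w _; apply: sume_ge0 => i _; rewrite lee_fin mulr_ge0.
- apply: emeasurable_sum => i; apply/measurable_EFinP; apply: measurable_funM => //.
  exact: mI.
- apply: emeasurable_sum => i; apply/measurable_EFinP; apply: measurable_funM => //.
  exact: mI.
- by move=> w _; rewrite !sumEFin lee_fin !big_enum/=.
Qed.

Lemma markov_card (I : finType) (A : I -> set T) (N : R) (B : set T) : 0 <= N ->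
  (forall i, measurable (A i)) -> measurable B ->
  (forall w, B w -> N <= #|[pred i | w \in A i]|%:R) ->
  N * pr B <= \sum_i pr (A i).
Proof.
move=> N0 mA mB H.
have := @indicator_sum_le unit I (fun=> B) A (fun=> N) (fun=> 1) (fun=> mB) mA
  (fun=> N0) (fun=> ler01).
rewrite big_const card_unit/= addr0; under [leRHS]eq_bigr do rewrite mul1r.
apply=> w; rewrite big_const card_unit/= addr0.
under eq_bigr do rewrite mul1r.
rewrite -natr_sum; have [|_] := boolP (w \in B); last by rewrite mulr0.
rewrite mulr1 => /set_mem /H /le_trans; apply.
by rewrite -sum1_card big_mkcond/= ler_nat; apply: leq_sum => i _; rewrite !inE; case: ifP.
Qed.

(* Integrate [l^2 1_(Y >= K) - 2 l (Y - K) + Y^2 >= 0]. *)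
Lemma second_moment (I : finType) (A : I -> set T) (K l : R) (B : set T) :
  0 < l -> 0 <= K -> (forall i, measurable (A i)) -> measurable B ->
  (forall w, K <= #|[pred i | w \in A i]|%:R -> B w) ->
  2 * l * (\sum_i pr (A i) - K) <= l ^+ 2 * pr B + \sum_i \sum_j pr (A i `&` A j).
Proof.
move=> l0 K0 mA mB H.
(* Terms of the right-hand side: [l^2] on [B], the constant [2 l K] moved across the inequality, and
   the pairs making up [Y^2]. *)
pose D (x : bool + (I * I)) : set T :=
  match x with inl true => B | inl false => setT | inr x => A x.1 `&` A x.2 end.
pose e (x : bool + (I * I)) : R :=
  match x with inl true => l ^+ 2 | inl false => 2 * l * K | inr x => 1 end.
have := @indicator_sum_le I _ A D (fun=> 2 * l) e mA.
have -> : \sum_x e x * pr (D x) =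
    l ^+ 2 * pr B + 2 * l * K + \sum_i \sum_j pr (A i `&` A j).
  rewrite big_sumType/= big_bool/= pr_setT mulr1; congr (_ + _).
  rewrite pair_big/=; apply: eq_bigr => -[i j] _; by rewrite mul1r.
rewrite -mulr_sumr => key; rewrite mulrBr lerBlDr addrAC; apply: key => //.
- by case=> [[]|[i j]] //=; exact: measurableI.
- by move=> _; rewrite mulr_ge0// ltW.
- by case=> [[]|x] //=; rewrite ?sqr_ge0// mulr_ge0// mulr_ge0// ltW.
move=> w; rewrite -mulr_sumr big_sumType/= big_bool/= in_setT mulr1.
have -> : \sum_(x : I * I) e (inr x) * (w \in D (inr x))%:R =
    (\sum_i (w \in A i)%:R) ^+ 2.
  rewrite expr2 big_distrlr pair_big/=; apply: eq_bigr => -[i j] _ /=.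
  by rewrite mul1r in_setI -mulnb natrM.
have YE : \sum_i (w \in A i)%:R = #|[pred i | w \in A i]|%:R :> R.
  rewrite -natr_sum -sum1_card [in RHS]big_mkcond/=; congr (_%:R).
set Y := \sum_i _; have Y0 : 0 <= Y by rewrite /Y YE.
have [wB|wB] := boolP (w \in B); first by rewrite mulr1; have := sqr_ge0 (Y - l); nra.
have YK : Y < K.
  rewrite ltNge; apply: contra wB => KY; apply/mem_set/H.
  by rewrite -YE.
rewrite mulr0 add0r; nra.
Qed.

End real_probability.

Section bernoulli.
Context {d : measure_display} {T : measurableType d} {R : realType}.
Variable P : probability T R.
Variables (I : eqType) (p : R).
Implicit Types (X : T -> I -> bool) (S : seq I) (F G : (I -> bool) -> bool).

Definition bernoulli X : Prop :=
  (forall u, measurable [set w | X w u]) /\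
  (forall S, uniq S -> pr P [set w | all (X w) S] = p ^+ size S).

Definition depends S F : Prop :=
  forall s s' : I -> bool, {in S, s =1 s'} -> F s = F s'.

Definition override u (x : bool) (s : I -> bool) : I -> bool :=
  fun v => if v == u then x else s v.

(** Expectation of [F] under independent sites, expanded site by site, with [false] off the listed
    sites. As it does not mention [X], two Bernoulli families give a local event the same
    probability. *)
Fixpoint bernoulli_mean S F : R :=
  if S is u :: S' then
    p * bernoulli_mean S' (F \o override u true)
    + (1 - p) * bernoulli_mean S' (F \o override u false)
  else (F (fun=> false))%:R.

Lemma depends_override u x S F : depends (u :: S) F -> depends S (F \o override u x).
Proof.
move=> dF s s' ss; apply: dF => v; rewrite /override inE.
by case: eqVneq => //= _ /ss.
Qed.

Lemma depends_sub S S' F : {subset S <= S'} -> depends S F -> depends S' F.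
Proof. by move=> SS dF s s' ss; apply: dF => v /SS/ss. Qed.

Lemma override_id u (x : bool) (s : I -> bool) : s u = x -> override u x s = s.
Proof.
by move=> sx; apply/funext => v; rewrite /override; case: eqVneq => // ->.
Qed.

Lemma measurable_all X S : (forall u, measurable [set w | X w u]) ->
  measurable [set w | all (X w) S].
Proof.
move=> mX; elim: S => [|u S IH] /=.
  by rewrite (_ : [set _ | _] = setT)//; apply/seteqP; split.
rewrite (_ : [set _ | _] = [set w | X w u] `&` [set w | all (X w) S]).
  exact: measurableI.
by apply/seteqP; split => w /= /andP.
Qed.

(* [B] is only assumed independent of the events [all (X w) S'], so that the
   induction can condition on one coordinate after the other. *)
Lemma pr_depends_cap X S F (B : set T) : (forall u, measurable [set w | X w u]) ->
  uniq S -> depends S F -> measurable B ->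
  (forall S', uniq S' -> {subset S' <= S} ->
    pr P (B `&` [set w | all (X w) S']) = pr P B * p ^+ size S') ->
  measurable [set w | F (X w)] /\
  pr P (B `&` [set w | F (X w)]) = pr P B * bernoulli_mean S F.
Proof.
move=> mX; elim: S F B => [|u S IH] F B /=.
  move=> _ dF mB _.
  have -> : [set w | F (X w)] = if F (fun=> false) then setT else set0.
    apply/seteqP; split => w /=; rewrite (dF (X w) (fun=> false))//.
      by move=> ->.
    by case: (F _).
  case: (F _); first by split => //; rewrite setIT mulr1.
  by split => //; rewrite setI0 pr_set0 mulr0.
move=> /andP[uS unS] dF mB HB; have mXu := mX u.
have dF' x : depends S (F \o override u x) by exact: depends_override.
pose A x := if x then [set w | X w u] else ~` [set w | X w u].
have mA x : measurable (A x) by case: x => //; exact: measurableC.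
have AE x w : A x w -> X w u = x.
  by case: x => //= /negP/negbTE.
have prB : forall S', uniq S' -> {subset S' <= S} ->
    pr P (B `&` [set w | X w u] `&` [set w | all (X w) S']) = pr P B * p ^+ (size S').+1.
  move=> S' uS' SS'; have := HB (u :: S'); rewrite /= uS' andbT.
  rewrite (_ : [set w | X w u && all (X w) S'] =
    [set w | X w u] `&` [set w | all (X w) S']) ?setIA; last first.
    by apply/seteqP; split => w /= /andP.
  move=> -> //; first by apply: contra uS => /SS'.
  by move=> v; rewrite !inE => /predU1P[->|/SS' ->]; rewrite ?eqxx ?orbT.
have prBu : pr P (B `&` [set w | X w u]) = pr P B * p.
  have := prB [::] isT (fun v => _); rewrite /= expr1 => <- //.
  by rewrite (_ : [set _ | true] = setT) ?setIT//; apply/seteqP; split.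
have prBA x : pr P (B `&` A x) = pr P B * (if x then p else 1 - p).
  case: x => //=; have := prID P mB mXu; rewrite setDE prBu => e.
  by rewrite mulrBr mulr1 {1}e addrAC subrr add0r.
have cap x S' : uniq S' -> {subset S' <= S} ->
    pr P (B `&` A x `&` [set w | all (X w) S']) = pr P (B `&` A x) * p ^+ size S'.
  move=> uS' SS'; rewrite prBA; case: x => /=.
    by rewrite prB// exprS mulrA.
  (* Closed coordinate: subtract the open case from the event without condition on [u]. *)
  have mS' := measurable_all S' mX.
  have e := prID P (measurableI _ _ mB mS') mXu.
  rewrite setIAC -setDE.
  have e1 : pr P (B `&` [set w | all (X w) S']) = pr P B * p ^+ size S'.
    by apply: HB => // v /SS' vS; rewrite inE vS orbT.
  move: e; rewrite e1 setIAC prB// exprS => /esym/eqP; rewrite addrC eq_sym -subr_eq => /eqP <-.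
  by ring.
have [m1 h1] := IH _ (B `&` A true) unS (dF' true) (measurableI _ _ mB (mA true)) (cap true).
have [m0 h0] := IH _ (B `&` A false) unS (dF' false) (measurableI _ _ mB (mA false)) (cap false).
have FE x : A x `&` [set w | F (X w)] = A x `&` [set w | (F \o override u x) (X w)].
  by apply/seteqP; split => w /= [/[dup] Ax /AE Xx]; rewrite /= (override_id Xx).
have mF : measurable [set w | F (X w)].
  have -> : [set w | F (X w)] = (A true `&` [set w | F (X w)]) `|` (A false `&` [set w | F (X w)]).
    by rewrite -setIUl /A setUv setTI.
  by apply: measurableU; rewrite FE; exact: measurableI.
split => //; rewrite (prID P (measurableI _ _ mB mF) mXu) setDE.
rewrite -[[set w | X w u]]/(A true) -[~` _]/(A false).
by rewrite ![B `&` _ `&` A _]setIAC -!setIA !FE !setIA h1 h0 !prBA /=; ring.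
Qed.

Lemma depends_undup S F : depends S F -> depends (undup S) F.
Proof. by apply: depends_sub => v; rewrite mem_undup. Qed.

Lemma pr_depends X S F : bernoulli X -> depends S F ->
  measurable [set w | F (X w)] /\
  pr P [set w | F (X w)] = bernoulli_mean (undup S) F.
Proof.
move=> [mX pX] /depends_undup dF.
have [|mF] := pr_depends_cap mX (undup_uniq S) dF measurableT.
  by move=> S' uS' _; rewrite setTI pr_setT mul1r pX.
by rewrite setTI pr_setT mul1r.
Qed.

Lemma pr_depends_law X X' S F : bernoulli X -> bernoulli X' -> depends S F ->
  pr P [set w | F (X w)] = pr P [set w | F (X' w)].
Proof. by move=> bX bX' dF; rewrite (pr_depends bX dF).2 (pr_depends bX' dF).2. Qed.

(** [pr_depends_cap] is used twice: with [B] a cylinder over [S'], which makes [F] independent of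
    such cylinders, and then with [B] the event [F] itself. *)
Lemma pr_depends_indep X S S' F G : bernoulli X -> depends S F -> depends S' G ->
  ~~ has (mem S) S' ->
  pr P [set w | F (X w) && G (X w)] = pr P [set w | F (X w)] * pr P [set w | G (X w)].
Proof.
move=> [mX pX] dF dG disj.
have [mF _] := pr_depends (conj mX pX) dF.
have [mG EG] := pr_depends (conj mX pX) dG.
rewrite (_ : [set w | _ && _] = [set w | F (X w)] `&` [set w | G (X w)]); last first.
  by apply/seteqP; split => w /= /andP.
rewrite EG; apply: (pr_depends_cap mX (undup_uniq S') (depends_undup dG) mF _).2.
move=> S1 uS1 SS1; have mS1 := measurable_all S1 mX.
rewrite setIC.
have cyl S2 : uniq S2 -> {subset S2 <= undup S} ->
    pr P ([set w | all (X w) S1] `&` [set w | all (X w) S2]) =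
    pr P [set w | all (X w) S1] * p ^+ size S2.
  move=> uS2 SS2; rewrite pX// -exprD -size_cat -pX.
    by congr (pr P _); apply/seteqP; split => w /=; rewrite all_cat => /andP.
  rewrite cat_uniq uS1 uS2 andbT; apply/hasPn => v /SS2; rewrite mem_undup => vS.
  apply: contra disj => vS1; apply/hasP; exists v => //.
  by have := SS1 _ vS1; rewrite mem_undup.
have [_ ->] := pr_depends_cap mX (undup_uniq S) (depends_undup dF) mS1 cyl.
by rewrite pX// (pr_depends (conj mX pX) dF).2 mulrC.
Qed.

Lemma pr_depends_indep_all X (J : eqType) (r : seq J) (S : J -> seq I)
    (F : J -> (I -> bool) -> bool) : bernoulli X ->
  (forall j, depends (S j) (F j)) -> uniq r ->
  (forall i j, i != j -> ~~ has (mem (S i)) (S j)) ->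
  pr P [set w | all (fun j => F j (X w)) r] = \prod_(j <- r) pr P [set w | F j (X w)].
Proof.
move=> bX dF ur disj; elim: r ur => [|j r IH] /= => [_|/andP[jr ur]].
  by rewrite big_nil -(pr_setT P); congr (pr P _); apply/seteqP; split.
rewrite big_cons -IH//.
apply: (@pr_depends_indep X (S j) (flatten [seq S i | i <- r]) (F j)
  (fun s => all (fun i => F i s) r)) => //.
  move=> s s' ss; apply: eq_in_all => i ir; apply: dF => v vS; apply: ss.
  by apply/flatten_mapP; exists i.
apply/hasPn => v /flatten_mapP[i ir vS]; have ji : j != i.
  by apply: contraNneq jr => ->.
by have /hasPn := disj _ _ ji; exact.
Qed.

End bernoulli.

(** * Prefixes of words and local events of the tree *)

Section prefixes.
Context {R : realType} {a : nat}.
Implicit Types (u v z : seq 'I_a) (U : seq (seq 'I_a)) (sg : seq 'I_a -> bool).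

Definition prefixes v : seq (seq 'I_a) := [seq take k v | k <- iota 1 (size v)].

Lemma survivesE sg v : survives sg v = all sg (prefixes v).
Proof. by rewrite all_map. Qed.

Lemma size_prefixes v : size (prefixes v) = size v.
Proof. by rewrite size_map size_iota. Qed.

Lemma mem_prefixes v z : z \in prefixes v -> (0 < size z <= size v)%N /\ z = take (size z) v.
Proof.
by move=> /mapP[k]; rewrite mem_iota add1n ltnS => /andP[k0 kv] ->; rewrite size_takel// k0.
Qed.

Lemma uniq_prefixes v : uniq (prefixes v).
Proof.
rewrite map_inj_in_uniq ?iota_uniq// => i j.
rewrite !mem_iota !add1n !ltnS => /andP[_ iv] /andP[_ jv] /(congr1 size).
by rewrite !size_takel.
Qed.

(* [i] ranges over the possible lengths of the longest prefix of [v] in [U]. *)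
Lemma merge_prefixes (p : R) v U : 0 <= p <= 1 ->
  p ^+ size (undup (prefixes v ++ U)) <=
    p ^+ size (undup U) *
    \sum_(i < (size v).+1) p ^+ (size v - i) * ((i == 0 :> nat) || (take i v \in U))%:R.
Proof.
move=> /andP[p0 p1]; pose b i := (i == 0 :> nat) || (take i v \in U).
pose c i := b i && (i <= size v)%N.
have exc : exists i, c i by exists 0%N.
have cub i : c i -> (i <= size v)%N by move=> /andP[].
case: (ex_maxnP exc cub) => i /andP[bi iv] imax.
have szle : (size (undup U) + (size v - i) <= size (undup (prefixes v ++ U)))%N.
  have := @uniq_leq_size _ (undup U ++ [seq take k v | k <- iota i.+1 (size v - i)])
    (undup (prefixes v ++ U)).
  rewrite size_cat size_map size_iota; apply.
    rewrite cat_uniq undup_uniq/= map_inj_in_uniq ?iota_uniq ?andbT.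
      apply/hasPn => _ /mapP[k + ->]; rewrite mem_iota => /andP[ik kv].
      rewrite mem_undup; apply/negP => kU.
      have : (k <= i)%N by apply: imax; rewrite /c /b kU orbT; lia.
      by lia.
    move=> k l; rewrite !mem_iota => kl ll /(congr1 size)/=.
    have [ks ls] : (k <= size v)%N /\ (l <= size v)%N by lia.
    by rewrite !size_takel.
  move=> z; rewrite mem_cat !mem_undup mem_cat => /orP[->|/mapP[k + ->]]; first by rewrite orbT.
  rewrite mem_iota => ki; apply/orP; left; apply/mapP; exists k => //.
  by rewrite mem_iota; lia.
apply: (@le_trans _ _ (p ^+ (size (undup U) + (size v - i)))); first exact: ler_wiXn2l.
rewrite exprD ler_wpM2l ?exprn_ge0//.
have iv' : (i < (size v).+1)%N by rewrite ltnS.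
rewrite (bigD1 (Ordinal iv'))//= -/(b i) bi mulr1 lerDl; apply: sumr_ge0 => j _.
by rewrite mulr_ge0// exprn_ge0.
Qed.

Lemma card_tuple_prefix L i (z : seq 'I_a) :
  (#|[pred v : L.-tuple 'I_a | take i v == z]| <= a ^ (L - i))%N.
Proof.
have [iL|Li] := leqP i L; last first.
  rewrite (eqP (ltnW Li : (L - i)%N == 0)%N) expn0.
  apply/fintype.card_le1P => v; rewrite inE => /eqP vz w; rewrite !inE.
  apply/eqP/eqP => [wz|->//]; apply: val_inj => /=; move: vz wz.
  by rewrite !take_oversize ?size_tuple ?(ltnW Li)// => <- ->.
have dsz (v : L.-tuple 'I_a) : size (drop i v) == (L - i)%N by rewrite size_drop size_tuple.
have inj : {in [pred v : L.-tuple 'I_a | take i v == z] &, injective (fun v : L.-tuple 'I_a => Tuple (dsz v))}.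
  move=> v w; rewrite !inE => /eqP vz /eqP wz /(congr1 val) /= dvw; apply: val_inj.
  by rewrite /= -(cat_take_drop i v) -(cat_take_drop i w) vz wz dvw.
by rewrite -(card_in_image inj) (leq_trans (max_card _))// card_tuple card_ord.
Qed.

Definition nwords n : seq (seq 'I_a) :=
  flatten [seq [seq tval x | x <- enum {: k.-tuple 'I_a}] | k <- iota 1 n].

Lemma mem_nwords n v : (v \in nwords n) = (0 < size v <= n)%N.
Proof.
apply/flatten_mapP/idP => [[k]|vn].
  by rewrite mem_iota add1n ltnS => kn /mapP[w _ ->]; rewrite size_tuple.
exists (size v); first by rewrite mem_iota add1n ltnS.
by apply/mapP; exists (in_tuple v) => //; rewrite mem_enum.
Qed.

Lemma depends_survives v : depends (prefixes v) (fun sg => survives sg v).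
Proof. by move=> s s' ss; rewrite !survivesE; apply: eq_in_all. Qed.

Lemma depends_shift S u (F : (seq 'I_a -> bool) -> bool) : depends S F ->
  depends [seq u ++ v | v <- S] (fun sg => F (shift sg u)).
Proof.
by move=> dF s s' ss; apply: dF => v vS; apply: ss; apply/mapP; exists v.
Qed.

Lemma depends_good K L j : depends (nwords (L * j)) (good K L j).
Proof.
elim: j => [|j IH] s s' ss //=; congr (_ <= _)%N; apply: eq_card => v; rewrite !inE.
have -> : survives s v = survives s' v.
  apply: depends_survives => z /mem_prefixes[z0 _]; apply: ss.
  by rewrite mem_nwords mulnS; move: z0; rewrite size_tuple; lia.
congr andb; apply: (@depends_shift _ v _ IH) => _ /mapP[z zj ->]; apply: ss.
by move: zj; rewrite !mem_nwords size_cat size_tuple mulnS; lia.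
Qed.

End prefixes.

Lemma geometric_sum_le (R : realFieldType) (x : R) n : 1 < x ->
  \sum_(i < n.+1) x ^+ (n - i) <= x / (x - 1) * x ^+ n.
Proof.
move=> x1; rewrite (reindex_inj rev_ord_inj)/=.
under eq_bigr => i _ do rewrite subSS subKn ?leq_ord//.
have := subrX1 x n.+1; set s := \sum_(i < _) _ => h.
rewrite mulrAC -exprS ler_pdivlMr ?subr_gt0// mulrC -h; lra.
Qed.

(** * Second moment method for regular subtrees *)

Section galton_watson.
Context {d : measure_display} {T : measurableType d} {R : realType}.
Variable P : probability T R.
Variables (a : nat) (p : R).
Hypothesis p01 : 0 < p <= 1.
Implicit Types (X : T -> seq 'I_a -> bool).

Lemma bernoulli_shift X u : bernoulli P p X -> bernoulli P p (fun w => shift (X w) u).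
Proof.
move=> [mX pX]; split=> [v|S uS]; first exact: mX.
rewrite -(size_map (cat u)) -pX; last first.
  by rewrite map_inj_uniq// => x y /eqP; rewrite eqseq_cat// eqxx => /eqP.
by congr (pr P _); apply/seteqP; split => w /=; rewrite all_map.
Qed.

Lemma pr_survives2 X u v : bernoulli P p X ->
  pr P [set w | survives (X w) u && survives (X w) v] =
  p ^+ size (undup (prefixes u ++ prefixes v)).
Proof.
move=> [_ pX]; rewrite -pX ?undup_uniq//; congr (pr P _).
by apply/seteqP; split => w /=; rewrite !survivesE -all_cat (eq_all_r (mem_undup _)).
Qed.

Lemma pr_survives X u : bernoulli P p X ->
  pr P [set w | survives (X w) u] = p ^+ size u.
Proof.
move=> [_ pX]; rewrite -size_prefixes -pX ?uniq_prefixes//; congr (pr P _).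
by apply/seteqP; split => w /=; rewrite survivesE.
Qed.

(** For fixed [v], at most [a^(L - i)] words share its first [i] letters, and such a pair is
    weighted by [p^(2 L - i)]. The sum over [i] is geometric with ratio [a p > 1], hence comparable
    to the term [i = 0] of independent words. *)
Lemma sum_pairs_le L : 1 < a%:R * p ->
  \sum_(u : L.-tuple 'I_a) \sum_(v : L.-tuple 'I_a)
    p ^+ size (undup (prefixes u ++ prefixes v)) <=
  a%:R * p / (a%:R * p - 1) * ((a%:R * p) ^+ L) ^+ 2.
Proof.
move=> ap1; have /andP[p0 p1] := p01.
have key (v : L.-tuple 'I_a) : \sum_(u : L.-tuple 'I_a)
    p ^+ size (undup (prefixes u ++ prefixes v)) <=
    p ^+ L * (a%:R * p / (a%:R * p - 1) * (a%:R * p) ^+ L).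
  apply: (@le_trans _ _ (\sum_(u : L.-tuple 'I_a) p ^+ L *
      \sum_(i < L.+1) p ^+ (L - i) * (take i u == take i v)%:R)).
    apply: ler_sum => u _.
    have := @merge_prefixes R a p u (prefixes v).
    rewrite (undup_id (uniq_prefixes _)) size_prefixes !size_tuple (ltW p0) p1 => /(_ isT).
    move=> /le_trans; apply; rewrite ler_pM2l ?exprn_gt0//; apply: ler_sum => i _.
    rewrite ler_wpM2l ?exprn_ge0 ?(ltW p0)// ler_nat.
    case: (_ || _) / orP => // -[/eqP ->|/mem_prefixes[_ ->]]; first by rewrite !take0 eqxx.
    by rewrite size_takel ?size_tuple ?leq_ord// eqxx.
  rewrite -mulr_sumr ler_pM2l ?exprn_gt0//.
  apply: le_trans (geometric_sum_le L ap1).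
  rewrite exchange_big/=; apply: ler_sum => i _; rewrite -mulr_sumr exprMn mulrC.
  rewrite ler_wpM2r ?exprn_ge0 ?(ltW p0)// -natrX -natr_sum ler_nat.
  apply: leq_trans (card_tuple_prefix L i (take i v)).
  rewrite -sum1_card [leqRHS]big_mkcond/=; apply: leq_sum => u _; by rewrite inE; case: eqP.
rewrite exchange_big/=; apply: (le_trans (ler_sum _ (fun v _ => key v))).
rewrite sumr_const card_tuple card_ord -[leLHS]mulr_natl natrX.
by rewrite le_eqVlt; apply/orP; left; apply/eqP; rewrite !exprMn; ring.
Qed.

Section good_probability.
Variables (K L : nat) (X : T -> seq 'I_a -> bool).
Hypothesis bX : bernoulli P p X.

Definition good_pr j : R := pr P [set w | good K L j (X w)].

Definition good_leaf j (v : seq 'I_a) (sg : seq 'I_a -> bool) : bool :=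
  survives sg v && good K L j (shift sg v).

Lemma good_shift_pr j v : pr P [set w | good K L j (shift (X w) v)] = good_pr j.
Proof.
exact: (pr_depends_law (bernoulli_shift v bX) bX (@depends_good a K L j)).
Qed.

Lemma measurable_depends S F : depends S F -> measurable [set w | F (X w)].
Proof. by move=> dF; exact: (pr_depends bX dF).1. Qed.

Lemma depends_leaf j v :
  depends (prefixes v ++ [seq v ++ z | z <- nwords (L * j)]) (good_leaf j v).
Proof.
move=> s s' ss; rewrite /good_leaf; congr andb.
  by apply: depends_survives => z zv; apply: ss; rewrite mem_cat zv.
apply: (@depends_shift a _ v _ (@depends_good a K L j)) => z zv.
by apply: ss; rewrite mem_cat zv orbT.
Qed.

Lemma good_leaf_pr j v : pr P [set w | good_leaf j v (X w)] = p ^+ size v * good_pr j.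
Proof.
rewrite (pr_depends_indep bX (@depends_survives a v)
  (@depends_shift a _ v _ (@depends_good a K L j))).
  by rewrite pr_survives// good_shift_pr.
apply/hasPn => _ /mapP[z + ->]; rewrite mem_nwords => z0; apply/negP => /mem_prefixes[+ _].
by rewrite size_cat; lia.
Qed.

(** Three disjoint sets of words are involved: the prefixes of [u] and [v], and the proper
    descendants of each. Equal lengths keep the two subtrees apart from each other and from the
    prefixes. *)
Lemma good_leaf_pr2 j u v : u != v -> size u = size v ->
  pr P [set w | good_leaf j u (X w) && good_leaf j v (X w)] =
  p ^+ size (undup (prefixes u ++ prefixes v)) * good_pr j ^+ 2.
Proof.
move=> uv suv.
pose F sg := survives sg u && survives sg v.
pose G sg := good K L j (shift sg u) && good K L j (shift sg v).
have -> : [set w | good_leaf j u (X w) && good_leaf j v (X w)] = [set w | F (X w) && G (X w)].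
  by apply/seteqP; split => w /=; rewrite /good_leaf /F /G andbACA.
have dg := @depends_good a K L j.
have dF : depends (prefixes u ++ prefixes v) F.
  by move=> s s' ss; rewrite /F; congr andb; apply: depends_survives => z zu;
    apply: ss; rewrite mem_cat zu ?orbT.
have dG : depends ([seq u ++ z | z <- nwords (L * j)] ++ [seq v ++ z | z <- nwords (L * j)]) G.
  by move=> s s' ss; rewrite /G; congr andb; apply: (depends_shift dg) => z zu;
    apply: ss; rewrite mem_cat zu ?orbT.
rewrite (pr_depends_indep bX dF dG).
  rewrite pr_survives2//; congr (_ * _).
  rewrite (pr_depends_indep bX (@depends_shift a _ u _ dg) (@depends_shift a _ v _ dg)).
    by rewrite !good_shift_pr.
  apply/hasPn => _ /mapP[z _ ->]; apply/negP => /mapP[z' _] /eqP.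
  by rewrite eqseq_cat// eq_sym (negbTE uv).
apply/hasPn => x; rewrite mem_cat => xin; apply/negP => xpre.
have {xpre} xL : (size x <= size v)%N.
  have : x \in prefixes u ++ prefixes v by [].
  by rewrite mem_cat => /orP[]/mem_prefixes[/andP[_]]; rewrite ?suv.
by case/orP: xin xL => /mapP[z + ->]; rewrite mem_nwords size_cat ?suv => /andP[z0 _];
  by rewrite -[leqRHS]addn0 leq_add2l leqNgt z0.
Qed.

(* Second moment method, [C = a p / (a p - 1)] bounding
   [E Z_L^2 / (E Z_L)^2] uniformly in [L]. *)
Lemma good_pr_ge (C := a%:R * p / (a%:R * p - 1)) (x0 := (8 * C)^-1) j :
  1 < a%:R * p -> 1 <= x0 * (a%:R * p) ^+ L -> 2 * K%:R <= x0 * (a%:R * p) ^+ L ->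
  x0 <= good_pr j.
Proof.
move=> ap1 x0L KL; have /andP[p0 p1] := p01.
have C1 : 1 <= C by rewrite /C ler_pdivlMr ?subr_gt0//; lra.
have x00 : 0 < x0 by rewrite invr_gt0; lra.
have C8 : 8 * C * x0 = 1 by rewrite divff//; lra.
have sp := sum_pairs_le L ap1; rewrite -/C in sp.
have x01 : x0 <= 1 by rewrite invf_le1; lra.
clearbody x0; clearbody C.
elim: j => [|j IH].
  by rewrite /good_pr (_ : [set _ | _] = setT) ?pr_setT//; apply/seteqP; split.
set m := (a%:R * p) ^+ L in x0L KL *.
have m0 : 0 < m by rewrite exprn_gt0//; lra.
pose E := m * good_pr j.
have Ex : x0 * m <= E by rewrite mulrC ler_pM2l.
have E1 : 1 <= E by lra.
have E0 : 0 < E by lra.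
(* [E] is the mean number of good leaves. The diagonal contributes [E <= C E^2], since [E >= 1], so
   the second moment is at most [2 C E^2]; with [K <= E / 2], the optimal choice is [l = 4 C E], and
   it returns exactly [1 / (8 C) = x0]. The induction thus loses nothing from one depth to the
   next. *)
have l0 : 0 < 4 * C * E by rewrite !mulr_gt0//; lra.
have ml (v : L.-tuple 'I_a) : measurable [set w | good_leaf j v (X w)].
  exact: measurable_depends (@depends_leaf j v).
have mg := measurable_depends (@depends_good a K L j.+1).
have hB w : K%:R <= #|[pred v : L.-tuple 'I_a | w \in [set w | good_leaf j v (X w)]]|%:R :> R ->
    [set w | good K L j.+1 (X w)] w.
  rewrite ler_nat => /leq_trans; apply; apply: subset_leq_card.
  by apply/fintype.subsetP => v; rewrite !inE => /set_mem.
have := second_moment P l0 (ler0n _ K) ml mg hB.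
have -> : \sum_(v : L.-tuple 'I_a) pr P [set w | good_leaf j v (X w)] = E.
  under eq_bigr do rewrite good_leaf_pr size_tuple.
  by rewrite sumr_const card_tuple card_ord -mulr_natl natrX /E /m exprMn mulrA.
have -> : \sum_(u : L.-tuple 'I_a) \sum_(v : L.-tuple 'I_a)
    pr P ([set w | good_leaf j u (X w)] `&` [set w | good_leaf j v (X w)]) =
  \sum_(u : L.-tuple 'I_a) \sum_(v : L.-tuple 'I_a)
    pr P [set w | good_leaf j u (X w) && good_leaf j v (X w)].
  apply: eq_bigr => u _; apply: eq_bigr => v _; congr (pr P _).
  by apply/seteqP; split => w /= /andP.
have S2 : \sum_(u : L.-tuple 'I_a) \sum_(v : L.-tuple 'I_a)
    pr P [set w | good_leaf j u (X w) && good_leaf j v (X w)] <= C * E ^+ 2 + E.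
  apply: (@le_trans _ _ (\sum_(u : L.-tuple 'I_a) ((\sum_(v : L.-tuple 'I_a)
      p ^+ size (undup (prefixes u ++ prefixes v))) * good_pr j ^+ 2 + p ^+ L * good_pr j))).
    apply: ler_sum => u _; rewrite (bigD1 u)//= mulr_suml [in leRHS](bigD1 u)//= addrAC.
    apply: lerD.
      rewrite (_ : [set _ | _] = [set w | good_leaf j u (X w)]).
        by rewrite good_leaf_pr size_tuple lerDr mulr_ge0 ?exprn_ge0 ?(ltW p0) ?sqr_ge0 ?pr_ge0.
      by apply/seteqP; split => w /=; rewrite andbb.
    apply: ler_sum => v vu; rewrite good_leaf_pr2 ?size_tuple//.
    by rewrite eq_sym; apply: contra vu => /eqP /val_inj ->.
  rewrite big_split/= -mulr_suml sumr_const card_tuple card_ord lerD//.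
    rewrite /E exprMn [leRHS]mulrA ler_wpM2r ?sqr_ge0//.
  by rewrite -mulr_natl natrX /E /m exprMn mulrA.
move=> /le_trans/(_ (lerD (lexx _) S2)) H; rewrite -/(good_pr j.+1) in H.
have KE : K%:R <= E / 2 by lra.
have CE0 : 0 < C * E ^+ 2 by rewrite mulr_gt0 ?exprn_gt0//; lra.
have : 4 * (C * E ^+ 2) <= 16 * C * (C * E ^+ 2) * good_pr j.+1 + 2 * (C * E ^+ 2).
  have h1 : 8 * (C * E) * (E / 2) <= 8 * (C * E) * (E - K%:R).
    by rewrite ler_wpM2l ?mulr_ge0//; lra.
  have h2 : E <= C * E ^+ 2 by nra.
  by move: H h1 h2; rewrite !expr2; nra.
move=> h; have : 2 * (C * E ^+ 2) <= 2 * (C * E ^+ 2) * (8 * C * good_pr j.+1) by lra.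
have D0 : 0 < 2 * (C * E ^+ 2) by lra.
rewrite -[leLHS]mulr1 (ler_pM2l D0) => h'.
have := ler_wpM2l (ltW x00) h'; rewrite mulr1 => /le_trans; apply.
by rewrite mulrA [x0 * _]mulrC C8 mul1r.
Qed.

End good_probability.

End galton_watson.

(** * Survival of the Galton-Watson tree *)

Section offspring_iteration.
Context {R : realType}.
Variables (a : nat) (p : R).
Hypotheses (a2 : (1 < a)%N) (p01 : 0 < p <= 1).

(** Generating function of the binomial number of surviving children of a vertex. *)
Definition offspring (x : R) : R := (1 - p + p * x) ^+ a.

Let f := offspring.
Let p0 : 0 < p. Proof. by case/andP: p01. Qed.
Let p1 : p <= 1. Proof. by case/andP: p01. Qed.

Lemma offspring1 : f 1 = 1.
Proof. by rewrite /f /offspring mulr1 subrK expr1n. Qed.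

Lemma offspring_le x y : 0 <= x -> x <= y -> f x <= f y.
Proof.
move=> x0 xy; have h : p * x <= p * y by rewrite ler_pM2l.
have h0 : 0 <= p * x by rewrite mulr_ge0// ltW.
have h1 := p1; rewrite /f /offspring lerXn2r ?nnegrE; lra.
Qed.

Lemma offspring_ge0 x : 0 <= x -> 0 <= f x.
Proof.
move=> x0; have h0 : 0 <= p * x by rewrite mulr_ge0// ltW.
by have h1 := p1; apply: exprn_ge0; lra.
Qed.

Lemma offspring_le1 x : 0 <= x <= 1 -> f x <= 1.
Proof. by move=> /andP[x0 x1]; rewrite -offspring1 offspring_le. Qed.

Lemma iter_offspring_ge0 m x : 0 <= x -> 0 <= iter m f x.
Proof. by move=> x0; elim: m => //= m IH; exact: offspring_ge0. Qed.

Lemma iter_offspring_le1 m x : 0 <= x <= 1 -> iter m f x <= 1.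
Proof.
move=> /andP[x0 x1]; elim: m => //= m IH; apply: offspring_le1.
by rewrite IH iter_offspring_ge0.
Qed.

Lemma iter_offspring_le m x y : 0 <= x -> x <= y -> iter m f x <= iter m f y.
Proof.
move=> x0 xy; elim: m => //= m IH; apply: offspring_le => //.
exact: iter_offspring_ge0.
Qed.

(** Convexity on the chord from [u] to 1, where [f 1 = 1]. By induction on the exponent: multiplying
    two such bounds leaves the nonnegative defect [r (1 - r) (1 - A) (1 - A^n)]. *)
Lemma offspring_convex u r : 0 <= u <= 1 -> 0 <= r <= 1 ->
  f (u + r * (1 - u)) <= f u + r * (1 - f u).
Proof.
move=> /andP[u0 u1] /andP[r0 r1]; rewrite /f /offspring.
pose A := 1 - p + p * u; rewrite -/A.
have -> : 1 - p + p * (u + r * (1 - u)) = A + r * (1 - A) by rewrite /A; ring.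
have pu0 : 0 <= p * u by rewrite mulr_ge0// ltW.
have pu1 : p * u <= p * 1 by rewrite ler_pM2l.
have h1 := p1; have A0 : 0 <= A by rewrite /A; lra.
have A1 : A <= 1 by rewrite /A; lra.
clearbody A.
have B0 : 0 <= A + r * (1 - A) by rewrite addr_ge0// mulr_ge0//; lra.
elim: (a) => [|n IH]; first by rewrite !expr0; lra.
rewrite !exprS; apply: (@le_trans _ _ ((A + r * (1 - A)) * (A ^+ n + r * (1 - A ^+ n)))).
  exact: ler_wpM2l.
rewrite -subr_ge0.
have -> : A * A ^+ n + r * (1 - A * A ^+ n) - (A + r * (1 - A)) * (A ^+ n + r * (1 - A ^+ n)) =
  r * (1 - r) * ((1 - A) * (1 - A ^+ n)) by ring.
have An : A ^+ n <= 1 by rewrite exprn_ile1.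
by rewrite mulr_ge0 ?mulr_ge0//; lra.
Qed.

(** Factor [f x - 1] by a geometric sum and cancel [x - 1]. The left-hand side is strictly
    increasing in [x] because [a >= 2], which gives uniqueness below 1; its value at 1 is [a p],
    which excludes a fixed point below 1 when [a p <= 1]. *)
Lemma offspring_fixed x : 0 <= x < 1 -> f x = x ->
  p * \sum_(i < a) (1 - p + p * x) ^+ i = 1.
Proof.
move=> /andP[x0 x1] fx; have := subrX1 (1 - p + p * x) a; rewrite -[_ ^+ a]/(f x) fx.
set S := \sum_(i < a) _ => h; have x1' : x - 1 != 0 by rewrite subr_eq0 lt_eqF.
by apply: (mulfI x1'); rewrite mulr1 {2}h; ring.
Qed.

Lemma offspring_fixed_uniq x y : 0 <= x -> x < y -> y < 1 -> f x = x -> f y = y -> False.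
Proof.
move=> x0 xy y1 fx fy.
have := offspring_fixed (x := x); rewrite x0 (lt_trans xy y1) => /(_ isT fx) hx.
have := offspring_fixed (x := y); rewrite y1 (le_trans x0 (ltW xy)) => /(_ isT fy) hy.
have h1 := p1; have pxy : p * x < p * y by rewrite ltr_pM2l.
have px0 : 0 <= p * x by rewrite mulr_ge0// ltW.
have : p * \sum_(i < a) (1 - p + p * x) ^+ i < p * \sum_(i < a) (1 - p + p * y) ^+ i.
  rewrite ltr_pM2l// (bigD1 (Ordinal a2))//= [ltRHS](bigD1 (Ordinal a2))//= !expr1.
  apply: ltr_leD; first lra.
  by apply: ler_sum => i _; rewrite lerXn2r ?nnegrE; lra.
by rewrite hx hy ltxx.
Qed.

Lemma offspring_subcritical_fixed x : a%:R * p <= 1 -> 0 <= x <= 1 -> f x = x -> x = 1.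
Proof.
move=> ap /andP[x0 x1] fx; apply/eqP; rewrite eq_le x1 leNgt; apply/negP => xlt.
have := offspring_fixed (x := x); rewrite x0 xlt => /(_ isT fx) hx.
have h1 := p1; have pxy : p * x < p * 1 by rewrite ltr_pM2l.
have px0 : 0 <= p * x by rewrite mulr_ge0// ltW.
have : p * \sum_(i < a) (1 - p + p * x) ^+ i < p * \sum_(i < a) 1.
  rewrite ltr_pM2l// (bigD1 (Ordinal a2))//= [ltRHS](bigD1 (Ordinal a2))//= !expr1.
  apply: ltr_leD; first lra.
  by apply: ler_sum => i _; rewrite exprn_ile1//; lra.
by rewrite hx sumr_const card_ord; lra.
Qed.

Lemma offspring_cvg_fixed (u : nat -> R) l : (forall m, u m.+1 = f (u m)) ->
  u n @[n --> \oo] --> l -> f l = l.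
Proof.
move=> uS ul; have fc : continuous f.
  move=> x; rewrite /f /offspring.
  apply: (@continuous_comp _ _ _ (fun x => 1 - p + p * x) (fun y => y ^+ a)).
    by apply: cvgD; [exact: cvg_cst|apply: cvgM; [exact: cvg_cst|exact: cvg_id]].
  exact: exprn_continuous.
have h1 : f (u n) @[n --> \oo] --> f l by apply: continuous_cvg => //; exact: fc.
have h2 : u n.+1 @[n --> \oo] --> l by rewrite cvg_shiftS.
have : u n.+1 @[n --> \oo] --> f l by under eq_fun do rewrite uS.
by move=> /cvg_lim <-//; move: h2 => /cvg_lim ->.
Qed.

Lemma iter_offspring_cvg : exists l : R,
  [/\ 0 <= l <= 1, f l = l, iter m f 0 @[m --> \oo] --> l & forall m, iter m f 0 <= l].
Proof.
pose u m := iter m f 0.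
have unit m : 0 <= u m <= 1.
  by rewrite /u iter_offspring_ge0//= iter_offspring_le1// lexx ler01.
have nd : nondecreasing_seq u.
  apply/nondecreasing_seqP => m; rewrite /u iterSr; apply: iter_offspring_le => //.
  exact: offspring_ge0.
have uc : cvgn u.
  apply: nondecreasing_is_cvgn => //; exists 1 => _ [m _ <-].
  by case/andP: (unit m).
exists (limn u); split => //.
- apply/andP; split.
    by apply: limr_ge => //; apply: nearW => m; case/andP: (unit m).
  by apply: limr_le => //; apply: nearW => m; case/andP: (unit m).
- exact: offspring_cvg_fixed uc.
- by move=> m; exact: nondecreasing_cvgn_le.
Qed.

Lemma iter_offspring_subcritical : a%:R * p <= 1 -> iter m f 0 @[m --> \oo] --> (1 : R).
Proof.
by move=> ap; have [l [l01 fl ul _]] := iter_offspring_cvg;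
  rewrite -(offspring_subcritical_fixed ap l01 fl).
Qed.

(* [r m], the position of [f^m x] between [f^m 0] and [1], is nonincreasing by
   convexity; a positive limit would give a second fixed point below [1]. *)
Lemma iter_offspring_gap x : 0 <= x < 1 ->
  iter m f x - iter m f 0 @[m --> \oo] --> (0 : R).
Proof.
move=> /andP[x0 x1]; have [l [/andP[l0 l1] fl ul ule]] := iter_offspring_cvg.
pose u m := iter m f 0; pose v m := iter m f x.
have uv m : u m <= v m by exact: iter_offspring_le.
have v1 m : v m <= 1 by apply: iter_offspring_le1; rewrite x0 ltW.
have u0 m : 0 <= u m by exact: iter_offspring_ge0.
move: l1; rewrite le_eqVlt => /predU1P[l1|l1].
  apply: (@squeeze_cvgr _ _ _ _ (fun=> 0) (fun m => 1 - u m)).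
  - by apply: nearW => m; rewrite subr_ge0 uv lerD2r v1.
  - exact: cvg_cst.
  - by rewrite -(subrr 1) -{3}l1; apply: cvgB => //; exact: cvg_cst.
have u1 m : u m < 1 by exact: le_lt_trans (ule m) l1.
have d0 m : 0 < 1 - u m by rewrite subr_gt0.
pose r m := (v m - u m) / (1 - u m).
have rE m : v m - u m = r m * (1 - u m) by rewrite /r divfK// gt_eqF.
have r01 m : 0 <= r m <= 1.
  by rewrite /r divr_ge0 ?subr_ge0 ?uv ?(ltW (u1 m))//= ler_pdivrMr// mul1r lerD2r.
have rS m : r m.+1 <= r m.
  rewrite {1}/r ler_pdivrMr// lerBlDl /v /u !iterS -/(u m) -/(v m).
  have -> : v m = u m + r m * (1 - u m) by rewrite -rE addrC subrK.
  by apply: offspring_convex; rewrite ?u0 ?(ltW (u1 m)).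
have rni : nonincreasing_seq r by apply/nonincreasing_seqP.
have rc : cvgn r.
  by apply: nonincreasing_is_cvgn => //; exists 0 => _ [m _ <-]; case/andP: (r01 m).
have rx : limn r <= x.
  apply: (le_trans (nonincreasing_cvgn_ge rni rc 0)).
  by rewrite /r /v /u /= !subr0 divr1.
have rl0 : 0 <= limn r by apply: limr_ge => //; apply: nearW => m; case/andP: (r01 m).
have gap : r m * (1 - u m) @[m --> \oo] --> limn r * (1 - l).
  by apply: cvgM => //; apply: cvgB => //; exact: cvg_cst.
have vc : v m @[m --> \oo] --> l + limn r * (1 - l).
  have -> : v = (fun m => u m + r m * (1 - u m)).
    by apply/funext => m; rewrite -rE addrC subrK.
  exact: cvgD.
have fv := offspring_cvg_fixed (fun m => erefl (v m.+1)) vc.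
under eq_fun do rewrite rE.
suff -> : 0 = limn r * (1 - l) :> R by [].
move: rl0; rewrite le_eqVlt => /predU1P[<-|rpos]; first by rewrite mul0r.
exfalso; apply: (offspring_fixed_uniq l0 _ _ fl fv); first by rewrite ltrDl mulr_gt0// subr_gt0.
have : limn r * (1 - l) < 1 * (1 - l) by rewrite ltr_pM2r ?subr_gt0//; lra.
lra.
Qed.

End offspring_iteration.

Section blocked.
Context {a : nat}.
Implicit Types (sg : seq 'I_a -> bool) (B : (seq 'I_a -> bool) -> bool).

(* Every surviving word of length [m] ends at a subtree satisfying [B]; with
   [B = fun=> false], the tree dies out before level [m]. *)
Fixpoint blocked B (m : nat) sg : bool :=
  if m is m'.+1 then
    all (fun i => ~~ (sg [:: i] && ~~ blocked B m' (shift sg [:: i]))) (enum 'I_a)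
  else B sg.

Lemma survives_cons sg i v : survives sg (i :: v) = sg [:: i] && survives (shift sg [:: i]) v.
Proof. by rewrite -cat1s survives_cat /survives /= andbT. Qed.

Lemma blockedP B m sg : reflect
  (forall v, size v = m -> survives sg v -> B (shift sg v)) (blocked B m sg).
Proof.
elim: m sg => [|m IH] sg /=.
  apply: (iffP idP) => [Bs v /size0nil -> _|]; first by [].
  by move=> /(_ [::] erefl isT).
apply: (iffP allP) => [H [//|i v] [sv]|H i _].
  rewrite survives_cons => /andP[si sv']; have := H i (mem_enum _ _).
  by rewrite si negbK => /IH/(_ v sv sv'); rewrite shift_cat.
rewrite negb_and negbK; case si: (sg _) => //=; apply/IH => v sv vs.
by rewrite shift_cat; apply: H; rewrite /= ?sv// survives_cons si.
Qed.

Lemma depends_blocked B n m : depends (nwords n) B -> depends (nwords (n + m)) (blocked B m).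
Proof.
move=> dB; elim: m => [|m IH] s s' ss /=.
  by apply: dB => v vn; apply: ss; rewrite addn0.
apply: eq_in_all => i _; congr (~~ (_ && ~~ _)).
  by apply: ss; rewrite mem_nwords/=; lia.
apply: (depends_shift (u := [:: i]) IH) => _ /mapP[z + ->].
by rewrite mem_nwords => zn; apply: ss; rewrite mem_nwords/=; lia.
Qed.

Lemma tree_not_blocked sg m : word_tree (survives sg) !=set0 -> ~~ blocked (fun=> false) m sg.
Proof.
move=> [i Hi]; apply/negP => /blockedP/(_ (mkseq i m)).
by rewrite size_mkseq => /(_ erefl (Hi m)).
Qed.

Lemma not_very_good_blocked K L sg m :
  (forall u, survives sg u -> ~ very_good K L (shift sg u)) ->
  exists j0, forall j, (j0 <= j)%N -> blocked (fun s => ~~ good K L j s) m sg.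
Proof.
move=> H; have /choice[j Hj] : forall v : m.-tuple 'I_a, exists j, survives sg v ->
    ~~ good K L j (shift sg v).
  move=> v; have [sv|sv] := boolP (survives sg v); last by exists 0%N.
  by have /existsNP[j /negP nj] := H _ sv; exists j.
exists (\max_v j v)%N => k jk; apply/blockedP => v /eqP sv vs.
apply: contra (Hj (Tuple sv) vs) => /=; apply: good_le.
exact: leq_trans (leq_bigmax (Tuple sv)) jk.
Qed.

End blocked.

Section extinction.
Context {d : measure_display} {T : measurableType d} {R : realType}.
Variable P : probability T R.
Variables (a : nat) (p : R).
Hypotheses (a2 : (1 < a)%N) (p01 : 0 < p <= 1).
Implicit Types (X : T -> seq 'I_a -> bool).

(** Decomposition at the root: a child is absent or blocked with probability [1 - p + p x], and the
    [a] children are independent. *)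
Lemma pr_blocked X (B : (seq 'I_a -> bool) -> bool) n m : bernoulli P p X -> depends (nwords n) B ->
  pr P [set w | blocked B m (X w)] = iter m (offspring a p) (pr P [set w | B (X w)]).
Proof.
move=> bX dB; elim: m X bX => // m IH X bX /=.
pose S (i : 'I_a) := [:: i] :: [seq [:: i] ++ z | z <- nwords (n + m)].
pose F (i : 'I_a) (s : seq 'I_a -> bool) := ~~ (s [:: i] && ~~ blocked B m (shift s [:: i])).
have d1 (i : 'I_a) : depends [:: [:: i]] (fun s : seq 'I_a -> bool => s [:: i]).
  by move=> s s' ss; apply: ss; rewrite inE.
have d2 (i : 'I_a) : depends [seq [:: i] ++ z | z <- nwords (n + m)]
    (fun s => ~~ blocked B m (shift s [:: i])).
  apply: (@depends_shift a _ [:: i] (fun s => ~~ blocked B m s)) => s s' ss.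
  by congr (~~ _); exact: (depends_blocked dB ss).
have dF i : depends (S i) (F i).
  move=> s s' ss; rewrite /F; congr (~~ (_ && _)).
    by apply: d1 => z; rewrite inE => /eqP ->; apply: ss; rewrite inE eqxx.
  by apply: d2 => z zi; apply: ss; rewrite inE zi orbT.
rewrite (pr_depends_indep_all bX dF (enum_uniq _)); last first.
  move=> i j ij; have hd k z : z \in S k -> ohead z = Some k.
    by rewrite inE => /predU1P[->|/mapP[y _ ->]].
  by apply/hasPn => z /hd zj; apply/negP => /hd; rewrite zj => -[/eqP]; rewrite eq_sym (negbTE ij).
rewrite big_enum/= (eq_bigr (fun=> 1 - p + p * iter m (offspring a p) (pr P [set w | B (X w)]))).
  by rewrite prodr_const card_ord.
move=> i _; have bXi := bernoulli_shift [:: i] bX.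
have := IH _ bXi; rewrite -(pr_depends_law bX bXi dB) => <-.
have [m2 _] := pr_depends bX (depends_shift (u := [:: i]) (depends_blocked (m := m) dB)).
have [m3 _] := pr_depends bX (d2 i).
have [m1 _] := pr_depends bX (d1 i).
have -> : [set w | F i (X w)] =
    ~` [set w | X w [:: i] && ~~ blocked B m (shift (X w) [:: i])].
  by apply/seteqP; split => w /= /negP.
rewrite pr_setC; last first.
  rewrite (_ : [set w | _ && _] = [set w | X w [:: i]] `&` [set w | ~~ blocked B m (shift (X w) [:: i])]).
    exact: measurableI.
  by apply/seteqP; split => w /= /andP.
rewrite (pr_depends_indep bX (d1 i) (d2 i)); last first.
  apply/hasPn => _ /mapP[z + ->]; rewrite mem_nwords => z0; apply/negP => zin.
  have : [:: i] ++ z \in [:: [:: i]] by [].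
  by rewrite inE => /eqP[z0']; rewrite z0' in z0.
have -> : pr P [set w | X w [:: i]] = p.
  have := bX.2 [:: [:: i]] isT; rewrite expr1 => <-.
  by congr (pr P _); apply/seteqP; split => w /=; rewrite andbT.
have -> : [set w | ~~ blocked B m (shift (X w) [:: i])] =
    ~` [set w | blocked B m (shift (X w) [:: i])].
  by apply/seteqP; split => w /= /negP.
by rewrite pr_setC//; ring.
Qed.

Lemma measurable_blocked X (B : (seq 'I_a -> bool) -> bool) n m :
  bernoulli P p X -> depends (nwords n) B -> measurable [set w | blocked B m (X w)].
Proof. by move=> bX dB; exact: (pr_depends bX (depends_blocked (m := m) dB)).1. Qed.

Lemma negligible_small (N : set T) (e : nat -> R) : e m @[m --> \oo] --> (0 : R) ->
  (forall m, exists A, [/\ measurable A, N `<=` A & (P A <= (e m)%:E)%E]) ->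
  P.-negligible N.
Proof.
move=> e0 /choice[A HA]; exists (\bigcap_m A m); split.
- by apply: bigcapT_measurable => m; case: (HA m).
- have mA : measurable (\bigcap_m A m) by apply: bigcapT_measurable => m; case: (HA m).
  apply/eqP; rewrite eq_le measure_ge0 andbT -(prE P mA) lee_fin.
  rewrite -(cvg_lim _ e0)//; apply: limr_ge; first exact: (cvgP _ e0).
  apply: nearW => m; rewrite -lee_fin prE//; have [mAm _ +] := HA m; apply: le_trans.
  by apply: le_measure; [exact/mem_set|exact/mem_set|exact: bigcap_inf].
- by move=> w Nw m _; case: (HA m) => _ /(_ w Nw).
Qed.

Lemma subcritical_extinction X : bernoulli P p X -> a%:R * p <= 1 ->
  P.-negligible [set w | word_tree (survives (X w)) !=set0].
Proof.
move=> bX ap; apply: (@negligible_small _ (fun m => 1 - iter m (offspring a p) 0)).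
  have : 1 - iter m (offspring a p) 0 @[m --> \oo] --> (1 - 1 : R).
    by apply: cvgB; [exact: cvg_cst|exact: iter_offspring_subcritical].
  by rewrite subrr.
have d0 : depends (nwords 0) (fun _ : seq 'I_a -> bool => false) by [].
move=> m; have mb := measurable_blocked m bX d0.
exists (~` [set w | blocked (fun=> false) m (X w)]); split.
- exact: measurableC.
- by move=> w tw; apply/negP; exact: tree_not_blocked.
- rewrite -(prE P (measurableC mb)) lee_fin pr_setC// (pr_blocked m bX d0).
  rewrite (_ : [set _ | _] = set0) ?pr_set0//.
  by apply/seteqP; split.
Qed.

Lemma survival_very_good X K L (x0 : R) : bernoulli P p X -> 0 < x0 ->
  (forall j, x0 <= good_pr P K L X j) ->
  {ae P, forall w, word_tree (survives (X w)) !=set0 ->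
     exists u, survives (X w) u /\ very_good K L (shift (X w) u)}.
Proof.
move=> bX x00 Hg.
have x01 : x0 <= 1.
  have [mg _] := pr_depends bX (@depends_good a K L 0).
  by apply: (le_trans (Hg 0%N)); rewrite /good_pr -lee_fin prE// probability_le1.
apply: (@negligible_small _ (fun m => iter m (offspring a p) (1 - x0) - iter m (offspring a p) 0)).
  by apply: iter_offspring_gap => //; lra.
pose B j (s : seq 'I_a -> bool) := ~~ good K L j s.
have dB j : depends (nwords (L * j)) (B j).
  by move=> s s' ss; rewrite /B; congr (~~ _); exact: (@depends_good a K L j).
have d0 : depends (nwords 0) (fun _ : seq 'I_a -> bool => false) by [].
move=> m.
pose E j := [set w | blocked (B j) m (X w)] `\` [set w | blocked (fun=> false) m (X w)].
have mB j := measurable_blocked m bX (dB j); have m0 := measurable_blocked m bX d0.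
have mE j : measurable (E j) by exact: measurableD.
have Eb j : (P (E j) <= (iter m (offspring a p) (1 - x0) - iter m (offspring a p) 0)%:E)%E.
  rewrite -(prE P (mE j)) lee_fin prB//; last first.
    by move=> w /blockedP H; apply/blockedP => v vm sv; have := H v vm sv.
  rewrite (pr_blocked m bX (dB j)) (pr_blocked m bX d0).
  rewrite (_ : [set w | false] = set0) ?pr_set0; last by apply/seteqP; split.
  rewrite lerD2r; apply: iter_offspring_le => //; rewrite ?pr_ge0//.
  have -> : [set w | B j (X w)] = ~` [set w | good K L j (X w)].
    by apply/seteqP; split => w /= /negP.
  rewrite pr_setC; first by rewrite lerB//; exact: Hg.
  exact: (pr_depends bX (@depends_good a K L j)).1.
exists (\bigcup_j E j); split.
- exact: bigcupT_measurable.
- move=> w /= /not_implyP[tw /forallNP nw].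
  have [|j0 Hj] := @not_very_good_blocked a K L (X w) m.
    by move=> u su vu; exact: (nw u).
  exists j0 => //; split; first exact: Hj.
  exact/negP/tree_not_blocked.
- have ndE : {homo E : i j / (i <= j)%N >-> (i <= j)%O}.
    move=> i j ij; apply/subsetPset => w [/blockedP bi n0]; split => //.
    apply/blockedP => v vm sv; apply: contra (bi v vm sv); exact: good_le.
  have c := nondecreasing_cvg_mu (mu := P) mE (bigcupT_measurable _ mE) ndE.
  rewrite -(cvg_lim _ c)//; apply: lime_le; first exact: (cvgP _ c).
  by apply: nearW => j; exact: Eb.
Qed.

End extinction.

Lemma bernoulli_expr (R : realFieldType) (y : R) n : 1 < y -> 1 + n%:R * (y - 1) <= y ^+ n.
Proof.
move=> y1; elim: n => [|n IH]; first by rewrite mul0r addr0.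
have y0 : 0 <= y by lra.
have n2 : 0 <= n%:R * (y - 1) ^+ 2 by rewrite mulr_ge0 ?sqr_ge0.
by have := ler_wpM2l y0 IH; rewrite exprS -[n.+1%:R]natr1; move: n2; rewrite expr2; lra.
Qed.

Lemma powR_expR (R : realType) (x y : R) : 0 < x -> x `^ y = expR (y * ln x).
Proof. by move=> x0; rewrite /powR gt_eqF. Qed.

(* [K] is about half of [x0 (a p)^L], and [a p = a^alpha]. *)
Lemma branching_parameters (R : realType) (a : nat) (p x0 g : R) :
  (1 < a)%N -> 0 < p -> 0 < x0 -> 0 <= g -> g < 1 + ln p / ln a%:R ->
  exists K L : nat, [/\ (0 < K)%N, (0 < L)%N, K%:R^-1 <= (a%:R^-1 ^+ L) `^ g,
    1 <= x0 * (a%:R * p) ^+ L & 2 * K%:R <= x0 * (a%:R * p) ^+ L].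
Proof.
move=> a1 p0 x00 g0 ga; have a0 : 0 < a%:R :> R by rewrite ltr0n ltnW.
have lna : 0 < ln a%:R :> R by rewrite ln_gt0// ltr1n.
have ag1 : a%:R^-1 `^ g <= 1.
  have ai : 0 < (a%:R : R)^-1 <= 1 by rewrite invr_gt0 a0 invf_le1// ler1n ltnW.
  by have := ger_powR ai g0; rewrite powRr0.
pose y := a%:R * p * (a%:R^-1 `^ g).
have y1 : 1 < y.
  rewrite /y powR_expR ?invr_gt0// -{1}(lnK (x := a%:R)) ?posrE// -(lnK (x := p)) ?posrE//.
  rewrite -!expRD lnV ?posrE// expR_gt1.
  move: ga; rewrite -ltrBlDl ltr_pdivlMr//; lra.
(* Here [y = a^(alpha - g) > 1]. From [y^L >= 4 / x0] follow [x0 m >= 4], so that truncating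
   [x0 m / 2] leaves [K >= x0 m / 4], and then [K >= a^(g L)]. *)
pose L := (Num.trunc (4 / x0 / (y - 1))).+1.
have yL : 4 / x0 <= y ^+ L.
  apply: (le_trans _ (bernoulli_expr L y1)).
  have q0 : 0 <= 4 / x0 / (y - 1) by rewrite !divr_ge0//; lra.
  have /andP[_] := truncn_itv q0; rewrite -/L ltr_pdivrMr ?subr_gt0//; lra.
pose m := (a%:R * p) ^+ L.
have yE : y ^+ L = m * (a%:R^-1 `^ g) ^+ L by rewrite /y exprMn.
have m0 : 0 < m by rewrite exprn_gt0 ?mulr_gt0.
have ym : y ^+ L <= m.
  by rewrite yE ler_piMr ?(ltW m0)// exprn_ile1// powR_ge0.
have xm : 4 <= x0 * m.
  by move: yL; rewrite ler_pdivrMr// mulrC => /le_trans; apply; rewrite ler_pM2l.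
have mE : m = (a%:R * p) ^+ L by [].
have L0 : (0 < L)%N by [].
clearbody m; clearbody L.
have xm2 : 0 <= x0 * m / 2 by lra.
have /andP[K1 K2] := truncn_itv xm2; rewrite -[(Num.trunc _).+1%:R]natr1 in K2.
set K := Num.trunc _ in K1 K2; clearbody K.
have K0 : 1 < K%:R :> R by lra.
exists K, L; split => //.
- by rewrite -(ltr_nat R); lra.
- rewrite powR_expn ?invr_gt0// -[leLHS]mul1r ler_pdivrMr; last lra.
  have : 1 <= x0 / 4 * y ^+ L.
    by move: yL; rewrite ler_pdivrMr// => h; lra.
  rewrite yE => /le_trans; apply; rewrite mulrA [leRHS]mulrC ler_wpM2r ?exprn_ge0 ?powR_ge0//.
  lra.
- by rewrite -mE; lra.
- by rewrite -mE; lra.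
Qed.

(** * Moments of strip counts *)

Section counting_events.
Context {d : measure_display} {T : measurableType d} {R : realType}.
Variable P : probability T R.

Lemma measurable_card_ge (I : finType) (A : I -> set T) (N : R) :
  (forall i, measurable (A i)) ->
  measurable [set w | N <= #|[pred i | w \in A i]|%:R].
Proof.
move=> mA.
have mf : measurable_fun setT (fun w => \sum_(i <- enum I) (w \in A i)%:R : R).
  by apply: measurable_sum => i; exact: (@measurable_indic _ _ R setT (A i)).
have E w : \sum_(i <- enum I) (w \in A i)%:R = #|[pred i | w \in A i]|%:R :> R.
  by rewrite big_enum/= -natr_sum -sum1_card [in RHS]big_mkcond/=; congr (_%:R).
have := mf measurableT `[N, +oo[%classic (measurable_itv _).
rewrite setTI; congr (measurable _); apply/seteqP; split => w /=;
  by rewrite in_itv/= andbT E.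
Qed.

Lemma geometric_borel_cantelli (F : nat -> set T) (C r : R) : 0 <= C -> 0 < r < 1 ->
  (forall n, measurable (F n)) -> (forall n, pr P (F n) <= C * r ^+ n) ->
  {ae P, forall w, exists n0, forall n, (n0 <= n)%N -> ~ F n w}.
Proof.
move=> C0 /andP[r0 r1] mF Fr.
have := @lim_sup_set_cvg0 _ _ _ P F mF.
have Fs : (\sum_(n <oo) P (F n) <= (C / (1 - r))%:E)%E.
  apply: lime_le; first exact: is_cvg_nneseries.
  apply: nearW => n; rewrite big_mkord.
  apply: (@le_trans _ _ (\sum_(i < n) (C * r ^+ i)%:E)%E).
    by apply: lee_sum => i _; rewrite -(prE P (mF _)) lee_fin.
  rewrite sumEFin lee_fin.
  have := @geometric_le_lim R n C r C0 r0; rewrite /series/= big_mkord; apply.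
  by rewrite ger0_norm// ltW.
rewrite (le_lt_trans Fs (ltry _)) => /(_ isT) h.
exists (lim_sup_set F); split => //.
  apply: bigcap_measurable; first by exists 0%N.
  by move=> n _; apply: bigcup_measurable => k _; exact: mF.
move=> w /= /forallNP H n _.
have /existsNP[k /not_implyP[nk /contrapT Fk]] := H n.
by exists k.
Qed.

End counting_events.

Section strips.
Context {d : measure_display} {T : measurableType d} {R : realType}.
Variable P : probability T R.
Variables (a b : nat) (p q : R).
Variables (X : T -> seq 'I_a -> bool) (Y : T -> seq 'I_b -> bool).

Definition joint_bernoulli : Prop :=
  [/\ forall u, measurable [set w | X w u], forall v, measurable [set w | Y w v] &
  forall S S', uniq S -> uniq S' ->
    pr P [set w | all (X w) S && all (Y w) S'] = p ^+ size S * q ^+ size S'].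

Hypotheses (p01 : 0 < p <= 1) (q01 : 0 < q <= 1) (bXY : joint_bernoulli).

Definition union_prefixes c (us : seq (seq 'I_c)) : seq (seq 'I_c) :=
  flatten (map prefixes us).

Definition joint_survival (l : seq (seq 'I_a * seq 'I_b)) : set T :=
  [set w | all (fun z => survives (X w) z.1 && survives (Y w) z.2) l].

(** Removing duplicates counts a shared prefix once, which makes this the exact probability of joint
    survival. *)
Definition survival_weight (l : seq (seq 'I_a * seq 'I_b)) : R :=
  p ^+ size (undup (union_prefixes (unzip1 l))) *
  q ^+ size (undup (union_prefixes (unzip2 l))).

Lemma joint_survivalE l : joint_survival l =
  [set w | all (X w) (undup (union_prefixes (unzip1 l))) &&
           all (Y w) (undup (union_prefixes (unzip2 l)))].
Proof.
apply/seteqP; split => w; rewrite /joint_survival /= !(eq_all_r (mem_undup _)) /union_prefixes;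
  elim: l => //= -[u v] l IH; rewrite !all_cat -!survivesE.
  by move=> /andP[/andP[-> ->] /IH].
by move=> /andP[/andP[-> h1] /andP[-> h2]]; rewrite IH ?h1.
Qed.

Lemma measurable_joint_survival l : measurable (joint_survival l).
Proof.
have [mX mY _] := bXY; rewrite joint_survivalE.
rewrite (_ : [set w | _ && _] =
  [set w | all (X w) (undup (union_prefixes (unzip1 l)))] `&`
  [set w | all (Y w) (undup (union_prefixes (unzip2 l)))]).
  by apply: measurableI; exact: measurable_all.
by apply/seteqP; split => w /= /andP.
Qed.

Lemma pr_joint_survival l : pr P (joint_survival l) = survival_weight l.
Proof. by have [_ _ h] := bXY; rewrite joint_survivalE h ?undup_uniq. Qed.

Section moments.
Variables (k m : nat) (Q : pred (k.-tuple 'I_a * m.-tuple 'I_b)).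

Definition word_pair (z : k.-tuple 'I_a * m.-tuple 'I_b) : seq 'I_a * seq 'I_b :=
  (tval z.1, tval z.2).

Definition surviving_pairs (w : T) : pred (k.-tuple 'I_a * m.-tuple 'I_b) :=
  [pred z | Q z && (w \in joint_survival [:: word_pair z])].

(* [moment r l] is the expectation of the [r]-th power of the number of surviving
   pairs in [Q], restricted to the survival of the pairs in [l]. *)
Fixpoint moment (r : nat) (l : seq (seq 'I_a * seq 'I_b)) : R :=
  if r is r'.+1 then \sum_(z | Q z) moment r' (word_pair z :: l) else survival_weight l.

(** Markov's inequality is applied [r] times: each step selects one more surviving pair and adds it
    to [l]. *)
Lemma markov_moment (N : R) (r : nat) l : 0 <= N ->
  measurable [set w | N <= #|surviving_pairs w|%:R] ->
  N ^+ r * pr P ([set w | N <= #|surviving_pairs w|%:R] `&` joint_survival l) <= moment r l.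
Proof.
move=> N0 mB; set B := [set w | _] in mB *.
elim: r l => [|r IH] l /=.
  have ml := measurable_joint_survival l.
  by rewrite mul1r -pr_joint_survival; apply: le_pr => //; exact: measurableI.
have mS l' : measurable (B `&` joint_survival l').
  have ml := measurable_joint_survival l'.
  exact: measurableI.
pose A z := if Q z then B `&` joint_survival (word_pair z :: l) else set0.
have mA z : measurable (A z) by rewrite /A; case: ifP.
have key : N * pr P (B `&` joint_survival l) <= \sum_z pr P (A z).
  apply: markov_card => // w [Bw lw]; apply: (le_trans Bw); rewrite ler_nat.
  apply: subset_leq_card; apply/fintype.subsetP => z; rewrite !inE => /andP[Qz /set_mem zw].
  rewrite /A Qz; apply/mem_set; split => //; move: zw lw; rewrite /joint_survival /=.
  by rewrite andbT => -> ->.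
rewrite exprSr -mulrA (le_trans (ler_wpM2l (exprn_ge0 _ N0) key))// mulr_sumr.
rewrite [leRHS]big_mkcond/=; apply: ler_sum => z _; rewrite /A; case: ifP => // _.
by rewrite pr_set0 mulr0.
Qed.

(** Bounds the mean number of new pairs in [Q] when [i] letters of [x] and [j] letters of [y] are
    already paid for, summed over [i] and [j]. *)
Variable Phi : R.
Hypothesis Phi_ge : forall (x : seq 'I_a) (y : seq 'I_b),
  \sum_(i < k.+1) \sum_(j < m.+1) p ^+ (k - i) * q ^+ (m - j) *
    #|[pred z | [&& Q z, take i z.1 == take i x & take j z.2 == take j y]]|%:R <= Phi.

(** The longest prefix of [u] already present lies on one of the words of [us]. Summing over all of
    them avoids naming it; [[::]] stands for a separation at the root. *)
Lemma merge_weight c (y : R) (K : nat) (u : K.-tuple 'I_c) (us : seq (seq 'I_c)) :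
  0 < y <= 1 ->
  y ^+ size (undup (prefixes u ++ union_prefixes us)) <=
  y ^+ size (undup (union_prefixes us)) *
  \sum_(x <- [::] :: us) \sum_(i < K.+1) y ^+ (K - i) * (take i u == take i x)%:R.
Proof.
move=> /andP[y0 y1]; have := @merge_prefixes R c y u (union_prefixes us).
rewrite (ltW y0) y1 => /(_ isT)/le_trans; apply.
rewrite ler_pM2l ?exprn_gt0// size_tuple exchange_big/=; apply: ler_sum => i _.
rewrite -mulr_sumr ler_pM2l ?exprn_gt0//.
have nn (s : seq (seq 'I_c)) : 0 <= \sum_(x <- s) (take i u == take i x)%:R :> R.
  exact: sumr_ge0.
case: (_ || _) / orP => [|_]; last exact: nn.
rewrite big_cons => -[/eqP ->|]; first by rewrite !take0 eqxx lerDl sumr_ge0.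
move=> /flattenP[_ /mapP[x xus ->]] /mem_prefixes[_ ux].
have uxi : take i u = take i x by rewrite {1}ux size_takel// size_tuple leq_ord.
by rewrite ler_wpDl// (big_rem x)//= {1}uxi eqxx lerDl nn.
Qed.

(** In each coordinate the new word leaves one of [(size l).+1] words, the empty one included; the
    two choices are unrelated, whence the square. *)
Lemma moment_step l : \sum_(z | Q z) survival_weight (word_pair z :: l) <=
  survival_weight l * ((size l).+1%:R ^+ 2 * Phi).
Proof.
have /andP[p0 _] := p01; have /andP[q0 _] := q01.
pose us := [::] :: unzip1 l; pose vs := [::] :: unzip2 l.
pose G (x : seq 'I_a) (y : seq 'I_b) (z : k.-tuple 'I_a * m.-tuple 'I_b) : R :=
  (\sum_(i < k.+1) p ^+ (k - i) * (take i z.1 == take i x)%:R) *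
  (\sum_(j < m.+1) q ^+ (m - j) * (take j z.2 == take j y)%:R).
apply: (@le_trans _ _ (\sum_(z | Q z) survival_weight l *
    \sum_(x <- us) \sum_(y <- vs) G x y z)).
  apply: ler_sum => z _; rewrite /survival_weight /=.
  have h1 := merge_weight z.1 (unzip1 l) p01.
  have h2 := merge_weight z.2 (unzip2 l) q01.
  apply: (le_trans (ler_pM _ _ h1 h2)); rewrite ?exprn_ge0 ?(ltW p0) ?(ltW q0)//.
  by rewrite mulrACA big_distrlr.
have W0 : 0 <= survival_weight l by rewrite mulr_ge0 ?exprn_ge0 ?(ltW p0) ?(ltW q0).
rewrite -mulr_sumr ler_wpM2l// exchange_big/=.
have GP x y : \sum_(z | Q z) G x y z <= Phi.
  apply: le_trans (Phi_ge x y); rewrite /G.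
  under eq_bigr => z _ do rewrite big_distrlr/=.
  rewrite exchange_big/=; apply: ler_sum => i _.
  rewrite exchange_big/=; apply: ler_sum => j _.
  under eq_bigr => z _ do rewrite mulrACA.
  rewrite -mulr_sumr ler_wpM2l ?mulr_ge0 ?exprn_ge0 ?(ltW p0) ?(ltW q0)//.
  under eq_bigr => z _ do rewrite -natrM mulnb.
  rewrite -natr_sum ler_nat -sum1_card big_mkcond [leqRHS]big_mkcond/=.
  by apply: leq_sum => z _; rewrite inE; case: (Q z).
apply: (@le_trans _ _ (\sum_(x <- us) \sum_(y <- vs) Phi)).
  apply: ler_sum => x _; rewrite exchange_big/=; exact: ler_sum.
rewrite !big_const_seq !count_predT !iter_addr_0 /us /vs /= !size_map.
by rewrite -mulrnA -[leLHS]mulr_natl expr2 natrM.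
Qed.

Lemma moment_le r l : moment r l <=
  survival_weight l * ((size l + r)%:R ^+ 2 * Phi) ^+ r.
Proof.
have Phi0 : 0 <= Phi.
  apply: le_trans (Phi_ge [::] [::]); have /andP[p0 _] := p01; have /andP[q0 _] := q01.
  by apply: sumr_ge0 => i _; apply: sumr_ge0 => j _; rewrite !mulr_ge0 ?exprn_ge0 ?(ltW p0) ?(ltW q0).
elim: r l => [|r IH] l; first by rewrite expr0 mulr1.
apply: (le_trans (ler_sum _ (fun z _ => IH (word_pair z :: l)))).
rewrite /= -mulr_suml addSnnS.
apply: (le_trans (ler_wpM2r _ (moment_step l))).
  by rewrite exprn_ge0// mulr_ge0// sqr_ge0.
rewrite [X in _ <= _ * X]exprS -[leLHS]mulrA ler_wpM2l//.
  by rewrite -pr_joint_survival pr_ge0.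
rewrite ler_wpM2r ?exprn_ge0 ?mulr_ge0 ?sqr_ge0// ler_wpM2r// lerXn2r ?nnegrE//.
by rewrite ler_nat addnS ltnS leq_addr.
Qed.

End moments.

End strips.

(** * Mean number of word pairs near a strip *)

Section strip_counts.
Context {R : realType}.

Lemma succn_le_expr (y : R) : 1 < y -> exists2 C : R, 0 < C & forall n, n.+1%:R <= C * y ^+ n.
Proof.
move=> y1; pose m := Num.min 1 (y - 1).
have m0 : 0 < m by rewrite lt_min ltr01 subr_gt0.
have m1 : m <= 1 by rewrite ge_min lexx.
have m2 : m <= y - 1 by rewrite ge_min lexx orbT.
exists m^-1; first by rewrite invr_gt0.
move=> n; rewrite -ler_pdivrMl ?invr_gt0// invrK.
apply: le_trans (bernoulli_expr n y1); rewrite -natr1.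
have : n%:R * m <= n%:R * (y - 1) by rewrite ler_wpM2l.
lra.
Qed.

(** The exponent with [a ^ perc_dim = a p], the mean number of surviving children. *)
Definition perc_dim (a : nat) (p : R) : R := 1 + ln p / ln a%:R.

Lemma perc_dim_le1 a p : (1 < a)%N -> 0 < p <= 1 -> perc_dim a p <= 1.
Proof.
move=> a1 /andP[p0 p1]; rewrite /perc_dim gerDl pmulr_lle0 ?invr_gt0 ?ln_gt0 ?ltr1n//.
exact: ln_le0.
Qed.

Lemma powR_perc_dim a p : (1 < a)%N -> 0 < p -> a%:R `^ (perc_dim a p - 1) = p.
Proof.
move=> a1 p0; rewrite powR_expR ?ltr0n ?(ltnW a1)// /perc_dim addrAC subrr add0r.
by rewrite divfK ?lnK ?posrE// gt_eqF// ln_gt0// ltr1n.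
Qed.

Lemma expr_perc_dim a p n : (1 < a)%N -> 0 < p ->
  p ^+ n = (a%:R ^+ n) `^ (perc_dim a p - 1).
Proof.
by move=> a1 p0; rewrite powR_expn ?ltr0n ?(ltnW a1)// powR_perc_dim.
Qed.

Lemma perc_dim_gt0 a p : (1 < a)%N -> 0 < p -> (0 < perc_dim a p) = (1 < a%:R * p).
Proof.
move=> a1 p0; have a0 : 0 < a%:R :> R by rewrite ltr0n ltnW.
rewrite /perc_dim -[X in X + _](divff (x := ln a%:R)); last by rewrite gt_eqF// ln_gt0// ltr1n.
rewrite -mulrDl pmulr_lgt0 ?invr_gt0 ?ln_gt0 ?ltr1n// -lnM ?posrE//.
apply/idP/idP; last exact: ln_gt0.
by apply: contraTT; rewrite -!leNgt; exact: ln_le0.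
Qed.

Lemma le_interpolation (x A B al : R) : 0 <= al <= 1 -> 0 < A -> 0 < B -> 0 <= x ->
  x <= A -> x <= B -> x <= A `^ (1 - al) * B `^ al.
Proof.
move=> /andP[al0 al1] A0 B0 x0 xA xB; have al1' : 0 <= 1 - al by lra.
have [x00|xpos] := leP x 0; first by rewrite (le_trans x00)// mulr_ge0 ?powR_ge0.
have -> : x = x `^ (1 - al) * x `^ al.
  rewrite -powRD; last by apply/implyP => _; rewrite gt_eqF.
  by rewrite subrK powRr1.
by rewrite ler_pM ?powR_ge0// ge0_ler_powR ?nnegrE// ltW.
Qed.

Lemma leq_level_self a n : (1 < a)%N -> (level a n <= n)%N.
Proof. by move=> a1; apply: up_log_min => //; case: n => // n; rewrite leq_exp2r. Qed.

Definition near_pairs a b (k m : nat) (s c e : R) : pred (k.-tuple 'I_a * m.-tuple 'I_b) :=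
  [pred z : k.-tuple 'I_a * m.-tuple 'I_b | `|word_pt z.1 + s * word_pt z.2 - c| <= e].

(** In a strip, either word determines the other up to [K0] choices: fixing the [a]-word leaves the
    [b]-word an interval of length of order [2^-n / |s|], and fixing the [b]-word leaves one of
    order [2^-n]. The prefix condition on the fixed word gives the powers. *)
Lemma near_pairs_prefix_le a b (S M : R) n (s c : R) (i j : nat) (x : seq 'I_a) (y : seq 'I_b)
    (k := level a n) (m := level b n) (K0 := 2 * M * (a%:R + b%:R) * S + 1)
    (cnt := #|[pred z : k.-tuple 'I_a * m.-tuple 'I_b |
      [&& near_pairs s c (M * 2^-1 ^+ n) z, take i z.1 == take i x & take j z.2 == take j y]]|) :
  (1 < a)%N -> (1 < b)%N -> 1 <= S -> 0 <= M -> S^-1 <= `|s| ->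
  cnt%:R <= a%:R ^+ (k - i) * K0 /\ cnt%:R <= b%:R ^+ (m - j) * K0.
Proof.
move=> a1 b1 S1 M0 Ss; have S0 : 0 < S by lra.
have s0 : 0 < `|s| by rewrite (lt_le_trans _ Ss)// invr_gt0.
have e0 : 0 <= M * 2^-1 ^+ n by rewrite mulr_ge0// exprn_ge0// invr_ge0.
pose P (z : k.-tuple 'I_a * m.-tuple 'I_b) := [&& near_pairs s c (M * 2^-1 ^+ n) z,
  take i z.1 == take i x & take j z.2 == take j y].
have K00 : 0 <= K0 by rewrite addr_ge0// !mulr_ge0// ltW.
have aS : M * a%:R <= M * (a%:R + b%:R) * S.
  rewrite -mulrA ler_wpM2l//; apply: (@le_trans _ _ (a%:R + b%:R)); first by rewrite lerDl.
  by rewrite ler_peMr.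
have bS : M * b%:R * S <= M * (a%:R + b%:R) * S.
  by rewrite ler_wpM2r ?(ltW S0)// ler_wpM2l// lerDr.
split.
- apply: (@le_trans _ _ (#|[pred u : k.-tuple 'I_a | take i u == take i x]|%:R * K0)); last first.
    by rewrite ler_wpM2r// -natrX ler_nat card_tuple_prefix.
  apply: (card_fibers_cond_le (P := P) (f := fst)) => [z /and3P[] //|u].
  apply: (@le_trans _ _ (#|[pred v : m.-tuple 'I_b |
      `|(word_pt u - c) + s * word_pt v| <= M * 2^-1 ^+ n]|%:R)).
    rewrite ler_nat; apply: leq_trans (leq_image_card (fun v => (u, v)) _).
    apply: subset_leq_card; apply/fintype.subsetP => -[u' v] /andP[/and3P[zn _ _] /eqP /= uu].
    apply/fintype.imageP; exists v; last by rewrite uu.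
    by rewrite inE; move: zn; rewrite /near_pairs /= uu addrAC.
  apply: (le_trans (card_words_near b1 _ e0 (fun v => id))); first by rewrite -normr_gt0.
  rewrite -/m; suff : M * 2^-1 ^+ n / `|s| * b%:R ^+ m <= M * (a%:R + b%:R) * S.
    by rewrite /K0; lra.
  have -> : M * 2^-1 ^+ n / `|s| * b%:R ^+ m = M * ((b%:R ^+ m * 2^-1 ^+ n) * `|s|^-1).
    by ring.
  apply: le_trans bS; rewrite -[leRHS]mulrA ler_wpM2l//.
  apply: ler_pM => //; rewrite ?mulr_ge0 ?exprn_ge0 ?invr_ge0//.
    exact: level_expr.
  by rewrite -[leRHS]invrK lef_pV2 ?posrE ?invr_gt0.
- apply: (@le_trans _ _ (#|[pred v : m.-tuple 'I_b | take j v == take j y]|%:R * K0)); last first.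
    by rewrite ler_wpM2r// -natrX ler_nat card_tuple_prefix.
  apply: (card_fibers_cond_le (P := P) (f := snd)) => [z /and3P[] //|v].
  apply: (@le_trans _ _ (#|[pred u : k.-tuple 'I_a |
      `|(s * word_pt v - c) + 1 * word_pt u| <= M * 2^-1 ^+ n]|%:R)).
    rewrite ler_nat; apply: leq_trans (leq_image_card (fun u => (u, v)) _).
    apply: subset_leq_card; apply/fintype.subsetP => -[u v'] /andP[/and3P[zn _ _] /eqP /= vv].
    apply/fintype.imageP; exists u; last by rewrite vv.
    rewrite inE; move: zn; rewrite /near_pairs /= vv mul1r.
    by congr (`|_| <= _); ring.
  apply: (le_trans (card_words_near a1 _ e0 (fun v => id))) => //.
  rewrite lerD2r -/k normr1 divr1; have := level_expr n a1 (R := R); rewrite -/k => h.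
  have := ler_wpM2l M0 h; lra.
Qed.

Lemma near_pairs_weight_le a b (p q S M : R) n (s c : R) (x : seq 'I_a) (y : seq 'I_b)
    (k := level a n) (m := level b n) (K0 := 2 * M * (a%:R + b%:R) * S + 1)
    (h := Num.max 0 (perc_dim a p + perc_dim b q - 1)) :
  (1 < a)%N -> (1 < b)%N -> 0 < p <= 1 -> 0 < q <= 1 -> 0 <= perc_dim a p ->
  1 <= S -> 0 <= M -> S^-1 <= `|s| ->
  \sum_(i < k.+1) \sum_(j < m.+1) p ^+ (k - i) * q ^+ (m - j) *
    #|[pred z : k.-tuple 'I_a * m.-tuple 'I_b | [&& near_pairs s c (M * 2^-1 ^+ n) z,
        take i z.1 == take i x & take j z.2 == take j y]]|%:R
  <= n.+1%:R ^+ 2 * (K0 * (b%:R * 2 ^+ n) `^ h).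
Proof.
move=> a1 b1 p01 q01 al0 S1 M0 Ss; have /andP[p0 p1] := p01; have /andP[q0 q1] := q01.
have K00 : 0 <= K0 by rewrite addr_ge0// !mulr_ge0//; lra.
have al1 := perc_dim_le1 a1 p01.
have h0 : 0 <= h by rewrite le_max lexx.
have hh : perc_dim a p + perc_dim b q - 1 <= h by rewrite le_max lexx orbT.
have b0 : 0 < b%:R :> R by rewrite ltr0n ltnW.
have a0 : 0 < a%:R :> R by rewrite ltr0n ltnW.
have term i j : p ^+ (k - i) * q ^+ (m - j) *
    #|[pred z : k.-tuple 'I_a * m.-tuple 'I_b | [&& near_pairs s c (M * 2^-1 ^+ n) z,
        take i z.1 == take i x & take j z.2 == take j y]]|%:R <= K0 * (b%:R * 2 ^+ n) `^ h.
  have [c1 c2] := near_pairs_prefix_le n c i j x y a1 b1 S1 M0 Ss.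
  set cnt := #|_| in c1 c2 *; rewrite -/k -/m -/K0 in c1 c2.
  pose A := a%:R ^+ (k - i) : R; pose B := b%:R ^+ (m - j) : R.
  have A0 : 0 < A by rewrite exprn_gt0.
  have B0 : 0 < B by rewrite exprn_gt0.
  have B1 : 1 <= B by rewrite exprn_ege1// ler1n ltnW.
  have K0p : 0 < K0 by rewrite ltr_wpDl// !mulr_ge0//; lra.
  (* The weights [1 - al] and [al] are chosen so that the power of [A] cancels against
     [p^(k - i) = A^(al - 1)]; what remains is [B^(al + be - 1) <= B^h]. *)
  have ci : cnt%:R / K0 <= A `^ (1 - perc_dim a p) * B `^ perc_dim a p.
    apply: le_interpolation => //; rewrite ?al0//.
    - by rewrite divr_ge0.
    - by rewrite ler_pdivrMr.
    - by rewrite ler_pdivrMr.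
  rewrite (expr_perc_dim _ a1 p0) (expr_perc_dim _ b1 q0) -/A -/B.
  apply: (@le_trans _ _ (A `^ (perc_dim a p - 1) * B `^ (perc_dim b q - 1) *
      (K0 * (A `^ (1 - perc_dim a p) * B `^ perc_dim a p)))).
    by rewrite ler_wpM2l ?mulr_ge0 ?powR_ge0// mulrC -ler_pdivrMr.
  have -> : A `^ (perc_dim a p - 1) * B `^ (perc_dim b q - 1) *
      (K0 * (A `^ (1 - perc_dim a p) * B `^ perc_dim a p)) =
      K0 * ((A `^ (perc_dim a p - 1) * A `^ (1 - perc_dim a p)) *
            (B `^ (perc_dim b q - 1) * B `^ perc_dim a p)) by ring.
  rewrite -!powRD; last 2 first.
  - by apply/implyP => _; rewrite gt_eqF.
  - by apply/implyP => _; rewrite gt_eqF.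
  rewrite (_ : perc_dim a p - 1 + (1 - perc_dim a p) = 0) ?powRr0 ?mul1r; last by ring.
  rewrite ler_wpM2l//; apply: (@le_trans _ _ (B `^ h)).
    by apply: ler_powR => //; apply: le_trans hh; rewrite addrAC [_ + perc_dim a p]addrC.
  apply: ge0_ler_powR; rewrite ?nnegrE ?mulr_ge0 ?exprn_ge0 ?(ltW B0) ?(ltW b0)//.
  apply: (@le_trans _ _ (b%:R ^+ m)).
    by rewrite ler_weXn2l ?ler1n ?(ltnW b1)// leq_subr.
  by have /andP[_] := levelP n b1; rewrite -(ler_nat R) natrM !natrX.
apply: (@le_trans _ _ (\sum_(i < k.+1) \sum_(j < m.+1) (K0 * (b%:R * 2 ^+ n) `^ h))).
  by apply: ler_sum => i _; apply: ler_sum => j _; exact: term.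
rewrite !sumr_const !card_ord -mulrnA -[leLHS]mulr_natl.
rewrite ler_wpM2r ?mulr_ge0 ?powR_ge0// expr2 -natrM ler_nat.
by rewrite leq_mul// ltnS leq_level_self.
Qed.

End strip_counts.

Section strip_probability.
Context {d : measure_display} {T : measurableType d} {R : realType}.
Variable P : probability T R.
Variables (a b : nat) (p q : R).
Variables (X : T -> seq 'I_a -> bool) (Y : T -> seq 'I_b -> bool).
Hypotheses (a1 : (1 < a)%N) (b1 : (1 < b)%N) (p01 : 0 < p <= 1) (q01 : 0 < q <= 1).
Hypothesis bXY : joint_bernoulli P p q X Y.
Hypothesis al0 : 0 <= perc_dim a p.

Definition excess : R := Num.max 0 (perc_dim a p + perc_dim b q - 1).

Definition crowded_strip (e : R) (n : nat) (s c M : R) : set T :=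
  [set w | (2 ^+ n) `^ (excess + e) <=
    #|surviving_pairs X Y (near_pairs (k := level a n) (m := level b n) s c (M * 2^-1 ^+ n)) w|%:R].

Lemma measurable_crowded_strip e n s c M : measurable (crowded_strip e n s c M).
Proof.
pose Q := near_pairs (a := a) (b := b) (k := level a n) (m := level b n) s c (M * 2^-1 ^+ n).
pose A z := if Q z then joint_survival X Y [:: word_pair z] else set0.
have mA z : measurable (A z).
  by rewrite /A; case: ifP => // _; exact: (measurable_joint_survival bXY).
have := measurable_card_ge ((2 ^+ n) `^ (excess + e)) mA.
congr (measurable _); apply/seteqP; split => w; rewrite /crowded_strip /= => /le_trans; apply;
  rewrite ler_nat; apply: subset_leq_card; apply/fintype.subsetP => z; rewrite !inE /A /Q /=;
  case: ifP => //= ? ; by rewrite ?in_set0.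
Qed.

(* Markov's inequality for a moment of order [r >= 6 / e]. *)
Lemma pr_crowded_strip (e S M : R) : 0 < e -> 1 <= S -> 0 <= M ->
  exists2 C : R, 0 <= C & forall n s c, S^-1 <= `|s| ->
    pr P (crowded_strip e n s c M) <= C * 8^-1 ^+ n.
Proof.
move=> e0 S1 M0; pose r := (Num.trunc (6 / e)).+1.
have re : 6 / e <= r%:R.
  by have /andP[_ /ltW] := @truncn_itv _ (6 / e) ltac:(by rewrite divr_ge0// ltW).
clearbody r; have h0 : 0 <= excess by rewrite le_max lexx.
(* The threshold is [2^(n h) y^(4 n)]. The factor [(n + 1)^2] uses up [y^(2 n)], so each order of
   the moment gains [y^(-2 n)], and [r e / 2 >= 3] turns [r] of these gains into [8^-n]. *)
pose y : R := 2 `^ (e / 4).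
have y1 : 1 < y.
  by rewrite /y powR_expR// expR_gt1 mulr_gt0 ?ln_gt0 ?ltr1n// divr_gt0.
have [C1 C10 HC1] := succn_le_expr y1.
pose K0 := 2 * M * (a%:R + b%:R) * S + 1 : R.
have K00 : 0 <= K0 by rewrite addr_ge0// !mulr_ge0//; lra.
pose D := r%:R ^+ 2 * (C1 ^+ 2 * (K0 * b%:R `^ excess)).
have D0 : 0 <= D by rewrite mulr_ge0 ?sqr_ge0// mulr_ge0 ?sqr_ge0// mulr_ge0 ?powR_ge0.
exists (D ^+ r); first exact: exprn_ge0.
move=> n s c Ss; pose N : R := (2 ^+ n) `^ (excess + e).
have N0 : 0 < N by rewrite powR_gt0// exprn_gt0.
have mB := measurable_crowded_strip e n s c M.
have := markov_moment bXY r [::] (ltW N0) mB.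
have -> : joint_survival X Y [::] = setT by apply/seteqP; split.
rewrite setIT => h1.
have h2 := moment_le p01 q01 bXY (fun x y => near_pairs_weight_le n c x y a1 b1 p01 q01 al0 S1 M0 Ss) r [::].
have {h1 h2} := le_trans h1 h2.
rewrite /survival_weight /= !expr0 !mul1r add0n -/K0 -/excess -/(crowded_strip e n s c M).
have y0 : 0 < y by exact: lt_trans y1.
have NE : N = (2 ^+ n) `^ excess * (y ^+ n) ^+ 4.
  rewrite /N powRD; last by apply/implyP => _; rewrite gt_eqF// exprn_gt0.
  congr (_ * _); rewrite powR_expn// -exprM mulnC exprM; congr (_ ^+ n).
  by rewrite /y -powR_mulrn ?powR_ge0// -powRrM; congr (_ `^ _); field.
have y8 : 8 <= (y ^+ 2) ^+ r.
  rewrite -exprM -powR_mulrn ?(ltW y0)// /y -powRrM.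
  rewrite (_ : 8 = 2 `^ 3%:R); last by rewrite powR_mulrn//; ring.
  apply: ler_powR; first by rewrite ler1n.
  by move: re; rewrite ler_pdivrMr// natrM; lra.
have yn0 : 0 < y ^+ n by rewrite exprn_gt0.
have n20 : 0 < (2 ^+ n : R) `^ excess by rewrite powR_gt0// exprn_gt0.
have step : r%:R ^+ 2 * (n.+1%:R ^+ 2 * (K0 * (b%:R * 2 ^+ n) `^ excess)) <=
    D * ((y ^+ 2)^-1) ^+ n * N.
  have -> : D * ((y ^+ 2)^-1) ^+ n * N =
      r%:R ^+ 2 * ((C1 * y ^+ n) ^+ 2 * (K0 * (b%:R `^ excess * (2 ^+ n) `^ excess))).
    rewrite NE /D exprVn [(y ^+ 2) ^+ n]exprAC; field.
    by rewrite gt_eqF// exprn_gt0.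
  rewrite ler_wpM2l ?sqr_ge0// powRM ?exprn_ge0// ler_wpM2r//.
    by rewrite !mulr_ge0 ?powR_ge0.
  by rewrite lerXn2r ?nnegrE// ltW// mulr_gt0.
clearbody D N.
rewrite mulrC -ler_pdivlMr ?exprn_gt0// => /le_trans; apply.
rewrite ler_pdivrMr ?exprn_gt0//.
apply: (@le_trans _ _ ((D * ((y ^+ 2)^-1) ^+ n * N) ^+ r)).
  have l0 := mulr_ge0 (sqr_ge0 (r%:R : R)) (mulr_ge0 (sqr_ge0 (n.+1%:R : R))
    (mulr_ge0 K00 (powR_ge0 (b%:R * 2 ^+ n) excess))).
  by rewrite lerXn2r ?nnegrE ?l0 ?(le_trans l0 step).
rewrite !exprMn ler_wpM2r ?exprn_ge0 ?(ltW N0)// ler_wpM2l ?exprn_ge0//.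
rewrite exprAC lerXn2r ?nnegrE ?exprn_ge0 ?invr_ge0 ?sqr_ge0//.
by rewrite exprVn lef_pV2 ?posrE ?exprn_gt0.
Qed.

End strip_probability.

Section strip_counts_ae.
Context {d : measure_display} {T : measurableType d} {R : realType}.
Variable P : probability T R.
Variables (a b : nat) (p q : R).
Variables (X : T -> seq 'I_a -> bool) (Y : T -> seq 'I_b -> bool).
Hypotheses (a1 : (1 < a)%N) (b1 : (1 < b)%N) (p01 : 0 < p <= 1) (q01 : 0 < q <= 1).
Hypothesis bXY : joint_bernoulli P p q X Y.
Hypothesis al0 : 0 <= perc_dim a p.

(** A net of order [4^n] strips, each crowded with probability of order [8^-n], leaves the summable
    bound [2^-n]. Any other strip is contained, as far as word pairs go, in a slightly wider strip
    of the net, because the points [word_pt] lie in [[0, 1]]. *)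
Lemma strip_counts_ae (S : nat) (e : R) : (0 < S)%N -> 0 < e ->
  {ae P, forall w, exists n0, forall n, (n0 <= n)%N -> forall s c : R,
    S%:R^-1 <= `|s| <= S%:R ->
    #|strip_words (survives (X w)) (survives (Y w)) (k := level a n) (m := level b n)
        s c ((2 + `|s|) * 2^-1 ^+ n)|%:R <= (2 ^+ n) `^ (excess a b p q + e)}.
Proof.
(* [S'] leaves room for the net point of [s] to be closer to 0 than [s]. [M] is [2 + S] plus 1 for
   moving [s] and 1 for moving [c]. A strip containing some pair has [|c| <= 1 + S + (2 + S)], which
   is [H]; the others need no bound. *)
move=> S0 e0; pose S' : R := 2 * S%:R; pose M : R := 4 + S%:R; pose H := (2 * S + 3)%N.
have S1 : 1 <= S%:R :> R by rewrite ler1n.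
have [||C C0 HC] := pr_crowded_strip a1 b1 p01 q01 bXY al0 e0 (S := S') (M := M).
- by rewrite /S'; lra.
- by rewrite /M; lra.
pose Z n : finType := ('I_(2 * S * 2 ^ n + 1) * 'I_(2 * H * 2 ^ n + 1))%type.
pose A n (z : Z n) : set T :=
  if S'^-1 <= `|dyadic_point S n z.1 : R| then
    crowded_strip p q X Y e n (dyadic_point S n z.1) (dyadic_point H n z.2) M
  else set0.
have mA n z : measurable (@A n z).
  by rewrite /A; case: ifP => // _; exact: (measurable_crowded_strip bXY).
pose F n := \bigcup_(z in [set: Z n]) A n z.
have mF n : measurable (F n) by apply: fin_bigcup_measurable => //; exact: finite_finset.
have [n1 Hn1] : exists n1, forall n, (n1 <= n)%N -> 2^-1 ^+ n <= S'^-1.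
  have S'0 : 0 < S'^-1 by rewrite invr_gt0 /S'; lra.
  have [n1 _ h] := near_infty_natSinv_expn_lt (PosNum S'0).
  by exists n1 => n /h /= /ltW; rewrite div1r exprVn.
pose D : R := (2 * S%:R + 1) * (2 * H%:R + 1).
have D0 : 0 <= D by rewrite mulr_ge0// addr_ge0// mulr_ge0.
have prF n : pr P (F n) <= D * C * 2^-1 ^+ n.
  have h1 : 1 * pr P (F n) <= \sum_z pr P (@A n z).
    apply: markov_card => // w [z _ Az]; rewrite ler1n; apply/card_gt0P.
    by exists z; rewrite inE; apply/mem_set.
  rewrite mul1r in h1; apply: (le_trans h1).
  apply: (@le_trans _ _ (\sum_(z : Z n) C * 8^-1 ^+ n)).
    apply: ler_sum => z _; rewrite /A; case: ifP => [/HC//|_].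
    by rewrite pr_set0 mulr_ge0// exprn_ge0// invr_ge0.
  rewrite sumr_const card_prod !card_ord -[leLHS]mulr_natl natrM !natrD !natrM !natrX.
  have e1 : 1 <= 2 ^+ n :> R by rewrite exprn_ege1// ler1n.
  have g (k : R) : 0 <= k -> 0 <= k * 2 ^+ n + 1 <= (k + 1) * 2 ^+ n.
    by move=> k0; rewrite addr_ge0 ?mulr_ge0 ?exprn_ge0//= mulrDl mul1r lerD2l.
  have /andP[g1 g2] := g (2 * S%:R) (mulr_ge0 (ler0n _ 2) (ler0n _ S)).
  have /andP[g3 g4] := g (2 * H%:R) (mulr_ge0 (ler0n _ 2) (ler0n _ H)).
  have q0 : 0 <= C * 8^-1 ^+ n by rewrite mulr_ge0// exprn_ge0// invr_ge0.
  apply: (le_trans (ler_wpM2r q0 (ler_pM g1 g3 g2 g4))).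
  rewrite le_eqVlt; apply/orP; left; apply/eqP.
  have -> : 8^-1 ^+ n = 2^-1 ^+ n * 2^-1 ^+ n * 2^-1 ^+ n :> R.
    by rewrite -!exprMn; congr (_ ^+ n); field.
  by rewrite /D exprVn; field; rewrite expf_neq0.
have half01 : 0 < (2^-1 : R) < 1 by rewrite invr_gt0 ltr0n/= invf_lt1// ltr1n.
have := geometric_borel_cantelli (mulr_ge0 D0 C0) half01 mF prF.
apply: filterS => w [n0 Hn0]; exists (maxn n0 n1) => n; rewrite geq_max => /andP[n0n n1n].
move=> s c /andP[Ss sS].
set Q := strip_words _ _ _ _ _.
have [z0|] := pickP Q; last first.
  by move=> Q0; rewrite eq_card0// powR_ge0.
move=> /and3P[_ _ /= z0c].
have e1 : 2^-1 ^+ n <= 1 :> R by rewrite exprn_ile1// ?invr_ge0// invf_le1// ler1n.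
have e00 : 0 < 2^-1 ^+ n :> R by rewrite exprn_gt0// invr_gt0.
have pt01 c' (u : seq 'I_c') : (1 < c')%N -> `|word_pt u : R| <= 1.
  by move=> c1; rewrite ger0_norm ?word_pt_ge0// word_pt_le1 ?(ltnW c1).
have cH : `|c| <= H%:R.
  have -> : c = word_pt z0.1 + s * word_pt z0.2 - (word_pt z0.1 + s * word_pt z0.2 - c) by ring.
  rewrite (le_trans (ler_normB _ _))// (le_trans (lerD (ler_normD _ _) z0c))//.
  have h1 := pt01 _ z0.1 a1; have h2 := pt01 _ z0.2 b1.
  rewrite normrM; have h3 : `|s| * `|word_pt z0.2 : R| <= S%:R * 1 by rewrite ler_pM.
  have h4 : (2 + `|s|) * 2^-1 ^+ n <= (2 + S%:R) * 1.
    by apply: ler_pM; rewrite ?addr_ge0 ?lerD2l ?(ltW e00).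
  by rewrite /H natrD natrM; lra.
have [i Hi] := dyadic_approx n cH.
have [j Hj] := dyadic_approx n sS.
have sj : S'^-1 <= `|dyadic_point S n j : R|.
  have := lerB_dist s (s - dyadic_point S n j); rewrite subKr.
  have /andP[h0 h1] := Hj; rewrite [X in _ - X]ger0_norm//; have h2 := Hn1 _ n1n.
  have SS : S%:R^-1 = S'^-1 + S'^-1 by rewrite /S'; field; rewrite pnatr_eq0 -lt0n.
  by lra.
rewrite leNgt; apply/negP => crowd; apply: (Hn0 _ n0n); exists (j, i) => //=.
rewrite /A /= sj /crowded_strip /=; apply: (le_trans (ltW crowd)); rewrite ler_nat.
apply: subset_leq_card; apply/fintype.subsetP => z.
rewrite !inE => /and3P[/asboolP Xz /asboolP Yz zc]; apply/andP; split; last first.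
  by apply/mem_set; rewrite /joint_survival /= Xz Yz.
rewrite /near_pairs /=.
have -> : word_pt z.1 + dyadic_point S n j * word_pt z.2 - dyadic_point H n i =
  (word_pt z.1 + s * word_pt z.2 - c) - ((s - dyadic_point S n j) * word_pt z.2) +
  (c - dyadic_point H n i) by ring.
rewrite (le_trans (ler_normD _ _))//.
have h1 := ler_normB (word_pt z.1 + s * word_pt z.2 - c) ((s - dyadic_point S n j) * word_pt z.2).
have h2 : `|(s - dyadic_point S n j) * word_pt z.2| <= 2^-1 ^+ n * 1.
  rewrite normrM ler_pM// ?pt01//; have /andP[h3 h4] := Hj; by rewrite ger0_norm.
have h3 : `|c - dyadic_point H n i| <= 2^-1 ^+ n.
  by have /andP[h3 h4] := Hi; rewrite ger0_norm.
have h4 : `|s| * 2^-1 ^+ n <= S%:R * 2^-1 ^+ n by rewrite ler_wpM2r// ltW.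
by rewrite /M; lra.
Qed.

End strip_counts_ae.

(** * Dimensions of the percolation sets and of their sums *)

Section assembly.
Context {R : realType}.

Lemma dim_squeeze (A : set R) (h : R) : A !=set0 ->
  (h%:E <= hausdorff_dim A)%E -> (upper_box_dim A <= h%:E)%E ->
  hausdorff_dim A = h%:E /\ has_dim A.
Proof.
move=> A0 hA Ah; have h1 := hausdorff_dim_le_lower A0; have h2 := lower_le_upper_box_dim A.
have e1 : hausdorff_dim A = h%:E.
  by apply/eqP; rewrite eq_le hA andbT (le_trans h1)// (le_trans h2).
split; first by [].
rewrite /has_dim e1; split; apply/eqP; rewrite eq_le.
  by rewrite (le_trans h2 Ah)/= -e1 h1.
by rewrite Ah/= (le_trans _ h2)// -e1.
Qed.

Lemma pow2_powRN n (x : R) : (2^-1 ^+ n) `^ (- x) = (2 ^+ n) `^ x.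
Proof.
by rewrite exprVn -powR_inv1 ?exprn_ge0// -powRrM mulN1r opprK.
Qed.

Lemma pow2_powR_ge1 n (x : R) : 0 <= x -> 1 <= (2 ^+ n) `^ x.
Proof.
move=> x0; have h : 1 <= 2 ^+ n :> R by rewrite exprn_ege1// ler1n.
by have := ler_powR h x0; rewrite powRr0.
Qed.

Section single.
Variables (a : nat) (Q : seq 'I_a -> Prop) (al : R).
Hypotheses (a1 : (1 < a)%N) (al0 : 0 < al).

Definition frostman_below : Prop := forall e : R, 0 < e ->
  exists g, [/\ 0 < g, al - e < g & frostman_words (word_tree Q) g].

Definition counted_above : Prop := forall e : R, 0 < e ->
  exists n0, forall n, (n0 <= n)%N ->
    (surviving_count Q (level a n))%:R <= (2 ^+ n) `^ (al + e).

Lemma counted_aboveE (e : R) : counted_above -> 0 < e -> exists2 C : R, 0 < C &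
  forall n, (surviving_count Q (level a n))%:R <= C * (2^-1 ^+ n) `^ (- (al + e)).
Proof.
move=> H e0; have [n0 Hn0] := H e e0; have ae0 : 0 <= al + e by rewrite addr_ge0 ?(ltW al0) ?(ltW e0).
pose C : R := 1 + \sum_(n < n0) (surviving_count Q (level a n))%:R.
have C1 : 1 <= C by rewrite lerDl sumr_ge0.
exists C => [|n]; first exact: lt_le_trans C1.
rewrite pow2_powRN; have p1 := pow2_powR_ge1 n ae0.
have [n0n|nn0] := leqP n0 n.
  by rewrite (le_trans (Hn0 n n0n))// ler_peMl// (le_trans ler01).
have : (surviving_count Q (level a n))%:R <= C.
  by rewrite /C (bigD1 (Ordinal nn0))//= addrCA lerDl addr_ge0// sumr_ge0.
by move=> /le_trans; apply; rewrite ler_peMr// (le_trans ler01).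
Qed.

Lemma percolation_dim : word_tree Q !=set0 -> frostman_below -> counted_above ->
  hausdorff_dim (@coding_map R a @` word_tree Q) = al%:E /\
  has_dim (@coding_map R a @` word_tree Q).
Proof.
move=> [i Qi] Hf Hc; apply: dim_squeeze; first by exists (coding_map i); exists i.
  apply: le_hausdorff_dim_approx => t t0 tal.
  have [|g [g0 g1 Hg]] := Hf (al - t); first by rewrite subr_gt0.
  apply: le_trans (frostman_hausdorff_dim a1 g0 Hg); rewrite lee_fin; lra.
apply/lee_addgt0Pr => e e0; rewrite -EFinD.
have [C C0 HC] := counted_aboveE Hc e0.
by apply: coding_upper_box_dim HC => //; rewrite addr_ge0 ?(ltW e0) ?(ltW al0).
Qed.

End single.

Lemma percolation_sum_dim (a b : nat) (Q : seq 'I_a -> Prop) (Q' : seq 'I_b -> Prop)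
    (al be s : R) (h := Num.max 0 (al + be - 1)) : (1 < a)%N -> (1 < b)%N -> 0 < al -> 0 < be ->
  word_tree Q !=set0 -> word_tree Q' !=set0 ->
  frostman_below Q al -> frostman_below Q' be -> counted_above Q al -> counted_above Q' be ->
  (forall e : R, 0 < e -> exists n0, forall n, (n0 <= n)%N -> forall c,
     #|strip_words Q Q' (k := level a n) (m := level b n) s c ((2 + `|s|) * 2^-1 ^+ n)|%:R <=
       (2 ^+ n) `^ (h + e)) ->
  hausdorff_dim (scaled_sum (@coding_map R a @` word_tree Q) s (@coding_map R b @` word_tree Q')) =
    (Num.min 1 (al + be))%:E /\
  has_dim (scaled_sum (@coding_map R a @` word_tree Q) s (@coding_map R b @` word_tree Q')).
Proof.
move=> a1 b1 al0 be0 [i Qi] [j Qj] Hf Hf' Hc Hc' Hs.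
have h0 : 0 <= h by rewrite le_max lexx.
have mh : Num.min 1 (al + be) = al + be - h.
  by rewrite /h; case: (leP 1 (al + be)) => H; case: (leP 0 (al + be - 1)) => H'; lra.
apply: dim_squeeze.
- by exists (coding_map i + s * coding_map j); exists (coding_map i);
    [exists i|exists (coding_map j) => //; exists j].
- apply: le_hausdorff_dim_approx => t t0 th; rewrite mh in th.
  (* Three losses of at most [e]: one for each tree and one in the strip count. *)
  pose e := (al + be - h - t) / 3; have e0 : 0 < e by rewrite divr_gt0//; lra.
  have [g [g0 g1 Hg]] := Hf e e0; have [g' [g0' g1' Hg']] := Hf' e e0.
  have [n0 Hn0] := Hs e e0; have he0 : 0 <= h + e by rewrite addr_ge0 ?(ltW e0).
  have E3 : 3 * e = al + be - h - t by rewrite /e; field.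
  (* The levels below [n0] are absorbed by counting all pairs of words. *)
  pose C : R := 1 + \sum_(n < n0) #|{: (level a n).-tuple 'I_a * (level b n).-tuple 'I_b}|%:R.
  have C1 : 1 <= C by rewrite lerDl sumr_ge0.
  have C0 : 0 < C by exact: lt_le_trans C1.
  apply: (@le_trans _ _ (g + g' - (h + e))%:E); first by rewrite lee_fin; lra.
  apply: (frostman_sum_hausdorff_dim (C0 := C)) => //; first lra.
  move=> n c; rewrite pow2_powRN; have p1 := pow2_powR_ge1 n he0.
  have [n0n|nn0] := leqP n0 n.
    by rewrite (le_trans (Hn0 n n0n c))// ler_peMl// (le_trans ler01).
  apply: (@le_trans _ _ C); last by rewrite ler_peMr// (le_trans ler01).
  apply: (@le_trans _ _ #|{: (level a n).-tuple 'I_a * (level b n).-tuple 'I_b}|%:R).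
    by rewrite ler_nat max_card.
  by rewrite /C (bigD1 (Ordinal nn0))//= addrCA lerDl addr_ge0// sumr_ge0.
- have [n sn] : exists n : nat, `|s| <= n%:R.
    exists (Num.trunc `|s|).+1; have /andP[_ /ltW //] := truncn_itv (normr_ge0 s).
  rewrite -[X in (_ <= X%:E)%E]/(Num.min 1 (al + be)).
  (* When the minimum is 1, boundedness of the sum set suffices; otherwise products of cells cover
     it. *)
  case: (leP 1 (al + be)) => _.
    apply: (@bounded_upper_box_dim _ _ n.+1) => _ [_ [x _ <-] [_ [y _ <-] <-]].
    have /andP[x0 x1] := coding_map01 x (ltnW a1) (R := R).
    have /andP[y0 y1] := coding_map01 y (ltnW b1) (R := R).
    rewrite (le_trans (ler_normD _ _))// normrM (ger0_norm x0) (ger0_norm y0) -natr1 addrC.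
    by apply: lerD => //; rewrite -[leRHS]mulr1 ler_pM.
  apply/lee_addgt0Pr => e e0; rewrite -EFinD.
  have e20 : 0 < e / 2 by rewrite divr_gt0.
  have [C C0 HC] := counted_aboveE al0 Hc e20; have [C' C0' HC'] := counted_aboveE be0 Hc' e20.
  rewrite (_ : al + be + e = (al + e / 2) + (be + e / 2)); last by field.
  by apply: sum_upper_box_dim HC HC' => //; rewrite addr_ge0 ?(ltW e20) ?(ltW al0) ?(ltW be0).
Qed.

End assembly.

Section survivor_counts.
Context {d : measure_display} {T : measurableType d} {R : realType}.
Variable P : probability T R.
Variables (a : nat) (p : R) (X : T -> seq 'I_a -> bool).
Hypotheses (a1 : (1 < a)%N) (p01 : 0 < p <= 1) (bX : bernoulli P p X).
Hypothesis al0 : 0 < perc_dim a p.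

(** The mean count at level [k] is [(a p)^k = (a^k)^al], of order at most [2^(n al)]; exceeding it
    by the factor [2^(n e)] has summable probability. *)
Lemma counted_above_ae_at (e : R) : 0 < e ->
  {ae P, forall w, exists n0, forall n, (n0 <= n)%N ->
    (surviving_count (survives (X w)) (level a n))%:R <= (2 ^+ n) `^ (perc_dim a p + e)}.
Proof.
move=> e0; have /andP[p0 p1] := p01.
pose N n : R := (2 ^+ n) `^ (perc_dim a p + e).
have N0 n : 0 < N n by rewrite powR_gt0// exprn_gt0.
pose A n (v : (level a n).-tuple 'I_a) : set T := [set w | survives (X w) v].
have mA n v : measurable (@A n v) by exact: (pr_depends bX (depends_survives (v := v))).1.
pose F n := [set w | N n <= #|[pred v | w \in @A n v]|%:R].
have mF n : measurable (F n) by exact: measurable_card_ge.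
have prF n : pr P (F n) <= a%:R `^ perc_dim a p * (2 `^ (- e)) ^+ n.
  have h := markov_card P (ltW (N0 n)) (mA n) (mF n) (fun w Fw => Fw).
  have a0 : 0 < a%:R :> R by rewrite ltr0n ltnW.
  rewrite -(ler_pM2l (N0 n)); apply: (le_trans h).
  under eq_bigr do rewrite /A (pr_survives _ bX) size_tuple.
  rewrite sumr_const card_tuple card_ord -[leLHS]mulr_natl natrX (expr_perc_dim _ a1 p0).
  set k := level a n.
  have -> : a%:R ^+ k * (a%:R ^+ k) `^ (perc_dim a p - 1) = (a%:R ^+ k) `^ perc_dim a p.
    rewrite -[X in X * _]powRr1 ?exprn_ge0 ?(ltW a0)// -powRD; last first.
      by apply/implyP => _; rewrite gt_eqF// exprn_gt0.
    by congr (_ `^ _); ring.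
  apply: (@le_trans _ _ ((a%:R * 2 ^+ n) `^ perc_dim a p)).
    apply: ge0_ler_powR; rewrite ?nnegrE ?mulr_ge0 ?exprn_ge0 ?(ltW a0) ?(ltW al0)//.
    by have /andP[_] := levelP n a1; rewrite -(ler_nat R) natrM !natrX.
  rewrite powRM ?exprn_ge0 ?(ltW a0)// /N powRD; last first.
    by apply/implyP => _; rewrite gt_eqF// exprn_gt0.
  rewrite -powR_expn// mulrCA -[X in _ <= _ * (X)]mulrA -powRD; last first.
    by apply/implyP => _; rewrite gt_eqF// exprn_gt0.
  by rewrite subrr powRr0 mulr1 mulrC.
have r01 : 0 < (2 : R) `^ (- e) < 1.
  by rewrite powR_gt0//= powR_expR// expR_lt1 mulNr oppr_lt0 mulr_gt0 ?ln_gt0 ?ltr1n.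
have := geometric_borel_cantelli (powR_ge0 _ _) r01 mF prF.
apply: filterS => w [n0 Hn0]; exists n0 => n n0n; rewrite leNgt; apply/negP => h.
apply: (Hn0 n n0n); rewrite /F /=; apply: (le_trans (ltW h)); rewrite ler_nat /surviving_count.
apply: subset_leq_card; apply/fintype.subsetP => v; rewrite !inE => /asboolP sv.
exact/mem_set.
Qed.

Lemma counted_above_ae :
  {ae P, forall w, counted_above (survives (X w)) (perc_dim a p)}.
Proof.
have h : {ae P, forall w, forall N : nat, exists n0, forall n, (n0 <= n)%N ->
    (surviving_count (survives (X w)) (level a n))%:R <=
      (2 ^+ n) `^ (perc_dim a p + N.+1%:R^-1)}.
  by apply: ae_foralln => N; apply: counted_above_ae_at; rewrite invr_gt0.
apply: filterS h => w H e e0.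
have [N HN] : exists N : nat, N.+1%:R^-1 <= e.
  have [N _ /(_ N (leqnn _)) /= h] := near_infty_natSinv_lt (PosNum e0).
  by exists N; exact: ltW.
have [n0 Hn0] := H N; exists n0 => n /Hn0/le_trans; apply.
by apply: ler_powR; [rewrite exprn_ege1// ler1n|rewrite lerD2l].
Qed.

Lemma frostman_below_ae :
  {ae P, forall w, word_tree (survives (X w)) !=set0 ->
     frostman_below (survives (X w)) (perc_dim a p)}.
Proof.
have /andP[p0 p1] := p01.
have ap1 : 1 < a%:R * p by rewrite -perc_dim_gt0.
pose C : R := a%:R * p / (a%:R * p - 1); pose x0 : R := (8 * C)^-1.
have x00 : 0 < x0 by rewrite invr_gt0 mulr_gt0// divr_gt0//; lra.
(* Countably many positive exponents increasing to [perc_dim a p], so that one null set serves them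
   all. *)
have h : {ae P, forall w, forall N : nat, word_tree (survives (X w)) !=set0 ->
    frostman_words (word_tree (survives (X w))) (perc_dim a p * (1 - N.+2%:R^-1))}.
  apply: ae_foralln => N; set g := perc_dim a p * _.
  have g0 : 0 <= g.
    by rewrite mulr_ge0 ?(ltW al0)// subr_ge0 invf_le1// ler1n.
  have gal : g < perc_dim a p.
    by rewrite /g mulrBr mulr1 ltrBlDr ltrDl mulr_gt0// invr_gt0.
  have [K [L [K0 L0 KL x1 x2]]] := branching_parameters a1 p0 x00 g0 gal.
  have := survival_very_good a1 p01 bX x00
    (fun j => good_pr_ge p01 bX j ap1 x1 x2).
  apply: filterS => w H tw; have [u [su gu]] := H tw.
  exact: (good_frostman a1 K0 L0 g0 KL su gu).
apply: filterS h => w H tw e e0.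
have [N HN] : exists N : nat, N.+1%:R^-1 < e / perc_dim a p.
  have e1 : 0 < e / perc_dim a p by rewrite divr_gt0.
  have [N _ /(_ N (leqnn _)) /= h] := near_infty_natSinv_lt (PosNum e1).
  by exists N.
exists (perc_dim a p * (1 - N.+2%:R^-1)); split; last exact: H.
- by rewrite mulr_gt0// subr_gt0 invf_lt1// ltr1n.
- have h1 : N.+2%:R^-1 <= N.+1%:R^-1 :> R by rewrite lef_pV2 ?posrE// ler_nat.
  have := le_lt_trans h1 HN; rewrite ltr_pdivlMr// => h2.
  by rewrite mulrBr mulr1 ltrD2l ltrN2 mulrC.
Qed.

End survivor_counts.

(** * From the weights to independent open words *)

Section weights.
Context {d : measure_display} {T : measurableType d} {R : realType}.
Variable P : probability T R.

Definition open_edge (a : nat) (V : seq 'I_a -> {RV P >-> R}) (w : T) (u : seq 'I_a) : bool :=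
  0 < V u w.

Lemma pos_preimage (f : {RV P >-> R}) :
  [set w | 0 < f w] = f @^-1` `]0, +oo[%classic.
Proof. by apply/seteqP; split => w /=; rewrite in_itv/= andbT. Qed.

Section one_family.
Variables (a : nat) (p : R) (V : seq 'I_a -> {RV P >-> R}).
Hypotheses (p01 : 0 < p <= 1) (hV : mandelbrot_weights p V).

Lemma measurable_open_edge u : measurable [set w | open_edge V w u].
Proof.
rewrite /open_edge (pos_preimage (V u)) -[_ @^-1` _]setTI.
exact: (measurable_funPT (V u)).
Qed.

Lemma measurable_weight_eq u (x : R) : measurable (V u @^-1` [set x]).
Proof. by rewrite -[_ @^-1` _]setTI; exact: (measurable_funPT (V u)). Qed.

(** The event lies between [V u = 1/p] and the complement of [V u = 0], both of probability [p]. *)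
Lemma pr_open_edge u : pr P [set w | open_edge V w u] = p.
Proof.
have /andP[p0 p1] := p01; have [h1 h0] := hV.1 u.
have m1 := measurable_weight_eq u p^-1; have m0 := measurable_weight_eq u 0.
have mo := measurable_open_edge u.
apply/eqP; rewrite eq_le; apply/andP; split.
  have := le_pr P mo (measurableC m0); rewrite pr_setC// [pr P (V u @^-1` _)]/pr h0/=.
  rewrite opprB addrC subrK; apply => w /=; rewrite /open_edge => + V0.
  by rewrite V0 ltxx.
have := le_pr P m1 mo; rewrite [pr P (V u @^-1` _)]/pr h1/=; apply => w /=.
by rewrite /open_edge => ->; rewrite invr_gt0.
Qed.

Lemma all_open_bigcap S :
  [set w | all (open_edge V w) S] = \bigcap_(u in [set` S]) (V u @^-1` `]0, +oo[%classic).
Proof.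
apply/seteqP; split => w /=.
  by move=> /allP h u /h; rewrite /= in_itv/= andbT.
by move=> h; apply/allP => u /h; rewrite /= in_itv/= andbT.
Qed.

Lemma pr_all_open S : uniq S -> pr P [set w | all (open_edge V w) S] = p ^+ size S.
Proof.
move=> uS; have mS := measurable_all S measurable_open_edge.
apply: EFin_inj; rewrite prE// all_open_bigcap.
rewrite (hV.2 S (fun=> `]0, +oo[%classic) uS)//.
rewrite (eq_bigr (fun=> p%:E)) => [|u _].
  by elim: S {uS mS} => [|u S IH]; rewrite ?big_nil// big_cons IH -EFinM -exprS.
rewrite -pos_preimage -(prE P (measurable_open_edge u)); congr (_%:E).
exact: pr_open_edge.
Qed.

Lemma bernoulli_open_edge : bernoulli P p (open_edge V).
Proof. by split; [exact: measurable_open_edge|exact: pr_all_open]. Qed.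

(** [measurable_all] is applied to the generated sigma-algebra instead of the ambient one. *)
Lemma family_all_open S : family_sigma_algebra V [set w | all (open_edge V w) S].
Proof.
pose G := \bigcup_i preimage_set_system setT (V i) measurable.
rewrite -[family_sigma_algebra V _]/((@measurable _ (g_sigma_algebraType G)) _).
apply: (@measurable_all _ (g_sigma_algebraType G)) => u.
apply: sub_sigma_algebra; exists u => //; exists `]0, +oo[%classic => //.
by rewrite setTI -pos_preimage.
Qed.

(** The law fixes each weight up to a null set depending on [u]; words are countable, so one null
    set does for all. *)
Lemma weights_two_valued : {ae P, forall w, forall u, V u w = p^-1 \/ V u w = 0}.
Proof.
have /andP[p0 p1] := p01.
have h : {ae P, forall w, forall n : nat, forall u : seq 'I_a,
    choice.unpickle n = Some u -> V u w = p^-1 \/ V u w = 0}.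
  apply: ae_foralln => n; case: (choice.unpickle n) => [u|]; last by apply: aeW.
  have [h1 h0] := hV.1 u.
  have m1 := measurable_weight_eq u p^-1; have m0 := measurable_weight_eq u 0.
  have mU := measurableU _ _ m1 m0.
  have dis : V u @^-1` [set p^-1] `&` V u @^-1` [set 0] = set0.
    apply/seteqP; split => // w [/= -> /eqP]; rewrite invr_eq0 => /eqP p00.
    by rewrite p00 ltxx in p0.
  have PU : P (V u @^-1` [set p^-1] `|` V u @^-1` [set 0]) = (p%:E + (1 - p)%:E)%E.
    by rewrite -h1 -h0; exact: measureU.
  exists (~` ((V u @^-1` [set p^-1]) `|` (V u @^-1` [set 0]))); split.
  - exact: measurableC.
  - apply: (etrans (probability_setC P mU)).
    by rewrite PU -EFinD (addrC p) subrK subrr.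
  - by move=> w /= H V10; apply: H => _ [<-]; exact: V10.
by apply: filterS h => w H u; exact: (H (choice.pickle u) u (choice.pickleK u)).
Qed.

Lemma take_mkseq (i : nat -> 'I_a) k n : (k <= n)%N -> take k (mkseq i n) = mkseq i k.
Proof. by move=> kn; rewrite /mkseq -map_take take_iota (minn_idPl kn). Qed.

Lemma surviving_wordsE w : (forall u, V u w = p^-1 \/ V u w = 0) ->
  surviving_words V w = word_tree (survives (open_edge V w)).
Proof.
have /andP[p0 p1] := p01; move=> H.
have V0 u : 0 <= V u w by case: (H u) => ->; rewrite ?invr_ge0 ?(ltW p0).
have sE i n : survives (open_edge V w) (mkseq i n) =
    all (fun k => 0 < V (mkseq i k) w) (index_iota 1 n.+1).
  rewrite /survives size_mkseq /index_iota subn1 /=; apply: eq_in_all => k.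
  by rewrite mem_iota add1n ltnS => /andP[_ kn]; rewrite /open_edge take_mkseq.
apply/seteqP; split => i hi.
  move=> [|n]; first by [].
  have := hi n.+1 isT; rewrite sE; set r := index_iota _ _; elim: r => // k r IH /=.
  rewrite big_cons => h; have Vk : 0 < V (mkseq i k) w.
    by rewrite lt_neqAle V0 andbT eq_sym; apply: contraTneq h => ->; rewrite mul0r ltxx.
  by rewrite Vk/= IH//; move: h; rewrite pmulr_rgt0.
move=> n _; have := hi n; rewrite sE => /allP h.
by rewrite big_seq_cond; apply: prodr_gt0 => k; rewrite andbT => /h.
Qed.

End one_family.

Lemma joint_open_edge (a b : nat) (p q : R) (V : seq 'I_a -> {RV P >-> R})
    (W : seq 'I_b -> {RV P >-> R}) : 0 < p <= 1 -> 0 < q <= 1 ->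
  mandelbrot_weights p V -> mandelbrot_weights q W -> independent_families V W ->
  joint_bernoulli P p q (open_edge V) (open_edge W).
Proof.
move=> p01 q01 hV hW hVW; split; [exact: measurable_open_edge|exact: measurable_open_edge|].
move=> S S' uS uS'.
have mS := measurable_all S (measurable_open_edge V).
have mS' := measurable_all S' (measurable_open_edge W).
rewrite -(pr_all_open p01 hV uS) -(pr_all_open q01 hW uS').
rewrite (_ : [set w | _ && _] =
  [set w | all (open_edge V w) S] `&` [set w | all (open_edge W w) S']); last first.
  by apply/seteqP; split => w /= /andP.
apply: EFin_inj; rewrite EFinM !prE//; last exact: measurableI.
by apply: hVW; exact: family_all_open.
Qed.

End weights.

Theorem corollary1p12 (R : realType) (d : measure_display)
    (T : measurableType d) (P : probability T R)
    (a b : nat) (p p' : R)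
    (V : seq 'I_a -> {RV P >-> R}) (W : seq 'I_b -> {RV P >-> R})
    (ha : (2 <= a)%N) (hb : (2 <= b)%N)
    (hp : 0 < p <= 1) (hp' : 0 < p' <= 1)
    (hV : mandelbrot_weights p V) (hW : mandelbrot_weights p' W)
    (hVW : independent_families V W)
    (hab : irrational (ln a%:R / ln b%:R : R)) :
  {ae P, forall w : T,
    percolation_set V w !=set0 -> percolation_set W w !=set0 ->
    forall s : R, s != 0 ->
      [/\ has_dim (percolation_set V w),
          has_dim (percolation_set W w),
          has_dim (scaled_sum (percolation_set V w) s (percolation_set W w)),
          fractal_dim (scaled_sum (percolation_set V w) s (percolation_set W w)) =
            Order.min 1%E
              (fractal_dim (percolation_set V w) + fractal_dim (percolation_set W w))%E
        & Order.min 1%E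
            (fractal_dim (percolation_set V w) + fractal_dim (percolation_set W w))%E =
          (Num.min 1 (2 + ln p / ln a%:R + ln p' / ln b%:R))%:E]}.
Proof.
have bV := bernoulli_open_edge hp hV; have bW := bernoulli_open_edge hp' hW.
have bVW := joint_open_edge hp hp' hV hW hVW.
have tV := weights_two_valued hp hV; have tW := weights_two_valued hp' hW.
have [p0 _] := andP hp; have [p0' _] := andP hp'.
(* Nonpositive exponent means [a p <= 1]: the tree dies out almost surely, and nonemptiness fails
   off a null set. *)
have [al0|al0] := leP (perc_dim a p) 0.
  have ap : a%:R * p <= 1 by rewrite leNgt -perc_dim_gt0// -leNgt.
  have ext : {ae P, forall w, ~ (word_tree (survives (open_edge V w)) !=set0)}.
    have [N [mN N0 HN]] := subcritical_extinction ha hp bV ap.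
    by exists N; split => // w /= /contrapT; exact: HN.
  apply: filterS (filterI tV ext) => w [/(surviving_wordsE hp) E nw] [_ [i + _]].
  by rewrite E => Hi; exfalso; apply: nw; exists i.
have [be0|be0] := leP (perc_dim b p') 0.
  have ap : b%:R * p' <= 1 by rewrite leNgt -perc_dim_gt0// -leNgt.
  have ext : {ae P, forall w, ~ (word_tree (survives (open_edge W w)) !=set0)}.
    have [N [mN N0 HN]] := subcritical_extinction hb hp' bW ap.
    by exists N; split => // w /= /contrapT; exact: HN.
  apply: filterS (filterI tW ext) => w [/(surviving_wordsE hp') E nw] _ [_ [i + _]].
  by rewrite E => Hi; exfalso; apply: nw; exists i.
(* The ranges [1/(S+1) <= |s| <= S+1] exhaust all [s != 0], and the errors [1/(N+1)] tend to 0; both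
   families are countable. *)
have st : {ae P, forall w, forall S N : nat, exists n0, forall n, (n0 <= n)%N ->
    forall s c : R, S.+1%:R^-1 <= `|s| <= S.+1%:R ->
    #|strip_words (survives (open_edge V w)) (survives (open_edge W w))
        (k := level a n) (m := level b n) s c ((2 + `|s|) * 2^-1 ^+ n)|%:R <=
      (2 ^+ n) `^ (excess a b p p' + N.+1%:R^-1)}.
  apply: ae_foralln => S; apply: ae_foralln => N.
  by apply: (strip_counts_ae ha hb hp hp' bVW (ltW al0)); rewrite ?invr_gt0.
have aeF : Filter (nbhs (almost_everywhere P)) by typeclasses eauto.
have aeI A B := @filterI _ _ aeF A B.
have fr := aeI _ _ (frostman_below_ae ha hp bV al0) (frostman_below_ae hb hp' bW be0).
have co := aeI _ _ (counted_above_ae ha hp bV al0) (counted_above_ae hb hp' bW be0).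
have all_ae := aeI _ _ (aeI _ _ tV tW) (aeI _ _ st (aeI _ _ fr co)).
apply: filterS all_ae => w [[/(surviving_wordsE hp) EV /(surviving_wordsE hp') EW] [Hst [[fV fW] [cV cW]]]].
rewrite /percolation_set EV EW => -[_ [i Hi _]] [_ [j Hj _]] s s0.
have nV : word_tree (survives (open_edge V w)) !=set0 by exists i.
have nW : word_tree (survives (open_edge W w)) !=set0 by exists j.
have [dV hdV] := percolation_dim ha al0 nV (fV nV) cV.
have [dW hdW] := percolation_dim hb be0 nW (fW nW) cW.
have [|dS hdS] := percolation_sum_dim (s := s) ha hb al0 be0 nV nW (fV nV) (fW nW) cV cW.
  move=> e e0.
  have [N HN] : exists N : nat, N.+1%:R^-1 <= e.
    have [N _ /(_ N (leqnn _)) /= h] := near_infty_natSinv_lt (PosNum e0).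
    by exists N; exact: ltW.
  have sp : 0 < `|s| by rewrite normr_gt0.
  pose S := (Num.trunc `|s| + Num.trunc `|s|^-1)%N.
  have sS : `|s| <= S.+1%:R.
    have /andP[_ /ltW /le_trans] := truncn_itv (ltW sp); apply.
    by rewrite ler_nat ltnS leq_addr.
  have sS' : S.+1%:R^-1 <= `|s|.
    rewrite -[leRHS]invrK lef_pV2 ?posrE ?invr_gt0//.
    have si : 0 <= `|s|^-1 by rewrite invr_ge0 ltW.
    have /andP[_ /ltW /le_trans] := truncn_itv si; apply.
    by rewrite ler_nat ltnS leq_addl.
  have [n0 Hn0] := Hst S N; exists n0 => n n0n c.
  apply: (le_trans (Hn0 n n0n s c _)); first by rewrite sS sS'.
  by apply: ler_powR; [rewrite exprn_ege1// ler1n|rewrite lerD2l].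
have minE : Order.min 1%E ((perc_dim a p)%:E + (perc_dim b p')%:E)%E =
    (Num.min 1 (perc_dim a p + perc_dim b p'))%:E by rewrite -EFinD -EFin_min.
rewrite /fractal_dim dV dW dS; split => //.
rewrite minE; congr (Num.min 1 _)%:E; rewrite /perc_dim; ring.
Qed.
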